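(* Let $H(\mathbb{Z})$ be the integer Heisenberg group ($3\times 3$ upper unitriangular integer matrices). For every finite symmetric generating set $S$ of $H(\mathbb{Z})$, the Cayley graph of $(H(\mathbb{Z}),S)$ is almost convex: for every $k$ there is a constant $N(k)$ such that for every $n$ and any two group elements $g_1,g_2$ with $|g_1|_S=|g_2|_S=n$ and word distance at most $k$ from each other, there is a path in the Cayley graph of length at most $N(k)$ connecting $g_1$ and $g_2$ and contained in the ball of radius $n$ about the identity.
   Context: $|g|_S$ is the word length of $g$ with respect to $S$, and the word distance is the path distance in the Cayley graph. A metric space is almost convex $(k)$, written $AC(k)$, if there is a constant $N(k)$ such that for any two points $x,y$ on a common metric sphere $S_n(x_0)$ with $d(x,y)\le k$, there is a path of length at most $N(k)$ connecting $x$ and $y$ inside the closed ball $B_n(x_0)$. For Cayley graphs of finitely generated groups, $AC(2)$ implies $AC(k)$ for all $k$ (a known result of Cannon), and the group with its generating set is then called almost convex. *)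

(* Defs.v *)
From HB Require Import structures.
From mathcomp Require Import all_boot all_order all_algebra.
From mathcomp Require Import boolp finmap.
From mathcomp Require Import zify.

Set Implicit Arguments.
Unset Strict Implicit.
Unset Printing Implicit Defensive.

Import GRing.Theory.

Local Open Scope ring_scope.

Definition unitriangular (A : 'M[int]_3) : bool :=
  [forall i : 'I_3, forall j : 'I_3, (j <= i)%N ==> (A i j == (i == j)%:R)].

Record heisenberg : predArgType :=
  Heisenberg { hmx :> 'M[int]_3; hmx_unitriangular : unitriangular hmx }.

HB.instance Definition _ := [isSub for hmx].
HB.instance Definition _ := [Choice of heisenberg by <:].

Lemma unitriangularP (A : 'M[int]_3) :
  reflect (forall i j : 'I_3, (j <= i)%N -> A i j = (i == j)%:R)
          (unitriangular A).
Proof.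
apply: (iffP forallP) => [h i j ji|h i].
  by have /forallP/(_ j)/implyP/(_ ji)/eqP := h i.
by apply/forallP => j; apply/implyP => ji; rewrite h.
Qed.

Lemma unitriangular1 : unitriangular 1%:M.
Proof. by apply/unitriangularP => i j _; rewrite mxE. Qed.

Lemma unitriangularM (A B : 'M[int]_3) :
  unitriangular A -> unitriangular B -> unitriangular (A *m B).
Proof.
move=> /unitriangularP hA /unitriangularP hB; apply/unitriangularP => i j ji.
rewrite mxE (bigD1 i) //= hA // eqxx mul1r big1 => [|k ki]; 
  first by rewrite hB // addr0.
have [lki|lik] := leqP k i.
  by rewrite hA // eq_sym (negbTE ki) mul0r.
have jk : (j < k)%N by apply: leq_ltn_trans lik.
by rewrite [B k j]hB ?(ltnW jk) // -val_eqE gtn_eqF // mulr0.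
Qed.

Lemma unitriangular_trig (A : 'M[int]_3) :
  unitriangular A -> is_trig_mx A^T.
Proof.
move=> /unitriangularP hA; apply/is_trig_mxP => i j ij.
by rewrite mxE hA ?(ltnW ij) // -val_eqE gtn_eqF.
Qed.

Lemma unitriangular_det (A : 'M[int]_3) : unitriangular A -> \det A = 1.
Proof.
move=> uA; rewrite -det_tr det_trig ?unitriangular_trig //.
by apply: big1 => i _; rewrite mxE; move/unitriangularP: uA => ->; rewrite ?eqxx.
Qed.

Lemma unitriangular_unit (A : 'M[int]_3) : unitriangular A -> A \in unitmx.
Proof. by move=> uA; rewrite unitmxE unitriangular_det. Qed.

Lemma unitriangularV (A : 'M[int]_3) :
  unitriangular A -> unitriangular (invmx A).
Proof.
move=> uA; have AU := unitriangular_unit uA.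
pose N := 1%:M - A; have defA : A = 1%:M - N by rewrite subKr.
have N0 (i j : 'I_3) : (j <= i)%N -> N i j = 0.
  by move=> ji; rewrite !mxE (unitriangularP _ uA) // subrr.
clearbody N; pose B := 1%:M + N + N *m N.
have NN0 (i j : 'I_3) : (j <= i.+1)%N -> (N *m N) i j = 0.
  move=> ji; rewrite mxE big1 // => k _.
  have [ki|ik] := leqP k i; first by rewrite N0 ?mul0r.
  by rewrite [N k j]N0 ?mulr0 // (leq_trans ji).
have NNN0 : N *m N *m N = 0.
  apply/matrixP => i j; rewrite mxE mxE big1 // => k _.
  have [ki|ik] := leqP k i.+1; first by rewrite NN0 ?mul0r.
  rewrite [N k j]N0 ?mulr0 //; have := ltn_ord j; have := ltn_ord k; lia.
have AB : B *m A = 1%:M.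
  rewrite defA /B mulmxBr mulmx1 !mulmxDl mul1mx NNN0 addr0 -[1%:M + N + _]addrA.
  exact: addrK.
have -> : invmx A = B by rewrite -[LHS]mul1mx -AB mulmxK.
apply/unitriangularP => i j ji.
by rewrite /B mxE [(N *m N) i j]NN0 ?(leqW ji) // mxE N0 // mxE !addr0.
Qed.

Definition heisenberg_one : heisenberg := Heisenberg unitriangular1.

Definition heisenberg_mul (A B : heisenberg) : heisenberg :=
  Heisenberg (unitriangularM (hmx_unitriangular A) (hmx_unitriangular B)).

Definition heisenberg_inv (A : heisenberg) : heisenberg :=
  Heisenberg (unitriangularV (hmx_unitriangular A)).

Fact heisenberg_mulA : associative heisenberg_mul.
Proof. by move=> A B C; apply: val_inj; rewrite /= mulmxA. Qed.

Fact heisenberg_mul1 : left_id heisenberg_one heisenberg_mul.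
Proof. by move=> A; apply: val_inj; rewrite /= mul1mx. Qed.

Fact heisenberg_mulr1 : right_id heisenberg_one heisenberg_mul.
Proof. by move=> A; apply: val_inj; rewrite /= mulmx1. Qed.

Fact heisenberg_mulV : left_inverse heisenberg_one heisenberg_inv heisenberg_mul.
Proof.
move=> A; apply: val_inj.
by rewrite /= mulVmx ?unitriangular_unit ?hmx_unitriangular.
Qed.

Fact heisenberg_mulrV :
  right_inverse heisenberg_one heisenberg_inv heisenberg_mul.
Proof.
move=> A; apply: val_inj.
by rewrite /= mulmxV ?unitriangular_unit ?hmx_unitriangular.
Qed.

HB.instance Definition _ := isGroup.Build heisenberg
  heisenberg_mulA heisenberg_mul1 heisenberg_mulr1
  heisenberg_mulV heisenberg_mulrV.

(* The least n satisfying P; the value 0 when there is none is a junk value,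
   never reached below once S is symmetric and generates the group. *)
Definition least (P : nat -> Prop) : nat :=
  if pselect (exists n, `[< P n >]) is left exP then ex_minn exP else 0%N.

Section CayleyGraph.
Local Open Scope group_scope.
Variables (G : groupType) (S : {fset G}).

Definition symmetric_set : Prop := invg_closed (mem S).

(* The only subgroup of G containing S is G itself. *)
Definition generating : Prop :=
  forall H : {pred G}, group_closed H -> {subset S <= H} -> forall g, g \in H.

Definition word_length (g : G) : nat :=
  least (fun n => exists w : seq G,
    [/\ {subset w <= S}, \prod_(s <- w) s = g & size w = n]).

Definition cayley : rel G := [rel g h | g^-1 * h \in S].

(* A path from g to h is given by the sequence p of its vertices after g; its
   length is size p. *)
Definition path_between (g h : G) (p : seq G) : Prop :=
  path cayley g p /\ last g p = h.

Definition cayley_dist (g h : G) : nat :=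
  least (fun n => exists2 p, path_between g h p & size p = n).

Definition cayley_ball (n : nat) : {pred G} :=
  [pred g | (word_length g <= n)%N].

End CayleyGraph.

(* Main.v *)
Require Import Defs.
From mathcomp Require Import all_boot all_order all_algebra finmap.
From mathcomp Require Import boolp.
From mathcomp Require Import zify ring lra.
From Stdlib Require Import Permutation.

(* Project the group to the plane. With zt = 2z - xy one has
   zt (g h) = zt g + zt h + om (hp g) (hp h), so zt of a word is, up to a linear
   error, twice the signed area enclosed by its planar path. Let v_j be the
   vertices of the convex hull of the projected generators. Sorting the letters
   by direction shows that every geodesic is dominated by a block word: real
   multiplicities a_j of the v_j, in cyclic order from a cut, with the same
   endpoint and length and at least as much area; conversely, block words with
   enough area are realised by group words up to an additive constant. Hence g
   has length at most sum_j a_j + C as soon as a reaches hp g and encloses |zt g|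
   up to a linear error.
   The area form on multiplicity vectors is Lorentzian (a reverse Minkowski
   inequality, proved through a discrete Picone identity), so mixtures of two
   block words with close endpoints and lengths enclose enough area, provided
   that both are cut at the same place. This joins, in bounded time inside the
   ball, any two points lying a bounded depth below nearby points of the sphere.
   When the cuts differ, the chord is almost parallel to all the vertices in
   between, and shortening one long block by a bounded amount is free.
   The path obtained ends at the target up to a bounded central element z. Since
   multiplying by z costs a uniformly bounded number of letters far from 1, one
   descends a further bounded distance, where z can be spelled out. *)

Set Implicit Arguments.
Unset Strict Implicit.
Unset Printing Implicit Defensive.

Import Order.TTheory GRing.Theory Num.Theory.

(* [lia] restricted to the hypotheses over [nat]: those over [R] slow it down. *)
Ltac nlia :=
  repeat match goal with
  | H : ?T |- _ =>
    lazymatch T with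
    | nat => fail
    | is_true (leq _ _) => fail
    | is_true (andb (leq _ _) _) => fail
    | @eq ?A _ _ => tryif unify A nat then fail else clear H
    | _ => clear H
    end
  end; lia.

(** * The convex hull of the projected generators *)

(** The order of the quantifiers is the main obstacle. The points joined by [conn_near] are reached
    by descending from the sphere, so their distance depends on the depth of the descent, which must
    therefore be fixed first; likewise the central element [z] depends on the length of the
    connection, while its cost must be known before. Both are possible because in [wl_good_point]
    the additive constant depends only on the endpoint error and on the slope of the linear error in
    the area: any bound that appears later is absorbed as one more multiple of [wl h] once [wl h] is
    large. This is also why planar points suffice: short lifts of one planar point differ by a
    bounded central element, which is such an error. A change of cut is not free in this sense: it
    changes the area by [om] of the moved blocks with the chord, which is quadratic in general. *)

Section PlaneVectors.
Local Open Scope ring_scope.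
Variable R : archiRealFieldType.
Local Notation vec := (R * R)%type.
Implicit Types (x y z t u : vec) (a b : R).

Definition om x y : R := x.1 * y.2 - x.2 * y.1.
Definition sc a x : vec := (a * x.1, a * x.2).
Definition nm x : R := `|x.1| + `|x.2|.

Lemma omDl x y z : om (x + y) z = om x z + om y z.
Proof. by rewrite /om /=; ring. Qed.
Lemma omDr x y z : om z (x + y) = om z x + om z y.
Proof. by rewrite /om /=; ring. Qed.
Lemma omNl x z : om (- x) z = - om x z.
Proof. by rewrite /om /=; ring. Qed.
Lemma omNr x z : om z (- x) = - om z x.
Proof. by rewrite /om /=; ring. Qed.
Lemma omBl x y z : om (x - y) z = om x z - om y z.
Proof. by rewrite omDl omNl. Qed.
Lemma omBr x y z : om z (x - y) = om z x - om z y.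
Proof. by rewrite omDr omNr. Qed.
Lemma omZl a x z : om (sc a x) z = a * om x z.
Proof. by rewrite /om /=; ring. Qed.
Lemma omZr a x z : om z (sc a x) = a * om z x.
Proof. by rewrite /om /=; ring. Qed.
Lemma sc_opp a x : sc (- a) x = - sc a x.
Proof. by rewrite /sc !mulNr. Qed.
Lemma omxx x : om x x = 0.
Proof. by rewrite /om; ring. Qed.
Lemma omC x y : om x y = - om y x.
Proof. by rewrite /om; ring. Qed.
Lemma om0l x : om 0 x = 0.
Proof. by rewrite /om /=; ring. Qed.
Lemma om0r x : om x 0 = 0.
Proof. by rewrite /om /=; ring. Qed.

Lemma om_suml (I : Type) (r : seq I) (P : pred I) (F : I -> vec) z :
  om (\sum_(i <- r | P i) F i) z = \sum_(i <- r | P i) om (F i) z.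
Proof. by apply: (big_morph (om^~ z)) => [x y|]; rewrite ?omDl ?om0l. Qed.
Lemma om_sumr (I : Type) (r : seq I) (P : pred I) (F : I -> vec) z :
  om z (\sum_(i <- r | P i) F i) = \sum_(i <- r | P i) om z (F i).
Proof. by apply: (big_morph (om z)) => [x y|]; rewrite ?omDr ?om0r. Qed.

Lemma plucker x y z t : om x y * om z t = om x z * om y t - om x t * om y z.
Proof. by rewrite /om; ring. Qed.

Lemma nm_ge0 x : 0 <= nm x.
Proof. by rewrite /nm addr_ge0. Qed.
Lemma nmN x : nm (- x) = nm x.
Proof. by rewrite /nm /= !normrN. Qed.
Lemma ler_nmD x y : nm (x + y) <= nm x + nm y.
Proof. by rewrite /nm /=; have := ler_normD x.1 y.1; have := ler_normD x.2 y.2; lra. Qed.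
Lemma ler_nmB x y : nm (x - y) <= nm x + nm y.
Proof. by rewrite -(nmN y) ler_nmD. Qed.
Lemma nmZ a x : nm (sc a x) = `|a| * nm x.
Proof. by rewrite /nm /= !normrM mulrDr. Qed.
Lemma nm0 : nm 0 = 0.
Proof. by rewrite /nm /= normr0 addr0. Qed.
Lemma ler_nm_sum (I : Type) (r : seq I) (P : pred I) (F : I -> vec) :
  nm (\sum_(i <- r | P i) F i) <= \sum_(i <- r | P i) nm (F i).
Proof.
elim/big_rec2: _ => [|i b x _ h]; first by rewrite nm0.
by apply: le_trans (ler_nmD _ _) _; rewrite lerD2l.
Qed.
Lemma ler_om x y : `|om x y| <= nm x * nm y.
Proof.
have h1 : `|x.1 * y.2| <= `|x.1| * `|y.2| by rewrite normrM.
have h2 : `|x.2 * y.1| <= `|x.2| * `|y.1| by rewrite normrM.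
apply: le_trans (ler_normB _ _) _; rewrite /nm.
have : 0 <= `|x.1| * `|y.1| by rewrite mulr_ge0.
have : 0 <= `|x.2| * `|y.2| by rewrite mulr_ge0.
by move=> ? ?; rewrite !mulrDl !mulrDr; lra.
Qed.

End PlaneVectors.

Arguments om {R}.
Arguments sc {R}.
Arguments nm {R}.

(** Totality and transitivity are required only on [s], because the angular comparison used for the
    hull is transitive only among vectors on one side of a line. *)
Lemma seq_max (T : eqType) (r : T -> T -> Prop) (s : seq T) :
  (forall x y, x \in s -> y \in s -> r x y \/ r y x) ->
  (forall x y z, x \in s -> y \in s -> z \in s -> r x y -> r y z -> r x z) ->
  s != [::] -> exists2 x, x \in s & forall y, y \in s -> r x y.
Proof.
elim: s => [//|x s IHs] tot tra _.
have rxx : r x x by case: (tot x x); rewrite ?mem_head.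
case: s IHs tot tra => [|y s] IHs tot tra.
  by exists x => [|y]; rewrite inE // => /eqP ->.
have [||//|z zs hz] := IHs.
- by move=> ? ? h1 h2; apply: tot; rewrite inE ?h1 ?h2 orbT.
- by move=> ? b ? h1 h2 h3; apply: (tra _ b); rewrite inE ?h1 ?h2 ?h3 orbT.
have zs' : z \in x :: y :: s by rewrite inE zs orbT.
case: (tot x z) => // [|xz|zx]; first exact: mem_head.
  exists x => [|t]; first exact: mem_head.
  rewrite inE => /orP[/eqP -> //|ts]; apply: (tra _ z) => //; first exact: mem_head.
    by rewrite inE ts orbT.
  exact: hz.
by exists z => // t; rewrite inE => /orP[/eqP -> //|/hz].
Qed.

Lemma ltn_count (T : eqType) (a b : pred T) (s : seq T) x :
  (forall y, a y -> b y) -> x \in s -> b x -> ~~ a x -> (count a s < count b s)%N.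
Proof.
move=> ab xs bx ax; have h := count_predUI a (pred1 x) s.
have I0 : count (predI a (pred1 x)) s = 0%N.
  apply/eqP; rewrite -leqn0 leqNgt -has_count; apply/hasPn => y _ /=.
  by apply/negP => /andP[ay /eqP yx]; rewrite -yx ay in ax.
have U : (count (predU a (pred1 x)) s <= count b s)%N.
  by apply: sub_count => y /= /orP[/ab //|/eqP ->].
have c1 : (0 < count (pred1 x) s)%N by rewrite -has_count has_pred1.
by rewrite -(addn0 (count _ s)) -I0 in U *; lia.
Qed.

Section ConvexHull.
Local Open Scope ring_scope.
Variable R : archiRealFieldType.
Local Notation vec := (R * R)%type.
Implicit Types (x y z t u : vec).

(* Indices run over the universal cover of the boundary circle; a half turn
   adds [l]. The vertices are those of the convex hull of [V]. *)
Record polygon (V : seq vec) (l : nat) (v : nat -> vec) : Prop := Polygon {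
  poly_in : forall j, v j \in V;
  poly_antiper : forall j, v (j + l)%N = - v j;
  poly_pos : forall j k, (j < k)%N -> (k < j + l)%N -> 0 < om (v j) (v k);
  poly_gt1 : (1 < l)%N;
  poly_supp : forall j s, s \in V -> 0 <= om (v j.+1 - v j) (s - v j)
}.

Variable V : seq vec.
Hypothesis V_sym : forall s, s \in V -> - s \in V.
Hypothesis V_turn : forall s, s \in V -> s != 0 -> exists2 t, t \in V & 0 < om s t.
Hypothesis V_neq0 : exists2 s, s \in V & s != 0.

Definition hull_edge : rel vec := [rel x y | [&& y \in V, 0 < om x y &
  all (fun s => 0 <= om (y - x) (s - x)) V]].

(** A gift wrapping step. Among the points strictly counterclockwise of [x], the rightmost one as
    seen from [x] is taken; the other points are controlled by the supporting line through [x] of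
    direction [d]. *)
Lemma next_vertex x d : x \in V -> 0 < om x d ->
  (forall s, s \in V -> 0 <= om d (s - x)) -> exists y, hull_edge x y.
Proof.
move=> xV xd dV.
have x0 : x != 0 by apply: contraTneq xd => ->; rewrite om0l ltxx.
have [y0 y0V xy0] := V_turn xV x0.
pose T := [seq y <- V | 0 < om x y].
have [|||y] := @seq_max _ (fun y z => 0 <= om (y - x) (z - x)) T.
- move=> y z _ _; rewrite (omC (z - x)).
  by case: (lerP 0 (om (y - x) (z - x))) => h; [left|right; lra].
- move=> y z t; rewrite !mem_filter => /andP[xy _] /andP[xz _] /andP[xt _] yz zt.
  have : 0 <= om x z * om (y - x) (t - x).
    rewrite (_ : _ * _ = om x t * om (y - x) (z - x) + om x y * om (z - x) (t - x)).
      by rewrite addr_ge0 // mulr_ge0 // ltW.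
    by rewrite /om /=; ring.
  by rewrite pmulr_rge0.
- have: y0 \in T by rewrite mem_filter xy0.
  by case: T.
rewrite mem_filter => /andP[xy yV] ymax; exists y.
apply/and3P; split=> //; apply/allP => s sV.
case: (ltrP 0 (om x s)) => xs; first by apply: ymax; rewrite mem_filter xs.
have : 0 <= om x d * om (y - x) (s - x).
  rewrite plucker [om x (y - x)]omBr [om x (s - x)]omBr omxx !subr0.
  by rewrite subr_ge0 (@le_trans _ _ 0) ?mulr_le0_ge0 ?mulr_ge0 ?dV // ltW.
by rewrite pmulr_rge0.
Qed.

Definition sqn x := x.1 * x.1 + x.2 * x.2.

(** Termination measure of gift wrapping: passing from [x] to the next vertex removes at least that
    vertex from the count. *)
Definition ahead x0 x := count (fun s => (0 < om x s) && (0 < om x0 s)) V.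

(** Gift wrapping from [x0] must hit [- x0] exactly, since a point of maximal Euclidean norm and its
    opposite are both hull vertices; the boundary thus closes up after a half turn. *)
Lemma hull_chain x0 : x0 \in V -> (forall s, s \in V -> sqn s <= sqn x0) ->
  forall n x d, (ahead x0 x < n)%N ->
  x \in V -> (x == x0) || (0 < om x0 x) -> 0 < om x d ->
  (forall s, s \in V -> 0 <= om d (s - x)) ->
  exists p, path hull_edge x (rcons p (- x0)) /\ all (fun y => 0 < om x0 y) p.
Proof.
move=> x0V x0max; elim=> [|n IHn] x d; first by rewrite ltn0.
move=> cnt xV hx xd dV.
have [y xy] := next_vertex xV xd dV.
have /and3P[yV Wpos /allP supp] := xy.
case: (ltrP 0 (om x0 y)) => x0y.
  have [|||s sV|p [p1 p2]] := IHn y (y - x) _ yV.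
  - rewrite ltnS in cnt; apply: leq_trans cnt.
    have imp : forall s, (0 < om y s) && (0 < om x0 s) -> (0 < om x s) && (0 < om x0 s).
      move=> s /andP[ys x0s]; rewrite x0s andbT.
      have [/eqP -> //|x0x] := orP hx.
      have : 0 < om x0 y * om x s.
        rewrite (_ : _ * _ = om x0 x * om y s + om x0 s * om x y).
          by rewrite addr_gt0 // mulr_gt0.
        by rewrite /om; ring.
      by rewrite pmulr_rgt0.
    apply: (ltn_count imp yV); first by rewrite Wpos x0y.
    by rewrite omxx ltxx.
  - by rewrite x0y orbT.
  - by rewrite omBr omxx sub0r -omC.
  - have -> : s - y = (s - x) - (y - x) by rewrite opprB addrA subrK.
    by rewrite omBr omxx subr0 supp.
  by exists (y :: p); rewrite /= xy x0y.
have x0x : 0 < om x0 x.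
  by have [/eqP ex|//] := orP hx; move: x0y; rewrite -ex leNgt Wpos.
exists [::]; split => //=; rewrite andbT.
suff -> : - x0 = y by [].
have := supp _ (V_sym x0V).
have := x0max _ xV; have := x0max _ yV.
case: x x0 y {IHn xV hx xd dV cnt xy yV supp x0max x0V} Wpos x0y x0x
  => [x1 x2] [z1 z2] [y1 y2]; rewrite /om /sqn /= => W A B hy hx hs.
set w := x1 * y2 - x2 * y1 in W.
(* Here [w] times [- x0] equals [a x + b y], and [a + b <= w] puts [- x0] in the triangle [0, x, y].
   As it has maximal norm and [b > 0], it must equal [y]. *)
have key : (z1 * x2 - z2 * x1) * ((y1 + z1) ^+ 2 + (y2 + z2) ^+ 2) <= 0.
  set a := - (z1 * y2 - z2 * y1) in A *.
  set b := z1 * x2 - z2 * x1 in B *.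
  have ab : a + b <= w by rewrite /a /b /w; move: hs; lra.
  have id1 : w * (z1 * z1 + z2 * z2) = a * (- (x1 * z1 + x2 * z2)) + b * (- (y1 * z1 + y2 * z2)).
    by rewrite /a /b /w; ring.
  have hxz : - (x1 * z1 + x2 * z2) <= z1 * z1 + z2 * z2.
    have := sqr_ge0 (x1 + z1); have := sqr_ge0 (x2 + z2); rewrite !expr2; lra.
  have hyz : (y1 + z1) ^+ 2 + (y2 + z2) ^+ 2 <= 2 * ((z1 * z1 + z2 * z2) + (y1 * z1 + y2 * z2)).
    by rewrite !expr2; lra.
  have N0 : 0 <= z1 * z1 + z2 * z2 by rewrite addr_ge0 // -expr2 sqr_ge0.
  have a0 : 0 <= a by rewrite /a; lra.
  have h1 := ler_wpM2l a0 hxz.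
  have h2 := ler_wpM2l (ltW B) hyz.
  have h3 := ler_wpM2r N0 ab.
  move: h1 h2 h3 id1; rewrite !mulrDl !mulrDr; lra.
have key2 : (y1 + z1) ^+ 2 + (y2 + z2) ^+ 2 <= 0 by move: key; rewrite pmulr_rle0.
have [s1 s2] := (sqr_ge0 (y1 + z1), sqr_ge0 (y2 + z2)).
have /eqP : (y1 + z1) ^+ 2 = 0 by lra.
have /eqP : (y2 + z2) ^+ 2 = 0 by lra.
rewrite !sqrf_eq0 !addr_eq0 => /eqP -> /eqP ->.
by congr pair.
Qed.

Lemma exists_polygon : exists l v, polygon V l v.
Proof.
have [|||x0 x0V x0max] := @seq_max _ (fun x y => sqn y <= sqn x) V.
- by move=> x y _ _; case: (lerP (sqn y) (sqn x)) => h; [left|right; apply: ltW].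
- by move=> x y z _ _ _ h1 h2; apply: le_trans h1.
- by case: V_neq0 => s; case: V.
have x0n0 : x0 != 0.
  apply/eqP => x00; have [[s1 s2] /x0max + s0] := V_neq0.
  rewrite x00 /sqn /= mulr0 addr0 => h.
  have [h1 h2] := (sqr_ge0 s1, sqr_ge0 s2); rewrite !expr2 in h1 h2.
  have /eqP : s1 * s1 = 0 by lra.
  have /eqP : s2 * s2 = 0 by lra.
  rewrite !mulf_eq0 !orbb => /eqP e2 /eqP e1.
  by move: s0; rewrite e1 e2 eqxx.
have sq0 : 0 < sqn x0.
  have [h1 h2] := (sqr_ge0 x0.1, sqr_ge0 x0.2); rewrite !expr2 in h1 h2.
  rewrite lt_neqAle addr_ge0 // andbT eq_sym paddr_eq0 // !mulf_eq0 !orbb.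
  by apply: contra x0n0 => /andP[/eqP h3 /eqP h4]; rewrite [x0]surjective_pairing h3 h4.
(* Maximality of the norm makes the perpendicular to [x0] a supporting direction, which starts the
   wrapping. *)
have [||s sV|p [pp pa]] := @hull_chain _ x0V x0max (ahead x0 x0).+1 x0 (- x0.2, x0.1) (ltnSn _) x0V.
- by rewrite eqxx.
- by move: sq0; rewrite /om /sqn /=; lra.
- have := x0max _ sV; rewrite /om /sqn /=.
  by have := sqr_ge0 (x0.1 - s.1); have := sqr_ge0 (x0.2 - s.2); rewrite !expr2; lra.
pose l := (size p).+1; pose w i := nth 0 (x0 :: rcons p (- x0)) i.
have wl : w l = - x0 by rewrite /w /= nth_rcons ltnn eqxx.
have wE i : (i < l)%N -> hull_edge (w i) (w i.+1).
  move=> il; have /(pathP 0)/(_ i) := pp; rewrite size_rcons => /(_ il).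
  by rewrite /w.
have w0 i : (0 < i)%N -> (i < l)%N -> 0 < om x0 (w i).
  case: i => // i _ il; rewrite /w /= nth_rcons (il : (i < size p)%N).
  by move/allP: pa; apply; rewrite mem_nth.
have wV i : (i < l)%N -> w i \in V.
  by case: i => // i /ltnW/wE/and3P[].
have wpos i k : (i < k)%N -> (k < l)%N -> 0 < om (w i) (w k).
  elim: k => // k IHk ik kl; have /and3P[_ e _] := wE k (ltnW kl).
  have [ik'|] := ltnP i k; last by move=> ki; have -> : i = k by lia.
  have : 0 < om x0 (w k) * om (w i) (w k.+1).
    rewrite (_ : _ * _ = om x0 (w k.+1) * om (w i) (w k) + om x0 (w i) * om (w k) (w k.+1)).
      rewrite ltr_pwDl ?mulr_gt0 ?w0 ?IHk // ?(ltnW kl) // mulr_ge0 ?(ltW e) //.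
      case: (posnP i) => [->|i0]; first by rewrite /w /= omxx.
      by rewrite ltW // w0 // (ltn_trans ik).
    by rewrite /om; ring.
  by rewrite pmulr_rgt0 // w0 ?(ltnW kl) // (leq_ltn_trans _ ik').
pose sg (b : bool) x : vec := if b then - x else x.
have om_sg b x y : om (sg b x) (sg b y) = om x y.
  by case: b; rewrite //= omNl omNr opprK.
have sg_V b x : x \in V -> sg b x \in V by case: b => // /V_sym.
(* The chain from [x0] to [- x0] extends antiperiodically; [vE] also covers [i = l], where both
   descriptions agree. *)
pose v j := sg (odd (j %/ l)) (w (j %% l)%N).
have vE q i : (i <= l)%N -> v (q * l + i)%N = sg (odd q) (w i).
  rewrite leq_eqVlt /v => /orP[/eqP ->|il].
    rewrite -mulSnr mulnK // modnMl wl /w /=.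
    by case: (odd q); rewrite /= ?opprK.
  by rewrite divnMDl // divn_small // addn0 modnMDl modn_small.
exists l, v; split.
- by move=> j; apply/sg_V/wV; rewrite ltn_mod.
- move=> j; rewrite /v divnDr ?dvdnn // divnn addn1 /= modnDr.
  by case: (odd _); rewrite //= opprK.
- move=> j k; rewrite (divn_eq j l) (divn_eq k l).
  set q := (j %/ l)%N; set q' := (k %/ l)%N.
  have il : (j %% l < l)%N by rewrite ltn_mod.
  have kl : (k %% l < l)%N by rewrite ltn_mod.
  rewrite !vE ?(ltnW il) ?(ltnW kl) // => h1 h2.
  have [qq|qq] : q' = q \/ q' = q.+1.
    have : (q * l < q'.+1 * l)%N by rewrite mulSn; lia.
    have : (q' * l < q.+2 * l)%N by rewrite !mulSn; lia.
    by rewrite !ltn_pmul2r //; lia.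
    by rewrite qq om_sg wpos //; move: h1; rewrite qq ltn_add2l.
  have ki : (k %% l < j %% l)%N by move: h2; rewrite qq mulSn; lia.
  have := wpos _ _ ki il; rewrite qq omC.
  by rewrite /=; case: (odd q); rewrite /= ?omNl ?omNr.
- rewrite /l ltnS lt0n; apply/eqP => /size0nil p0.
  move: pp; rewrite p0 /= andbT => /and3P[_ + _].
  by rewrite omNr omxx oppr0 ltxx.
- move=> j s sV; have jl := ltn_pmod j (isT : (0 < l)%N).
  have /and3P[_ _ /allP /(_ _ (sg_V (odd (j %/ l)) _ sV))] := wE _ jl.
  have -> : v j.+1 = sg (odd (j %/ l)) (w (j %% l).+1).
    by rewrite {1}(divn_eq j l) -addnS vE.
  rewrite /v; case: (odd _) => //=.
  by move: (w _) (w _) => [x1 x2] [y1 y2]; rewrite /om /=; lra.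
Qed.
End ConvexHull.

(** * Areas of block words *)

Section Areas.
Local Open Scope ring_scope.
Variable R : archiRealFieldType.
Local Notation vec := (R * R)%type.
Implicit Types (f g h : nat -> vec).

Definition ps f c d : vec := \sum_(c <= j < d) f j.
(** For [f = g], twice the signed area between the path of steps [f] and its chord. Two arguments
    make the form bilinear, so that areas of combinations can be expanded. *)
Definition bar f g c d : R := \sum_(c <= k < d) om (ps f c k) (g k).

Lemma ps_cat f c e d : (c <= e)%N -> (e <= d)%N -> ps f c d = ps f c e + ps f e d.
Proof. by move=> ce ed; rewrite /ps (big_cat_nat ce ed). Qed.

Lemma ps_recl f c d : (c < d)%N -> ps f c d = f c + ps f c.+1 d.
Proof. by move=> cd; rewrite /ps big_ltn. Qed.

Lemma ps_recr f c d : (c <= d)%N -> ps f c d.+1 = ps f c d + f d.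
Proof. by move=> cd; rewrite /ps big_nat_recr. Qed.

Lemma psn f c : ps f c c = 0.
Proof. by rewrite /ps big_geq. Qed.

Lemma ps1 f c : ps f c c.+1 = f c.
Proof. by rewrite /ps big_nat1. Qed.

Lemma eq_ps f g c d : (forall j, (c <= j < d)%N -> f j = g j) -> ps f c d = ps g c d.
Proof. by move=> fg; apply: eq_big_nat. Qed.

Lemma bar1 f g c : bar f g c c.+1 = 0.
Proof. by rewrite /bar big_nat1 psn om0l. Qed.

Lemma bar_recr f g c d : (c <= d)%N -> bar f g c d.+1 = bar f g c d + om (ps f c d) (g d).
Proof. by move=> cd; rewrite /bar big_nat_recr. Qed.

(** The last term is twice the area of the triangle formed by the chords of the two pieces. *)
Lemma bar_cat f g c e d : (c <= e)%N -> (e <= d)%N ->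
  bar f g c d = bar f g c e + bar f g e d + om (ps f c e) (ps g e d).
Proof.
move=> ce ed; rewrite /bar (big_cat_nat ce ed) /= -addrA; congr (_ + _).
rewrite /(ps g e d) om_sumr -big_split; apply: eq_big_nat => k /andP[ek _] /=.
by rewrite (ps_cat _ ce ek) omDl addrC.
Qed.

Lemma eq_bar f f' g g' c d : (forall j, (c <= j < d)%N -> f j = f' j) ->
  (forall j, (c <= j < d)%N -> g j = g' j) -> bar f g c d = bar f' g' c d.
Proof.
move=> ff gg; apply: eq_big_nat => k /[dup] kd /gg ->; congr om.
by apply: eq_ps => j jk; apply: ff; move: jk kd; lia.
Qed.

Lemma psD f g c d : ps (fun j => f j + g j) c d = ps f c d + ps g c d.
Proof. by rewrite /ps big_split. Qed.

Lemma psZ a f c d : ps (fun j => sc a (f j)) c d = sc a (ps f c d).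
Proof.
rewrite /ps; apply: (big_rec2 (fun x y => x = sc a y)); first by rewrite /sc /= !mulr0.
by move=> i x y _ ->; rewrite /sc /= !mulrDr.
Qed.

Lemma barDl f f' g c d : bar (fun j => f j + f' j) g c d = bar f g c d + bar f' g c d.
Proof. by rewrite /bar -big_split; apply: eq_bigr => k _; rewrite psD omDl. Qed.

Lemma barDr f g g' c d : bar f (fun j => g j + g' j) c d = bar f g c d + bar f g' c d.
Proof. by rewrite /bar -big_split; apply: eq_bigr => k _; rewrite omDr. Qed.

Lemma barZl a f g c d : bar (fun j => sc a (f j)) g c d = a * bar f g c d.
Proof. by rewrite /bar mulr_sumr; apply: eq_bigr => k _; rewrite psZ omZl. Qed.

Lemma barZr a f g c d : bar f (fun j => sc a (g j)) c d = a * bar f g c d.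
Proof. by rewrite /bar mulr_sumr; apply: eq_bigr => k _; rewrite omZr. Qed.

Lemma ler_bar f g c d : (c <= d)%N ->
  `|bar f g c d| <= (\sum_(c <= j < d) nm (f j)) * (\sum_(c <= j < d) nm (g j)).
Proof.
move=> cd; apply: le_trans (ler_norm_sum _ _ _) _; rewrite mulr_sumr.
rewrite big_nat [leRHS]big_nat; apply: ler_sum => k /andP[ck kd].
apply: le_trans (ler_om _ _) _; rewrite ler_wpM2r ?nm_ge0 //.
apply: le_trans (ler_nm_sum _ _ _) _.
by rewrite (big_cat_nat ck (ltnW kd)) /= lerDl sumr_ge0 // => *; apply: nm_ge0.
Qed.

Lemma ps_shift f c d n : ps f (c + n) (d + n) = ps (fun j => f (j + n)%N) c d.
Proof. by rewrite /ps big_addn addnK. Qed.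

Lemma bar_shift f g c d n :
  bar f g (c + n) (d + n) = bar (fun j => f (j + n)%N) (fun j => g (j + n)%N) c d.
Proof. by rewrite /bar big_addn addnK; apply: eq_bigr => j _; rewrite ps_shift. Qed.

Lemma ps_eq0 f c d : (forall j, (c <= j < d)%N -> f j = 0) -> ps f c d = 0.
Proof. by move=> f0; rewrite /ps big_nat big1. Qed.

Lemma ps_single f c d k : (c <= k < d)%N ->
  (forall j, (c <= j < d)%N -> j != k -> f j = 0) -> ps f c d = f k.
Proof.
move=> /andP[ck kd] f0; rewrite (ps_cat _ ck (ltnW kd)) (ps_recl _ kd).
by rewrite !ps_eq0 ?addr0 ?add0r // => j jk; apply: f0; lia.
Qed.

Lemma bar_single_r f g c d k : (c <= k < d)%N ->
  (forall j, (c <= j < d)%N -> j != k -> g j = 0) -> bar f g c d = om (ps f c k) (g k).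
Proof.
move=> /andP[ck kd] g0; rewrite /bar (big_cat_nat ck (ltnW kd)) /= [X in _ + X]big_ltn //.
rewrite !big_nat !big1 ?addr0 ?add0r // => j jk; rewrite g0 ?om0r //; lia.
Qed.

Lemma bar_single_l f g c d k : (c <= k < d)%N ->
  (forall j, (c <= j < d)%N -> j != k -> f j = 0) -> bar f g c d = om (f k) (ps g k.+1 d).
Proof.
move=> /[dup] ckd /andP[ck kd] f0; rewrite (bar_cat _ _ (leqW ck) kd).
rewrite (@ps_single _ c k.+1 k) ?ck ?ltnSn //; last by move=> j jk; apply: f0; lia.
rewrite /bar !big_nat !big1 ?add0r // => j jk; rewrite ps_eq0 ?om0l // => i ij; apply: f0; lia.
Qed.

Fixpoint larea (u : seq vec) : R :=
  if u is x :: u' then om x (\sum_(y <- u') y) + larea u' else 0.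

Lemma larea_rcons u x : larea (rcons u x) = larea u + om (\sum_(y <- u) y) x.
Proof.
elim: u => [|y u IHu]; first by rewrite /= !big_nil om0r om0l.
by rewrite /= IHu big_rcons big_cons /= omDr omDl; lra.
Qed.

End Areas.

Lemma sum_period (V : nmodType) (m c : nat) (F : nat -> V) :
  (forall j, F (j + m)%N = F j) ->
  \big[+%R/0%R]_(c <= j < c + m) F j = \big[+%R/0%R]_(0 <= j < m) F j.
Proof.
move=> Fm; elim: c => [|c IHc]; first by rewrite add0n.
rewrite -{}IHc; case: m Fm => [|m] Fm; first by rewrite !addn0 !big_geq.
rewrite [RHS]big_ltn ?addnS ?ltnS ?leq_addr // addSn big_nat_recr /= ?ltnS ?leq_addr //.
by rewrite addrC -addnS Fm.
Qed.

Section Blocks.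
Local Open Scope ring_scope.
Variable R : archiRealFieldType.
Local Notation vec := (R * R)%type.
Variables (V : seq vec) (l : nat) (v : nat -> vec).
Hypothesis P : polygon V l v.
Implicit Types (a b : nat -> R) (c d e j k : nat) (u x y : vec).

Local Notation m := (l + l)%N.

Definition periodic a := forall j, a (j + (l + l))%N = a j.
(* A periodic [a] encodes the path made of [a j] copies of each hull vertex
   [v j], in cyclic order from a cut [c] on; [area c a] is twice the signed area
   between this path and its chord. *)
Definition block_vec a j : vec := sc (a j) (v j).
Local Notation bv := block_vec.
Definition block_sum a := ps (bv a) 0 m.
Local Notation sigma := block_sum.
Definition block_length a := \sum_(0 <= j < m) a j.
Local Notation ell := block_length.
Definition block_area c a := bar (bv a) (bv a) c (c + (l + l)).
Local Notation area := block_area.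
(** Applied to the reversed chord [- sigma a]: the word cut at [c.+1] then closes up into a path
    whose steps, chord included, are in cyclic order of direction. The zero vector lies in every
    cone. *)
Definition vertex_cone c u := 0 <= om (v c) u /\ 0 <= om u (v c.+1).
Local Notation cone := vertex_cone.

Lemma l_gt0 : (0 < l)%N. Proof. exact: ltnW (poly_gt1 P). Qed.

Lemma v_per j : v (j + m)%N = v j.
Proof. by rewrite addnA !(poly_antiper P) opprK. Qed.

Lemma v_perM j q : v (j + q * m)%N = v j.
Proof. by elim: q => [|q IHq]; rewrite ?addn0 // mulSn [(m + _)%N]addnC addnA v_per. Qed.

Lemma periodicM a j q : periodic a -> a (j + q * m)%N = a j.
Proof. by move=> ap; elim: q => [|q IHq]; rewrite ?addn0 // mulSn [(m + _)%N]addnC addnA ap. Qed.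

Lemma w_ge0 j k : (j <= k)%N -> (k <= j + l)%N -> 0 <= om (v j) (v k).
Proof.
rewrite leq_eqVlt => /orP[/eqP ->|jk]; first by rewrite omxx.
rewrite leq_eqVlt => /orP[/eqP ->|kj]; last exact/ltW/(poly_pos P).
by rewrite (poly_antiper P) omNr omxx oppr0.
Qed.

Lemma w_le0 j k : (j + l <= k)%N -> (k <= j + m)%N -> om (v j) (v k) <= 0.
Proof.
move=> jk kj; rewrite -oppr_ge0 -omNl -(poly_antiper P) w_ge0 //.
by rewrite -addnA.
Qed.

Lemma w_gt0 j : 0 < om (v j) (v j.+1).
Proof. by apply: (poly_pos P) => //; have := poly_gt1 P; lia. Qed.

Lemma cone_r c u j : cone c u -> (c < j)%N -> (j <= c + l)%N -> 0 <= om u (v j).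
Proof.
move=> [h1 h2] cj jc; have w0 := w_gt0 c.
rewrite -(pmulr_rge0 _ w0) plucker (omC (v c.+1) u) mulrN opprK.
by rewrite addr_ge0 ?mulr_ge0 ?w_ge0 //; lia.
Qed.

Lemma cone_l c u j : cone c u -> (j <= c)%N -> (c < j + l)%N -> 0 <= om (v j) u.
Proof.
move=> cu jc cj; rewrite omC -omNr -(poly_antiper P).
by apply: cone_r cu _ _ => //; rewrite leq_add2r.
Qed.

Lemma bv_per a : periodic a -> forall j, bv a (j + m)%N = bv a j.
Proof. by move=> ap j; rewrite /bv ap v_per. Qed.

Lemma sigmaE c a : periodic a -> ps (bv a) c (c + m) = sigma a.
Proof. by move=> ap; apply: sum_period; apply: bv_per. Qed.

Lemma ellE c a : periodic a -> \sum_(c <= j < c + m) a j = ell a.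
Proof. by move=> ap; apply: sum_period. Qed.

Lemma ps_per a c d : periodic a -> ps (bv a) (c + m) (d + m) = ps (bv a) c d.
Proof.
move=> ap; rewrite /ps big_addn addnK; apply: eq_big_nat => j _; exact: bv_per.
Qed.

Lemma area_per c a : periodic a -> area (c + m) a = area c a.
Proof.
move=> ap; rewrite /area /bar big_addn addnK; apply: eq_big_nat => j _.
by rewrite ps_per // bv_per.
Qed.

(** Changing the cut moves the blocks between [c] and [e] from the front of the word to its back. *)
Lemma area_shift a c e : periodic a -> (c <= e)%N -> (e <= c + m)%N ->
  area e a = area c a - 2 * om (ps (bv a) c e) (sigma a).
Proof.
move=> ap ce ec; rewrite /area (bar_cat _ _ ce ec).
have ec' : (c + m <= e + m)%N by rewrite leq_add2r.
rewrite (bar_cat _ _ ec ec') -(sigmaE c ap) (ps_cat _ ce ec).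
have -> : bar (bv a) (bv a) (c + m) (e + m) = bar (bv a) (bv a) c e.
  rewrite /bar big_addn addnK; apply: eq_big_nat => j _.
  by rewrite ps_per // bv_per.
rewrite (ps_per _ _ ap) omDr omxx (omC (ps _ e _)); ring.
Qed.

Definition single_block k (t : R) j : R := if (j %% m == k %% m)%N then t else 0.
Local Notation spike := single_block.

Lemma spike_per k t : periodic (spike k t).
Proof. by move=> j; rewrite /spike modnDr. Qed.

Lemma periodicD a b : periodic a -> periodic b -> periodic (fun j => a j + b j).
Proof. by move=> ap bp j; rewrite ap bp. Qed.

Lemma spike_out k t j c : (c <= k < c + m)%N -> (c <= j < c + m)%N -> j != k ->
  spike k t j = 0.
Proof.
move=> kc jc jk; rewrite /spike; case: eqP => // e.
wlog: j k kc jc jk e / (j < k)%N => [wl|jk'].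
  by case: (ltngtP j k) jk => // h _; [apply: (wl j k)|apply: (wl k j)]; rewrite // neq_ltn h ?orbT.
have : (m %| k - j)%N by rewrite -eqn_mod_dvd ?(ltnW jk') // e.
by move/dvdn_leq; lia.
Qed.

Lemma spike_in k t : spike k t k = t.
Proof. by rewrite /spike eqxx. Qed.

Lemma sum_spike c k t : (c <= k < c + m)%N -> \sum_(c <= j < c + m) spike k t j = t.
Proof.
move=> /[dup] kc /andP[ck km].
rewrite (big_cat_nat ck (ltnW km)) /= [X in _ + X]big_ltn // spike_in !big_nat !big1 ?add0r ?addr0 //.
  by move=> j /andP[kj jc]; rewrite (spike_out _ kc) //; lia.
by move=> j /andP[kj jc]; rewrite (spike_out _ kc) //; lia.
Qed.

Lemma ell_spike a k t : periodic a -> ell (fun j => a j + spike k t j) = ell a + t.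
Proof.
move=> ap; have kk : (k - k %% m <= k < k - k %% m + m)%N.
  have l0 := l_gt0; have := leq_mod k m; have := @ltn_pmod k m; lia.
rewrite -(ellE (k - k %% m)); last by apply: periodicD => //; apply: spike_per.
by rewrite big_split /= sum_spike // ellE.
Qed.

Lemma bvD a b j : bv (fun i => a i + b i) j = bv a j + bv b j.
Proof. by rewrite /bv /sc /= !mulrDl. Qed.

Lemma sigma_spike a k t : periodic a ->
  sigma (fun j => a j + spike k t j) = sigma a + sc t (v k).
Proof.
move=> ap; have kk : (k - k %% m <= k < k - k %% m + m)%N.
  have l0 := l_gt0; have := leq_mod k m; have := @ltn_pmod k m; lia.
rewrite -(sigmaE (k - k %% m)); last by apply: periodicD => //; apply: spike_per.
rewrite (@eq_ps _ _ (fun j => bv a j + bv (spike k t) j)) => [|j _]; last exact: bvD.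
rewrite psD sigmaE // (ps_single kk) {1}/bv ?spike_in // => j jc jk.
by rewrite /bv (spike_out _ kk) // /sc !mul0r.
Qed.

(** Affine in [t]: the copies of [v k] in one block are parallel and enclose no area among
    themselves. *)
Lemma area_spike a c k t : periodic a -> (c <= k < c + m)%N ->
  area c (fun j => a j + spike k t j) =
  area c a + t * (om (sigma a) (v k) + 2 * om (v k) (ps (bv a) k.+1 (c + m))).
Proof.
move=> ap /[dup] kc /andP[ck km].
set a' := fun j => _; have bE j : bv a' j = bv a j + bv (spike k t) j by exact: bvD.
rewrite /area (@eq_bar _ _ (fun j => bv a j + bv (spike k t) j) _ (fun j => bv a j + bv (spike k t) j)) //.
rewrite barDl !barDr -addrA; congr (_ + _).
have b0 j : (c <= j < c + m)%N -> j != k -> bv (spike k t) j = 0.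
  by move=> jc jk; rewrite /bv (spike_out _ kc) // /sc ?mul0r.
rewrite (bar_single_r _ kc b0) (bar_single_l _ kc b0) (bar_single_r _ kc b0).
rewrite (@ps_eq0 _ (bv (spike k t)) c k); last by move=> j jk; apply: b0; lia.
have bk : bv (spike k t) k = sc t (v k) by rewrite /bv spike_in.
rewrite om0l bk omZr omZl.
rewrite -(sigmaE c ap) (ps_cat _ ck (ltnW km)) (ps_recl _ km) !omDl omZl omxx.
rewrite (omC (ps _ k.+1 _)); ring.
Qed.

(** Congruence modulo a full turn, with multiples added on both sides to avoid truncated
    subtraction. *)
Lemma modn_rep c k : exists k' q q', [/\ (c <= k' < c + m)%N & (k' + q * m = k + q' * m)%N].
Proof.
have m0 : (0 < m)%N by have := l_gt0; lia.
exists (c + (k + c * m - c) %% m)%N, ((k + c * m - c) %/ m)%N, c.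
have := ltn_pmod (k + c * m - c) m0; split; first by lia.
have := divn_eq (k + c * m - c) m.
have : (c <= c * m)%N by rewrite leq_pmulr.
by lia.
Qed.

Lemma spike_cong k k' q q' t : (k' + q * m = k + q' * m)%N -> spike k' t = spike k t.
Proof.
move=> e; apply/funext => j; rewrite /spike.
by rewrite -(modnMDl q' k) -(modnMDl q k') addnC e addnC.
Qed.

Lemma v_cong k k' q q' : (k' + q * m = k + q' * m)%N -> v k' = v k.
Proof. by move=> e; rewrite -(v_perM k' q) e (v_perM). Qed.

Lemma om_ps_ge0 a c d u : (forall j, 0 <= a j) ->
  (forall j, (c <= j < d)%N -> 0 <= om u (v j)) -> 0 <= om u (ps (bv a) c d).
Proof.
move=> a0 h; rewrite om_sumr big_nat sumr_ge0 // => j jd.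
by rewrite omZr mulr_ge0 // h.
Qed.

Lemma om_ps_le0 a c d u : (forall j, 0 <= a j) ->
  (forall j, (c <= j < d)%N -> om u (v j) <= 0) -> om u (ps (bv a) c d) <= 0.
Proof.
move=> a0 h; rewrite -oppr_ge0 -omNl om_ps_ge0 // => j jd.
by rewrite omNl oppr_ge0 h.
Qed.

(* The closing chord [- sigma a] has to stay in the cone at the cut; adding
   [t v_k] turns it towards [- v_k], and the cut follows it. *)
Lemma insertion a c k t : periodic a -> (forall j, 0 <= a j) -> 0 <= t ->
  cone c (- sigma a) -> exists c', cone c' (- (sigma a + sc t (v k))) /\
    area c.+1 a + t * om (sigma a) (v k) <= area c'.+1 (fun j => a j + spike k t j).
Proof.
move=> ap a0 t0 co; have [k' [q [q' [kc e]]]] := modn_rep c.+1 k.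
rewrite -(spike_cong t e) -(v_cong e) {k q q' e}; move: k' kc => k /[dup] kc /andP[ck km].
have l0 := l_gt0.
set a' := fun j => a j + spike k t j; have a'p : periodic a' by apply: periodicD => //; apply: spike_per.
have aa := area_spike t ap kc; rewrite -/a' in aa.
have sa' : sigma a' = sigma a + sc t (v k) by apply: (sigma_spike).
set u := - (sigma a + _).
have uE : sigma a' = - u by rewrite sa' opprK.
have uD : u = - (sigma a + sc t (v k)) by []; clearbody u.
have psE d e : (c < d)%N -> (e <= c.+1 + m)%N -> (forall j, (d <= j < e)%N -> j != k) ->
    ps (bv a') d e = ps (bv a) d e.
  move=> cd ec jk; apply: eq_ps => j jde.
  rewrite /a' bvD [X in _ + X](_ : _ = 0) ?addr0 // /block_vec (@spike_out k t j c.+1) ?jk //.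
    by rewrite /sc !mul0r.
  by lia.
have domV u' j : om u' (v j) <= 0 -> 0 <= om (v j) u'.
  by move=> h; rewrite omC oppr_ge0.
(* [- v k] is [v (k + l)], which does not lie beyond the cut [c + m] when [k < c.+1 + l]; the cut
   then moves back, to the last admissible index. Otherwise [- v k] is [v (k - l)], after [c], and
   the cut moves forward to the first one. *)
case: (leqP (c.+1 + l) k) => kl; last first.
  have hk : 0 <= om (- sigma a) (v k) by apply: (cone_r co) => //; lia.
  have ex : exists d, [&& (k + l <= d)%N, (d <= c + m)%N & om u (v d) <= 0].
    exists (k + l)%N; rewrite leqnn (poly_antiper P) omNr uD omNl opprK.
    by rewrite omDl omZl omxx mulr0 addr0 -oppr_ge0 -omNl hk andbT; lia.
  have bd : forall d, [&& (k + l <= d)%N, (d <= c + m)%N & om u (v d) <= 0] -> (d <= c + m)%N.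
    by move=> d /and3P[].
  have [d /and3P[kd dc ud] dmax] := ex_maxnP ex bd; exists d.
  have cu : cone d u.
    split; first exact: domV.
    move: dc; rewrite leq_eqVlt => /orP[/eqP dc|dc].
      rewrite dc -addSn (v_per) uD opprD omDl -sc_opp omZl.
      rewrite addr_ge0 ?(cone_r co) //; first by lia.
      by rewrite mulNr -mulrN -omC mulr_ge0 // (w_ge0) //; lia.
    rewrite leNgt; apply: contraT; rewrite negbK => ud1.
    by have := dmax d.+1; rewrite ltnn dc (leqW kd) (ltW ud1) => /(_ isT).
  split => //.
  have s1 : (d.+1 <= c.+1 + m)%N by lia.
  have s2 : (c.+1 + m <= d.+1 + m)%N by lia.
  have := area_shift a'p s1 s2; rewrite (area_per _ a'p) psE ?uE ?omNr; [|lia|lia|lia].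
  rewrite omC opprK -/a' => sh.
  have y2 : 0 <= om u (ps (bv a) d.+1 (c.+1 + m)).
    by apply: om_ps_ge0 => // j jd; apply: (cone_r cu); lia.
  have Y : 0 <= om (v k) (ps (bv a) k.+1 (c.+1 + m)).
    have -> : ps (bv a) k.+1 (c.+1 + m) = sigma a - ps (bv a) c.+1 k.+1.
      by rewrite -(sigmaE c.+1 ap) (ps_cat _ (leqW ck) km) addrC addKr.
    rewrite omBr subr_ge0 (@le_trans _ _ 0) //; last by rewrite omC -omNl.
    by apply: om_ps_le0 => // j jk; rewrite omC oppr_le0 (w_ge0) //; lia.
  have := mulr_ge0 t0 Y; rewrite aa in sh; lra.
have ex : exists d, (c <= d)%N && (0 <= om u (v d.+1)).
  exists (k - l.+1)%N; have -> : (k - l.+1).+1 = (k - l)%N by lia.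
  have vk : v k = - v (k - l)%N by rewrite -(poly_antiper P) subnK //; lia.
  rewrite uD omNl omDl omZl {1}vk omNl omxx oppr0 mulr0 addr0 -omNl (cone_r co) ?andbT; lia.
have [d /andP[cd ud] dmin] := ex_minnP ex; exists d.
have dk : (d < k - l)%N.
  have : (d <= k - l.+1)%N.
    apply: dmin; have -> : (k - l.+1).+1 = (k - l)%N by lia.
    have vk : v k = - v (k - l)%N by rewrite -(poly_antiper P) subnK //; lia.
    rewrite uD omNl omDl omZl {1}vk omNl omxx oppr0 mulr0 addr0 -omNl (cone_r co) ?andbT; lia.
  by lia.
have cu : cone d u.
  split=> //; move: cd; rewrite leq_eqVlt => /orP[/eqP <-|cd].
    rewrite uD opprD omDr addr_ge0 //; first by case: co.
    rewrite -sc_opp omZr mulNr -mulrN mulr_ge0 // oppr_ge0 (w_le0) //; lia.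
  apply: domV; rewrite leNgt; apply/negP => ud'.
  by have := dmin d.-1; rewrite prednK ?(ltW ud') ?andbT; lia.
split=> //.
have s1 : (c.+1 <= d.+1)%N by lia.
have s2 : (d.+1 <= c.+1 + m)%N by lia.
rewrite (area_shift a'p s1 s2) psE ?uE ?omNr; [|lia|lia|lia].
have y1 : 0 <= om (ps (bv a) c.+1 d.+1) u.
  rewrite omC oppr_ge0 om_ps_le0 // => j jd; rewrite omC oppr_le0 (cone_l cu) //; lia.
have Y : 0 <= om (v k) (ps (bv a) k.+1 (c.+1 + m)).
  by apply: om_ps_ge0 => // j jk; rewrite (w_ge0) //; lia.
have := mulr_ge0 t0 Y; rewrite aa; lra.
Qed.

(** [k] is the last index before [om (v k) s] changes sign, so [s] is in the sector of [v k] and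
    [v k.+1]. The coefficients come from Cramer's rule, and the support inequality of that edge
    bounds their sum. *)
Lemma polygon_decomp s : s \in V -> exists k al be,
  [/\ 0 <= al, 0 <= be, al + be <= 1 & s = sc al (v k) + sc be (v k.+1)].
Proof.
move=> sV; have l0 := l_gt0.
have [j hj] : exists j, 0 <= om (v j) s.
  case: (lerP 0 (om (v 0%N) s)) => h; first by exists 0%N.
  by exists l; rewrite -[l]add0n (poly_antiper P) omNl oppr_ge0 ltW.
have ex : exists i, om (v (j + i.+1)%N) s <= 0.
  by exists l.-1; rewrite prednK // (poly_antiper P) omNl oppr_le0.
have [i hi imin] := ex_minnP ex.
pose k := (j + i)%N; have k1 : om (v k.+1) s <= 0 by rewrite -addnS.
have k0 : 0 <= om (v k) s.
  rewrite /k; case: i imin {hi k k1} => [|i] imin; first by rewrite addn0.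
  by rewrite leNgt; apply/negP => h; have := imin i (ltW h); rewrite ltnn.
have w0 := w_gt0 k; have wn0 := lt0r_neq0 w0.
exists k, (om s (v k.+1) / om (v k) (v k.+1)), (om (v k) s / om (v k) (v k.+1)); split.
- by rewrite divr_ge0 ?(ltW w0) // omC oppr_ge0.
- by rewrite divr_ge0 ?(ltW w0).
- rewrite -mulrDl ler_pdivrMr // mul1r; have := poly_supp P k sV.
  by rewrite !omBl !omBr omxx (omC (v k.+1) s) (omC (v k.+1)); lra.
rewrite [s]surjective_pairing /sc /om /=; rewrite /om in wn0.
by congr pair => /=; field.
Qed.

(** Induction on appended letters: a letter is split along the two hull vertices around it and each
    part is put in its block by [insertion], for a total gain at least that of appending the
    letter. *)
Lemma dominated (u : seq vec) : {subset u <= V} -> exists a c,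
  [/\ periodic a, forall j, 0 <= a j, sigma a = \sum_(y <- u) y, ell a = (size u)%:R &
      cone c (- sigma a) /\ larea u <= area c.+1 a].
Proof.
elim/last_ind: u => [|u s IHu] uV.
  exists (fun=> 0), 0%N.
  have s0 : sigma (fun=> 0) = 0.
    by apply: ps_eq0 => j _; rewrite /block_vec /sc !mul0r.
  split=> //; first by rewrite s0 big_nil.
    by rewrite /block_length big1.
  rewrite s0 /vertex_cone oppr0 om0l om0r; split=> //.
  rewrite /block_area /bar big1 // => j _.
  by rewrite /block_vec /sc !mul0r om0r.
have [|a [c [ap a0 sa la [co ar]]]] := IHu; first by move=> x xu; apply: uV; rewrite mem_rcons inE xu orbT.
have [|k [al [be [al0 be0 ab sE]]]] := @polygon_decomp s; first by apply: uV; rewrite mem_rcons mem_head.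
have [c1 [co1 ar1]] := insertion k ap a0 al0 co.
set a1 := fun j => _ in ar1.
have ap1 : periodic a1 by apply: periodicD => //; apply: spike_per.
have sp0 i t : 0 <= t -> forall j, 0 <= spike i t j by move=> t0 j; rewrite /single_block; case: ifP.
have a10 j : 0 <= a1 j by rewrite addr_ge0 ?sp0.
rewrite -(sigma_spike) // -/a1 in co1.
have [c2 [co2 ar2]] := insertion k.+1 ap1 a10 be0 co1.
set a2 := fun j => _ in ar2.
have ap2 : periodic a2 by apply: periodicD => //; apply: spike_per.
have a20 j : 0 <= a2 j by rewrite addr_ge0 ?sp0.
rewrite -(sigma_spike) // -/a2 in co2.
pose th := (1 - al - be) / 2; have th0 : 0 <= th by rewrite /th divr_ge0 //; lra.
have [c3 [co3 ar3]] := insertion k ap2 a20 th0 co2.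
set a3 := fun j => _ in ar3.
have ap3 : periodic a3 by apply: periodicD => //; apply: spike_per.
have a30 j : 0 <= a3 j by rewrite addr_ge0 ?sp0.
rewrite -(sigma_spike) // -/a3 in co3.
have [c4 [co4 ar4]] := insertion (k + l) ap3 a30 th0 co3.
set a4 := fun j => _ in ar4.
have ap4 : periodic a4 by apply: periodicD => //; apply: spike_per.
rewrite -(sigma_spike) // -/a4 in co4.
have s1 : sigma a1 = sigma a + sc al (v k) by apply: (sigma_spike).
have s2 : sigma a2 = sigma a1 + sc be (v k.+1) by apply: (sigma_spike).
have s3 : sigma a3 = sigma a2 + sc th (v k) by apply: (sigma_spike).
have s4 : sigma a4 = sigma a3 + sc th (v (k + l)%N) by apply: (sigma_spike).
exists a4, c4; split => //.
- by move=> j; rewrite addr_ge0 ?sp0.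
- rewrite s4 s3 s2 s1 big_rcons /= -sa [in RHS]sE (poly_antiper P).
  move: (sigma a) (v k) (v k.+1) => [? ?] [? ?] [? ?].
  by rewrite /sc; congr pair => /=; ring.
- rewrite !(ell_spike) // la size_rcons -[in RHS]addn1 natrD /th; lra.
split=> //.
rewrite larea_rcons -sa sE omDr !omZr.
have w0 := w_gt0 k.
(* This product is the surplus of area from inserting the two parts in counterclockwise order. *)
have := mulr_ge0 (mulr_ge0 al0 be0) (ltW w0).
move: ar4 ar3 ar2 ar1; rewrite s3 s2 s1 (poly_antiper P).
rewrite ?omNr !omDl !omZl omxx (omC (v k.+1) (v k)).
lra.
Qed.

End Blocks.

Lemma max_norm (R : realFieldType) (f : nat -> R) c d : exists N : R,
  [/\ (0 <= N)%R, forall j, (c <= j < d)%N -> (`|f j| <= N)%R &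
      N = 0%R \/ exists2 j, (c <= j < d)%N & N = `|f j|%R].
Proof.
elim: d => [|d [N [N0 Nm Ne]]].
  by exists 0%R; split=> [//|j|]; [rewrite ltn0 andbF|left].
case: (leqP c d) => cd; last by exists N; split=> [//|j|]; [nlia|case: Ne; [left|move=> [j]; nlia]].
case: (lerP N `|f d|) => h.
  exists `|f d|%R; split=> // [j|]; last by right; exists d; rewrite ?cd ?ltnSn.
  rewrite ltnS [(j <= d)%N]leq_eqVlt => /andP[cj /orP[/eqP -> //|jd]].
  by apply: le_trans h; apply: Nm; rewrite cj.
exists N; split=> // [j|].
  rewrite ltnS [(j <= d)%N]leq_eqVlt => /andP[cj /orP[/eqP ->|jd]]; first exact: ltW.
  by apply: Nm; rewrite cj.
case: Ne => [->|[j jd ->]]; [by left|right; exists j => //; nlia].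
Qed.

(** * Reverse Minkowski inequality *)

Section ReverseMinkowski.
Local Open Scope ring_scope.
Variable R : archiRealFieldType.
Local Notation vec := (R * R)%type.
Variables (V : seq vec) (l : nat) (v : nat -> vec) (W : R).
Hypothesis P : polygon V l v.
Hypothesis om_ge1 : forall j k, (j < k < j + l)%N -> 1 <= om (v j) (v k).
Hypothesis nm_v : forall j, nm (v j) <= W.
Implicit Types (a b e x : nat -> R) (c d i j k : nat).
Local Notation m := (l + l)%N.
Local Notation periodic := (@periodic R l).
Local Notation bv := (block_vec v).
Local Notation sigma := (block_sum l v).
Local Notation ell := (block_length l).
Local Notation area := (block_area l v).

Lemma W_ge0 : 0 <= W.
Proof. exact: le_trans (nm_ge0 _) (nm_v 0). Qed.

Lemma om_v_le u j : `|om u (v j)| <= nm u * W.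
Proof. by apply: le_trans (ler_om _ _) _; rewrite ler_wpM2l ?nm_ge0. Qed.

Lemma om_vv_le j k : `|om (v j) (v k)| <= W * W.
Proof. by apply: le_trans (om_v_le _ _) _; rewrite ler_wpM2r ?W_ge0. Qed.

Lemma W_ge1 : 1 <= W * W.
Proof.
have h : (0 < 1 < 0 + l)%N by have := poly_gt1 P; nlia.
exact: le_trans (om_ge1 h) (le_trans (ler_norm _) (om_vv_le 0 1)).
Qed.

(* Discrete Picone identity: it diagonalises the area of an open chain of at
   most half a turn. *)
Lemma picone x i k : (i < k < i + l)%N ->
  bar (bv x) (bv x) i k.+1 =
  om (v i) (ps (bv x) i k.+1) * om (ps (bv x) i k.+1) (v k) / om (v i) (v k) -
  \sum_(i.+1 <= j < k) (om (v i) (ps (bv x) i j.+1)) ^+ 2 * om (v j) (v j.+1) /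
     (om (v i) (v j) * om (v i) (v j.+1)).
Proof.
move=> /andP[]; elim: k => // k IHk ik ki.
have nz j : (i < j < i + l)%N -> om (v i) (v j) != 0.
  by move=> /om_ge1 h; rewrite lt0r_neq0 // (lt_le_trans _ h) ?ltr01.
rewrite bar_recr; last nlia.
rewrite [ps _ i k.+2]ps_recr; last nlia.
move: ik; rewrite ltnS leq_eqVlt => /orP[/eqP ik|ik].
  rewrite -ik ps1 bar1 big_geq // !omDl !omDr !omZr !omZl !omxx.
  have := nz i.+1; rewrite ltnSn /= => /(_ _) h; have /h{}h : (i.+1 < i + l)%N by nlia.
  by rewrite subr0; field.
rewrite (IHk ik (ltnW ki)) big_nat_recr //=.
have n1 := nz k.+1; have n2 := nz k.
have {}n1 : om (v i) (v k.+1) != 0 by apply: n1; nlia.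
have {}n2 : om (v i) (v k) != 0 by apply: n2; nlia.
set y := ps _ i k.+1.
have key : om y (v k.+1) * om (v i) (v k) =
  om y (v k) * om (v i) (v k.+1) + om (v i) y * om (v k) (v k.+1).
  by rewrite /om; ring.
rewrite !omDl !omDr !omZl !omZr !omxx !mulr0 !addr0.
set g := om (v i) y in key *; set h' := om y (v k.+1) in key *.
set h := om y (v k) in key *; set S := \sum_(_ <= _ < _) _.
set sk := om (v i) (v k) in key n2 *; set sk1 := om (v i) (v k.+1) in key n1 *.
set w := om (v k) (v k.+1) in key *.
have -> : h' = (h * sk1 + g * w) / sk by rewrite -key mulfK.
by field; rewrite n1.
Qed.

(** The sum in [picone] is nonnegative, so only a product of two coordinates of the endpoint
    remains, over a denominator that is at least 1. *)
Lemma open_chain_le x i :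
  bar (bv x) (bv x) i (i + l) <= (W * nm (ps (bv x) i (i + l))) ^+ 2.
Proof.
have l1 := poly_gt1 P.
have {1 2}-> : (i + l = (i + l).-1.+1)%N by nlia.
rewrite picone; last by nlia.
have -> : ((i + l).-1.+1 = i + l)%N by nlia.
have s1 : 1 <= om (v i) (v (i + l).-1) by apply: om_ge1; nlia.
rewrite lerBlDr ler_wpDr //.
  rewrite big_nat sumr_ge0 // => j ji.
  by apply: divr_ge0; apply: mulr_ge0; rewrite ?sqr_ge0 ?(w_ge0 P) //; nlia.
rewrite ler_pdivrMr ?(lt_le_trans ltr01) //.
apply: le_trans (ler_norm _) _; rewrite normrM.
set y := ps _ _ _.
have b1 : `|om (v i) y| <= W * nm y by rewrite omC normrN mulrC om_v_le.
have b2 : `|om y (v (i + l).-1)| <= W * nm y by rewrite mulrC om_v_le.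
have := ler_pM (normr_ge0 _) (normr_ge0 _) b1 b2.
move=> h; apply: le_trans h _; rewrite -expr2 ler_peMr // sqr_ge0.
by [].
Qed.

Section Symmetric.
Variable e : nat -> R.
Hypothesis e_per : forall j, e (j + l)%N = e j.
Hypothesis e_sum0 : \sum_(0 <= j < l) e j = 0.

(** For [l]-periodic [e] the closed polygon of steps [E] is centrally symmetric, so a half turn
    determines it: [si i] is its diagonal from index [i] and [H i] its signed width across the
    direction [v i]. *)
Let E := bv e.
Let si i := ps E i (i + l).
Let H i := om (v i) (si i).

Lemma E_antiper j : E (j + l)%N = - E j.
Proof. by rewrite /E /block_vec e_per (poly_antiper P) /sc /= !mulrN. Qed.

Lemma width_step i : si i.+1 = si i - E i - E i.
Proof.
have l0 := l_gt0 P; rewrite /si addSn ps_recr ?E_antiper; last by nlia.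
by rewrite [ps E i _]ps_recl ?(addrC (E i)) ?addrK //; nlia.
Qed.

Lemma width_anti i : si (i + l)%N = - si i.
Proof.
rewrite /si /ps big_addn addnK -sumrN; apply: eq_big_nat => j _; exact: E_antiper.
Qed.

Lemma width_next i : om (v i) (si i.+1) = H i.
Proof. by rewrite width_step !omBr /E /block_vec omZr omxx mulr0 !subr0. Qed.

(** Moving the first step to the end also reverses it, and the two sign changes cancel. *)
Lemma symmetric_shift i j : bar E E i (i + l) = bar E E j (j + l).
Proof.
suff h k : bar E E k (k + l) = bar E E 0 l by rewrite h -(h j).
elim: k => [|k IHk]; first by rewrite add0n.
have l0 := l_gt0 P; rewrite -{}IHk addSn bar_recr; last by nlia.
rewrite E_antiper omNr -omC [RHS](@bar_cat _ _ _ k k.+1) ?bar1 ?ps1 ?add0r //; nlia.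
Qed.

(* The weighted sum of the widths [H i], with the edge lengths of the
   isoperimetrix as weights, is twice the length of the chain, so it vanishes. *)
Lemma width_sign : exists i, H i * H i.+1 <= 0.
Proof.
apply: contrapT => hH.
have pos i : 0 < H i * H i.+1 by rewrite ltNge; apply/negP => h; apply: hH; exists i.
have l0 := l_gt0 P.
have H0 i : 0 < H 0%N * H i.
  elim: i => [|i IHi].
    by rewrite -expr2 exprn_even_gt0 //=; apply: contraTneq (pos 0%N) => ->; rewrite mul0r ltxx.
  have := mulr_gt0 IHi (pos i).
  have -> : H 0%N * H i * (H i * H i.+1) = H i ^+ 2 * (H 0%N * H i.+1) by ring.
  by rewrite pmulr_rgt0 // exprn_even_gt0 //=; apply: contraTneq (pos i) => ->; rewrite mul0r ltxx.
pose w i := om (v i) (v i.+1); have w0 i : 0 < w i := w_gt0 P i.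
(* [xi i] is a vertex of the isoperimetrix, the polar dual of the hull turned by a right angle, and
   [T i] the length of an edge in units of [v i.+1]; convexity of the hull gives [0 <= T i]. *)
pose xi i := sc (w i)^-1 (v i.+1 - v i).
have xi_anti i : xi (i + l)%N = - xi i.
  rewrite /xi /w -addSn !(poly_antiper P) omNl omNr opprK -opprD.
  by rewrite /sc /= !mulrN.
have om_xi i : om (xi i) (v i) = -1.
  by rewrite /xi omZl omBl omxx subr0 omC mulrN mulVf // lt0r_neq0.
pose T i := (w i + w i.+1 - om (v i) (v i.+2)) / (w i * w i.+1).
have TE i : xi i - xi i.+1 = sc (T i) (v i.+1).
  have n1 := lt0r_neq0 (w0 i); have n2 := lt0r_neq0 (w0 i.+1).
  rewrite /xi /T; rewrite /w in n1 n2 *.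
  move: (v i) (v i.+1) (v i.+2) n1 n2 => [? ?] [? ?] [? ?]; rewrite /sc /om /= => n1 n2.
  by congr pair => /=; field; rewrite n1 n2.
have T0 i : 0 <= T i.
  rewrite divr_ge0 ?mulr_ge0 ?(ltW (w0 _)) //.
  have := poly_supp P i (poly_in P i.+2); rewrite !omBl !omBr omxx /w (omC (v i.+1) (v i)).
  lra.
(* Summation by parts; the boundary terms agree because [xi] and [si] both change sign after a half
   turn. *)
have sum0 : \sum_(0 <= i < l) T i * H i.+1 = 0.
  pose f i := - om (xi i) (si i).
  rewrite (eq_bigr (fun i => (f i.+1 - f i) + 2 * e i)); last first.
    move=> i _; rewrite /H -omZl -TE omBl {1}width_step !omBr /E /block_vec !omZr om_xi /f; ring.
  rewrite big_split /= -mulr_sumr e_sum0 mulr0 addr0 telescope_sumr // /f.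
  by rewrite -[l]add0n xi_anti width_anti omNl omNr opprK subrr.
(* If all widths have one strict sign, the weights vanish and [xi] is constant over a half turn,
   against [xi l = - xi 0]. *)
have T_eq0 i : (i < l)%N -> T i = 0.
  move=> il; rewrite big_mkord in sum0.
  have pos' (k : 'I_l) : true -> 0 <= T k * (H 0%N * H k.+1) by rewrite mulr_ge0 ?(ltW (H0 _)).
  have s0 : \sum_(k < l) T k * (H 0%N * H k.+1) = 0.
    transitivity (H 0%N * \sum_(k < l) T k * H k.+1); last by rewrite sum0 mulr0.
    by rewrite mulr_sumr; apply: eq_bigr => k _; ring.
  have /eqP := psumr_eq0P pos' s0 (i := Ordinal il) isT.
  by rewrite mulf_eq0 (gt_eqF (H0 _)) orbF => /eqP.
have xi_const i : (i <= l)%N -> xi i = xi 0%N.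
  elim: i => // i IHi il; rewrite -IHi ?(ltnW il) //; apply/esym/eqP.
  by rewrite -subr_eq0 TE T_eq0 // /sc !mul0r.
have := om_xi 0%N; rewrite -(xi_const l) // -{1}[l]add0n xi_anti omNl om_xi; lra.
Qed.

(** On zero-sum symmetric polygons the area is negative definite. Starting the half turn where two
    consecutive widths have opposite signs makes all terms of [picone] work in the same
    direction. *)
Lemma symmetric_bound : exists Y, [/\ 0 <= Y, forall j, `|e j| <= Y &
  Y ^+ 2 <= 120 * (l%:R * (W * W) * (W * W)) ^+ 2 * - bar E E 0 l].
Proof.
have [i Hi] := width_sign; have l1 := poly_gt1 P; have l0 := ltnW l1.
have w0 := w_gt0 P i; have w1 : 1 <= om (v i) (v i.+1) by apply: om_ge1; nlia.
have wU : om (v i) (v i.+1) <= W * W := le_trans (ler_norm _) (om_vv_le _ _).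
have omU := om_vv_le; have U1 := W_ge1.
set U := W * W in wU omU U1 *.
pose s := i.+1; set D := - bar E E 0 l; set w := om (v i) (v i.+1) in w0 w1 wU.
pose g k := om (v s) (ps E s k.+1).
pose F j := g j ^+ 2 * om (v j) (v j.+1) / (om (v s) (v j) * om (v s) (v j.+1)).
have e2 : om (si s) (v (i + l)%N) = H i by rewrite (poly_antiper P) omNr -omC width_next.
have e3 : om (v s) (v (i + l)%N) = w by rewrite (poly_antiper P) omNr -omC.
(* The first term of [picone] from [s] to [i + l] is [H i * H s / w], nonpositive by the choice of
   [i]. So [D] bounds each square in the sum, hence each [g j], and differences of [g] bound the
   interior [e j]. *)
have DE : D = - (H i * H s / w) + \sum_(s.+1 <= j < i + l) F j.
  have il : (s < i + l < s + l)%N by nlia.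
  have := picone e il; rewrite -addSn -[bv e]/E -/s.
  rewrite -[ps E s (s + l)]/(si s) e2 e3 -[om (v s) (si s)]/(H s).
  by rewrite (symmetric_shift s 0) add0n /D => ->; rewrite opprB addrC [H s * _]mulrC.
have F0 j : (s < j < i + l)%N -> 0 <= F j.
  by move=> jl; apply: divr_ge0; apply: mulr_ge0; rewrite ?sqr_ge0 ?(w_ge0 P) //; nlia.
have S0 : 0 <= \sum_(s.+1 <= j < i + l) F j.
  by rewrite big_nat sumr_ge0 // => j /F0.
have X0 : H i * H s / w <= 0 by rewrite pmulr_lle0 ?invr_gt0.
have D0 : 0 <= D by rewrite DE addr_ge0 // oppr_ge0.
have HH : - (U * D) <= H i * H s.
  have : - D <= H i * H s / w by rewrite DE; lra.
  by rewrite ler_pdivlMr // => h; apply: le_trans h; rewrite mulNr lerN2 mulrC ler_wpM2r.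
have gj j : (s < j < i + l)%N -> g j ^+ 2 <= U ^+ 2 * D.
  move=> jl; have Fj : F j <= D.
    rewrite DE ler_wpDl ?oppr_ge0 //.
    have sj : (s.+1 <= j)%N by nlia.
    rewrite (big_cat_nat sj) /=; last by nlia.
    rewrite [X in _ + X]big_ltn; last by nlia.
    rewrite addrCA ler_wpDr // addr_ge0 // big_nat sumr_ge0 // => k kl; apply: F0; nlia.
  have p1 : 1 <= om (v s) (v j) by apply: om_ge1; nlia.
  have p2 : 1 <= om (v s) (v j.+1) by apply: om_ge1; nlia.
  have p3 : 1 <= om (v j) (v j.+1) by apply: om_ge1; nlia.
  have q1 : om (v s) (v j) <= U := le_trans (ler_norm _) (omU _ _).
  have q2 : om (v s) (v j.+1) <= U := le_trans (ler_norm _) (omU _ _).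
  have pp : 0 < om (v s) (v j) * om (v s) (v j.+1) by rewrite mulr_gt0 // (lt_le_trans ltr01).
  move: Fj; rewrite /F ler_pdivrMr // => Fj.
  apply: (@le_trans _ _ (g j ^+ 2 * om (v j) (v j.+1))); first by rewrite ler_peMr ?sqr_ge0.
  apply: le_trans Fj _; rewrite mulrC ler_wpM2r // expr2.
  by rewrite ler_pM // (le_trans ler01).
have [N [N0 gN NE]] := max_norm g s.+1 (i + l).
have N2 : N ^+ 2 <= U ^+ 2 * D.
  case: NE => [->|[j jl ->]]; first by rewrite expr0n /= mulr_ge0 ?sqr_ge0.
  by rewrite real_normK ?num_real // gj.
have {}gN j : (s <= j < i + l)%N -> `|g j| <= N.
  move=> /andP[]; rewrite leq_eqVlt => /orP[/eqP <-|sj] jl; last by apply: gN; rewrite sj.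
  by rewrite /g ps1 /E /block_vec omZr omxx mulr0 normr0.
have eN j : (s < j < i + l)%N -> `|e j| <= 2 * N.
  move=> jl; have p1 : 1 <= om (v s) (v j) by apply: om_ge1; nlia.
  have gE : e j * om (v s) (v j) = g j - g j.-1.
    rewrite /g ps_recr; last by nlia.
    by rewrite prednK ?omDr ?omZr; [ring|nlia].
  apply: (@le_trans _ _ (`|e j * om (v s) (v j)|)).
    by rewrite normrM ler_peMr // (le_trans p1) // ler_norm.
  rewrite gE; apply: le_trans (ler_normB _ _) _.
  have h1 : `|g j| <= N by apply: gN; nlia.
  have h2 : `|g j.-1| <= N by apply: gN; nlia.
  by rewrite mulr_natl mulr2n lerD.
have l0R : 1 <= l%:R :> R by rewrite ler1n.
have sum_int (z : nat -> R) (M : R) : 0 <= M -> (forall j, `|z j| <= M) ->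
    `|\sum_(s.+1 <= j < i + l) e j * z j| <= 2 * N * M * l%:R.
  move=> M0 zM; apply: le_trans (ler_norm_sum _ _ _) _.
  rewrite big_nat; apply: (@le_trans _ _ (\sum_(s.+1 <= j < i + l) 2 * N * M)).
    by rewrite [leRHS]big_nat; apply: ler_sum => j jl; rewrite normrM ler_pM ?eN ?zM.
  rewrite sumr_const_nat -[2 * N * M *+ _]mulr_natr ler_wpM2l ?mulr_ge0 // ler_nat; nlia.
have split_sum (z : nat -> R) : \sum_(s <= j < s + l) z j =
    z s + \sum_(s.+1 <= j < i + l) z j + z (i + l)%N.
  have sl : (s < i + l)%N by nlia.
  by rewrite addSn big_nat_recr ?(ltnW sl) //= (big_ltn sl).
(* The extreme values [e s] and [e (i + l)] are not bounded through [g]. They are nearly opposite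
   because [e] sums to zero, and [H i], [H s] are nearly [w] times them, so the lower bound on
   [H i * H s] bounds the square of [e s]. *)
have q0 : `|e s + e (i + l)%N| <= 2 * N * l%:R.
  have := sum_int (fun=> 1) 1 ler01; rewrite normr1 lexx mulr1 => /(_ (fun=> isT)).
  rewrite (eq_bigr e) => [|j _]; last by rewrite mulr1.
  have := split_sum e; rewrite (sum_period _ e_per) e_sum0 => h.
  have -> : e s + e (i + l)%N = - \sum_(s.+1 <= j < i + l) e j by lra.
  by rewrite normrN.
have r2 : `|H s - w * e (i + l)%N| <= N.
  rewrite /H /si addSn ps_recr; last by nlia.
  rewrite omDr {2}/E /block_vec omZr e3 [w * _]mulrC addrK.
  have := @gN (i + l).-1; rewrite /g prednK; last by nlia.
  by apply; nlia.
have r1 : `|H i - w * e s| <= 2 * N * U * l%:R.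
  rewrite -width_next /si om_sumr split_sum -/E.
  rewrite {1 3}/E /block_vec !omZr (poly_antiper P) omNr omxx oppr0 mulr0 addr0.
  rewrite [e s * _]mulrC addrC addKr.
  rewrite (eq_bigr (fun j => e j * om (v i) (v j))) => [|j _]; last by rewrite omZr.
  by apply: sum_int => //; rewrite (le_trans ler01).
have eM j q : e (j + q * l)%N = e j.
  by elim: q => [|q IHq]; rewrite ?addn0 // mulSn [(l + _)%N]addnC addnA e_per.
have LN : N <= l%:R * N by rewrite ler_peMl.
exists (`|e s| + 2 * N * l%:R); split.
- by rewrite addr_ge0 ?mulr_ge0.
- move=> j; pose d := (j + s * l - s)%N.
  have dj : (s + d %% l + (d %/ l) * l = j + s * l)%N.
    have := divn_eq d l; have : (s <= s * l)%N by rewrite leq_pmulr.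
    rewrite /d; nlia.
  have dl : (d %% l < l)%N by rewrite ltn_mod.
  rewrite -(eM j s) -dj eM; move: (d %% l)%N dl => k kl.
  have [->|k0] := posnP k; first by rewrite addn0 lerDl !mulr_ge0.
  have [kl'|kl'] := ltnP (s + k)%N (i + l).
    have := @eN (s + k)%N; have -> : (s < s + k < i + l)%N by rewrite kl' andbT; nlia.
    by move=> /(_ isT) h; have := normr_ge0 (e s); lra.
  have -> : (s + k = i + l)%N by nlia.
  have := ler_normB (e s + e (i + l)%N) (e s); rewrite addrC addKr => h; lra.
set L := l%:R in q0 r1 r2 l0R LN *; set B := e s in q0 r1 *; set B' := e (i + l)%N in q0 r2 *.
have N'2 : N ^+ 2 <= U ^+ 2 * D := N2.
have A1 : 1 <= L * U by apply: mulr_ege1.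
have U0 : 0 <= U by lra.
pose M := 3 * (L * U) * N.
have W0 := W_ge0; have M0 : 0 <= M by rewrite /M !mulr_ge0.
have x1 : `|H i - w * B| <= M.
  by apply: le_trans r1 _; rewrite /M; have := mulr_ge0 (le_trans ler01 A1) N0; lra.
have x2 : `|H s + w * B| <= M.
  have -> : H s + w * B = (H s - w * B') + w * (B + B') by ring.
  apply: le_trans (ler_normD _ _) _; rewrite normrM (gtr0_norm w0).
  have h1 : w * `|B + B'| <= U * (2 * N * L) by rewrite ler_pM // ltW.
  have h2 : N <= L * U * N by rewrite ler_peMl.
  by apply: le_trans (lerD r2 h1) _; rewrite /M; lra.
have b2 : (w * B) ^+ 2 <= 2 * (U * D) + 6 * M ^+ 2.
  set b := w * B in x1 x2 *; set x := H i - b in x1; set y := H s + b in x2.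
  have E1 : H i * H s = (b + x) * (y - b) by rewrite /x /y; ring.
  have h1 : b * y <= `|b| * M by apply: le_trans (ler_norm _) _; rewrite normrM ler_wpM2l.
  have h2 : - (b * x) <= `|b| * M by apply: le_trans (ler_norm _) _; rewrite normrN normrM ler_wpM2l.
  have h3 : x * y <= M * M by apply: le_trans (ler_norm _) _; rewrite normrM ler_pM.
  have h4 : `|b| ^+ 2 = b ^+ 2 by rewrite real_normK ?num_real.
  have h5 := sqr_ge0 (`|b| - 2 * M).
  by rewrite E1 in HH; lra.
have B2 : B ^+ 2 <= (w * B) ^+ 2.
  by rewrite exprMn ler_peMl ?sqr_ge0 // expr_ge1 // ltW.
pose Q := (L * U * U) ^+ 2 * D.
have Q1 : U * D <= Q.
  rewrite /Q ler_wpM2r // exprMn; apply: (@le_trans _ _ (U ^+ 2)).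
    by rewrite expr2 ler_peMl.
  by rewrite ler_peMl ?sqr_ge0 // expr_ge1 // (le_trans ler01).
have Q2 : M ^+ 2 <= 9 * Q.
  have -> : M ^+ 2 = 9 * ((L * U) ^+ 2 * N ^+ 2) by rewrite /M; ring.
  have -> : 9 * Q = 9 * ((L * U) ^+ 2 * (U ^+ 2 * D)) by rewrite /Q; ring.
  by rewrite ler_wpM2l // ler_wpM2l ?sqr_ge0.
have Q3 : (N * L) ^+ 2 <= Q.
  rewrite exprMn mulrC; apply: (@le_trans _ _ (L ^+ 2 * (U ^+ 2 * D))); first by rewrite ler_wpM2l ?sqr_ge0.
  have -> : Q = U ^+ 2 * (L ^+ 2 * (U ^+ 2 * D)) by rewrite /Q; ring.
  by rewrite ler_peMl ?mulr_ge0 ?sqr_ge0 // expr_ge1.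
(* From [B ^+ 2 <= (2 + 6 * 9) * Q], the square of [|B| + 2 * N * L] is at most
   [(2 * 56 + 8) * Q]. *)
have -> : 120 * (L * U * U) ^+ 2 * D = 120 * Q by rewrite /Q; ring.
have := sqr_ge0 (`|B| - 2 * N * L); have := real_normK (num_real B).
move=> hB h5; lra.
Qed.

End Symmetric.

Lemma sum_nm_le a c d (M : R) : (forall j, `|a j| <= M) ->
  \sum_(c <= j < d) nm (bv a j) <= (d - c)%:R * (M * W).
Proof.
move=> aM; apply: (@le_trans _ _ (\sum_(c <= j < d) M * W)).
  apply: ler_sum => j _; rewrite nmZ; apply: ler_pM => //; exact: nm_ge0.
by rewrite sumr_const_nat mulr_natl.
Qed.

(* The reverse Minkowski inequality: the area form is Lorentzian, and negative
   on differences of polygons of equal length and equal endpoint. *)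
Lemma area_le : exists2 K : R, 0 <= K &
  forall a c, periodic a -> area c a <= K * (nm (sigma a) ^+ 2 + ell a ^+ 2).
Proof.
have l0 := l_gt0 P; have l0R : 0 < l%:R :> R by rewrite ltr0n.
have W0 := W_ge0; have U1 := W_ge1.
have Wp : 0 < W by rewrite lt_neqAle W0 andbT; apply: contraTneq U1 => <-; rewrite mulr0 ler10.
set L := l%:R in l0R.
have [C CE C0] : exists2 C, C = 120 * (L * (W * W) * (W * W)) ^+ 2 & 0 < C.
  by exists (120 * (L * (W * W) * (W * W)) ^+ 2) => //; rewrite mulr_gt0 // exprn_gt0 // !mulr_gt0.
pose q := L * W; have q0 : 0 <= q by rewrite mulr_ge0 // ltW.
exists (W ^+ 2 + 2 * C * (q * q) ^+ 2 + q * q + C * q ^+ 2 + q).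
  by rewrite !addr_ge0 ?mulr_ge0 ?sqr_ge0 ?(ltW C0).
move=> a c ap.
(* Under the half turn [a] splits into an even part [e = e' + lam], with mean [lam], and an odd part
   [d], each halved. The length is carried by [lam], the endpoint by [d], and [e'] falls under
   [symmetric_bound]. *)
pose d j := a j - a (j + l)%N; pose e j := a j + a (j + l)%N.
pose lam := ell a / L; pose e' j := e j - lam.
have e'per j : e' (j + l)%N = e' j by rewrite /e' /e -addnA ap [a (j + l)%N + _]addrC.
have ellE2 : ell a = \sum_(0 <= j < l) e j.
  rewrite /block_length (big_cat_nat (leq0n l) (leq_addr l l)) /= -{2}[l]add0n big_addn addnK.
  by rewrite -big_split.
have e'sum : \sum_(0 <= j < l) e' j = 0.
  rewrite sumrB -ellE2 sumr_const_nat subn0 -mulr_natr -/L /lam divfK ?subrr //.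
  exact: lt0r_neq0.
have [Y [Y0 eY Y2]] := symmetric_bound e'per e'sum.
rewrite -/L -CE in Y2; rewrite (symmetric_shift e'per 0 c) in Y2.
have bvE j : bv a j = sc (1/2) (bv e' j) + sc (1/2) (sc lam (v j)) + sc (1/2) (bv d j).
  by rewrite /block_vec /sc /e' /e /d; congr pair => /=; field.
have bvE2 j : bv a (j + l)%N = sc (1/2) (bv d j) + sc (-(1/2)) (bv e' j) + sc (-(1/2)) (sc lam (v j)).
  by rewrite /block_vec (poly_antiper P) /sc /e' /e /d; congr pair => /=; field.
pose vl j := sc lam (v j).
have sE : sigma a = ps (bv d) c (c + l).
  rewrite -(sigmaE P c ap) (ps_cat _ (leq_addr l c)) ?leq_add2l ?leq_addr //.
  rewrite addnA ps_shift (eq_ps (fun j _ => bvE j)) (eq_ps (fun j _ => bvE2 j)) !psD !psZ.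
  by rewrite /sc; move: (ps _ _ _) (ps _ _ _) (ps _ _ _) => [? ?] [? ?] [? ?]; congr pair => /=; field.
have aE : area c a = 1/2 * (bar (bv d) (bv d) c (c + l) +
   (bar (bv e') (bv e') c (c + l) + lam * (bar (bv e') v c (c + l) + bar v (bv e') c (c + l)) +
   lam ^+ 2 * bar v v c (c + l)) + om (ps (bv e') c (c + l) + sc lam (ps v c (c + l))) (sigma a)).
  rewrite /block_area (bar_cat _ _ (leq_addr l c)) ?leq_add2l ?leq_addr //.
  rewrite addnA bar_shift ps_shift sE.
  rewrite (eq_bar (fun j _ => bvE j) (fun j _ => bvE j)) (eq_bar (fun j _ => bvE2 j) (fun j _ => bvE2 j)).
  rewrite (eq_ps (fun j _ => bvE j)) (eq_ps (fun j _ => bvE2 j)) !psD !psZ.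
  rewrite !barDl !barDr !barZl !barZr !omDl !omDr !omZl !omZr !omxx.
  rewrite (omC (ps (bv d) _ _)) (omC (ps v _ _) (ps (bv e') _ _)) (omC (ps (bv d) _ _)).
  by field.
set B := bar (bv e') (bv e') c (c + l) in Y2 aE.
set s := nm (sigma a) in aE *; have s0 : 0 <= s by apply: nm_ge0.
set t := `|lam|; have t0 : 0 <= t by apply: normr_ge0.
have t2 : t ^+ 2 <= ell a ^+ 2.
  rewrite real_normK ?num_real // /lam expr_div_n ler_pdivrMr ?exprn_gt0 // ler_peMr ?sqr_ge0 //.
  by rewrite expr_ge1 ?ler1n // ltW.
have lE : (c + l - c)%:R = L by rewrite addKn.
have se : \sum_(c <= j < c + l) nm (bv e' j) <= q * Y.
  by apply: le_trans (sum_nm_le _ _ eY) _; rewrite lE /q; lra.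
have sv : \sum_(c <= j < c + l) nm (v j) <= q.
  apply: (@le_trans _ _ (\sum_(c <= j < c + l) W)); first by apply: ler_sum.
  by rewrite sumr_const_nat -[W *+ _]mulr_natl lE.
have s1 : 0 <= \sum_(c <= j < c + l) nm (bv e' j) by rewrite sumr_ge0 // => j _; apply: nm_ge0.
have s2 : 0 <= \sum_(c <= j < c + l) nm (v j) by rewrite sumr_ge0 // => j _; apply: nm_ge0.
have cl : (c <= c + l)%N by apply: leq_addr.
have b1 : `|bar (bv e') v c (c + l)| <= q * Y * q by apply: le_trans (ler_bar _ _ cl) _; rewrite ler_pM.
have b2 : `|bar v (bv e') c (c + l)| <= q * (q * Y) by apply: le_trans (ler_bar _ _ cl) _; rewrite ler_pM.
have b3 : `|bar v v c (c + l)| <= q * q by apply: le_trans (ler_bar _ _ cl) _; rewrite ler_pM.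
have b4 : bar (bv d) (bv d) c (c + l) <= W ^+ 2 * s ^+ 2.
  by rewrite -exprMn /s sE; apply: (open_chain_le).
set z := ps (bv e') c (c + l) + sc lam (ps v c (c + l)) in aE.
have nz : nm z <= q * Y + t * q.
  apply: le_trans (ler_nmD _ _) _; rewrite nmZ lerD //.
    by apply: le_trans (ler_nm_sum _ _ _) se.
  by rewrite ler_wpM2l //; apply: le_trans (ler_nm_sum _ _ _) sv.
have b5 : om z (sigma a) <= (q * Y + t * q) * s.
  apply: le_trans (ler_norm _) _; apply: le_trans (ler_om _ _) _.
  by rewrite ler_wpM2r.
have b6 : lam * (bar (bv e') v c (c + l) + bar v (bv e') c (c + l)) <= t * (2 * (q * q * Y)).
  apply: le_trans (ler_norm _) _; rewrite normrM ler_wpM2l //.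
  by apply: le_trans (ler_normD _ _) _; lra.
have b7 : lam ^+ 2 * bar v v c (c + l) <= t ^+ 2 * (q * q).
  rewrite real_normK ?num_real // ler_wpM2l ?sqr_ge0 //.
  by apply: le_trans (ler_norm _) b3.
have C1 : 0 <= C^-1 by rewrite invr_ge0 ltW.
have Cn : C != 0 by apply: lt0r_neq0.
(* Terms linear in [Y] are absorbed in [Y ^+ 2 / C <= - B] by completing the squares [k2] and
   [k3]. *)
have k1 : C^-1 * Y ^+ 2 <= - B by rewrite ler_pdivrMl.
have k2 := mulr_ge0 C1 (sqr_ge0 (Y - 2 * C * (q * q) * t)).
have k3 := mulr_ge0 C1 (sqr_ge0 (Y - C * q * s)).
have {}k2 : 4 * (q * q) * t * Y <= C^-1 * Y ^+ 2 + 4 * C * (q * q) ^+ 2 * t ^+ 2.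
  rewrite -subr_ge0; apply: le_trans k2 _; rewrite le_eqVlt; apply/orP; left; apply/eqP.
  by field.
have {}k3 : 2 * q * s * Y <= C^-1 * Y ^+ 2 + C * q ^+ 2 * s ^+ 2.
  rewrite -subr_ge0; apply: le_trans k3 _; rewrite le_eqVlt; apply/orP; left; apply/eqP.
  by field.
have k4 := mulr_ge0 q0 (sqr_ge0 (s - t)).
have st : 0 <= q * s ^+ 2 by rewrite mulr_ge0 ?sqr_ge0.
have st' : 0 <= q * t ^+ 2 by rewrite mulr_ge0 ?sqr_ge0.
have final : 2 * area c a <= W ^+ 2 * s ^+ 2 + 2 * C * (q * q) ^+ 2 * t ^+ 2 + q * q * t ^+ 2 +
    C * q ^+ 2 * s ^+ 2 + q * t ^+ 2 + q * s ^+ 2.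
  have h : 0 <= C * q ^+ 2 * s ^+ 2 by rewrite !mulr_ge0 ?sqr_ge0 ?(ltW C0).
  by rewrite aE; lra.
set K1 := 2 * C * _ ^+ 2 in final *; set K2 := C * q ^+ 2 in final *; set K3 := W ^+ 2 in final *.
have K10 : 0 <= K1 by rewrite !mulr_ge0 ?sqr_ge0 ?(ltW C0).
have K20 : 0 <= K2 by rewrite !mulr_ge0 ?sqr_ge0 ?(ltW C0).
have K30 : 0 <= K3 by apply: sqr_ge0.
have K40 : 0 <= q * q by rewrite mulr_ge0.
set S := s ^+ 2 in final *; set T := ell a ^+ 2 in t2 *; set T' := t ^+ 2 in t2 final.
have S0 : 0 <= S by apply: sqr_ge0.
have T0 : 0 <= T by apply: sqr_ge0.
have m1 := ler_wpM2l K10 t2; have m2 := ler_wpM2l K40 t2; have m3 := ler_wpM2l q0 t2.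
have n1 := mulr_ge0 K10 S0; have n2 := mulr_ge0 K40 S0; have n3 := mulr_ge0 K20 T0.
have n4 := mulr_ge0 K30 T0; have n5 := mulr_ge0 K30 S0; have n6 := mulr_ge0 K20 S0.
have n7 := mulr_ge0 K10 T0; have n8 := mulr_ge0 K40 T0; have n9 := mulr_ge0 q0 T0.
have n10 := mulr_ge0 q0 S0.
move: final; rewrite !mulrDl !mulrDr => final; lra.
Qed.

End ReverseMinkowski.

(** * Coordinates, word length and walks *)

Section HeisenbergCoordinates.
Local Open Scope ring_scope.
Implicit Types (g h : heisenberg) (x y z : int).

Let o0 : 'I_3 := @Ordinal 3 0 isT.
Let o1 : 'I_3 := @Ordinal 3 1 isT.
Let o2 : 'I_3 := @Ordinal 3 2 isT.

Definition hx g : int := hmx g o0 o1.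
Definition hy g : int := hmx g o1 o2.
Definition hz g : int := hmx g o0 o2.

Lemma ord3P (Q : 'I_3 -> Prop) : Q o0 -> Q o1 -> Q o2 -> forall i, Q i.
Proof.
move=> q0 q1 q2 [[|[|[|//]]] i3].
- by have -> : Ordinal i3 = o0 by apply: val_inj.
- by have -> : Ordinal i3 = o1 by apply: val_inj.
- by have -> : Ordinal i3 = o2 by apply: val_inj.
Qed.

Lemma hmx_low g (i j : 'I_3) : (j <= i)%N -> hmx g i j = (i == j)%:R.
Proof. by move=> ji; have /unitriangularP -> := hmx_unitriangular g. Qed.

Lemma hmx_unit g : (hmx g o0 o0 = 1) * (hmx g o1 o1 = 1) * (hmx g o2 o2 = 1) *
  (hmx g o1 o0 = 0) * (hmx g o2 o0 = 0) * (hmx g o2 o1 = 0).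
Proof. by rewrite !hmx_low. Qed.

Lemma heis_ext g h : hx g = hx h -> hy g = hy h -> hz g = hz h -> g = h.
Proof.
move=> ex ey ez; apply: val_inj; apply/matrixP.
by apply: ord3P; apply: ord3P; first [exact: ex | exact: ey | exact: ez | rewrite !hmx_low].
Qed.

Lemma hmulE g h i j : hmx (g * h)%g i j =
  hmx g i o0 * hmx h o0 j + hmx g i o1 * hmx h o1 j + hmx g i o2 * hmx h o2 j.
Proof.
rewrite mxE !big_ord_recl big_ord0 addr0 addrA.
by congr (_ + _ + _); congr (hmx g _ _ * hmx h _ _); apply: val_inj.
Qed.

Lemma hxM g h : hx (g * h)%g = hx g + hx h.
Proof. by rewrite /hx hmulE !hmx_unit mul1r mulr1 mulr0 addr0 addrC. Qed.
Lemma hyM g h : hy (g * h)%g = hy g + hy h.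
Proof. by rewrite /hy hmulE !hmx_unit mul0r mul1r mulr1 add0r addrC. Qed.
Lemma hzM g h : hz (g * h)%g = hz g + hz h + hx g * hy h.
Proof. by rewrite /hz hmulE !hmx_unit mul1r mulr1 /hx /hy; ring. Qed.

Lemma mkh_subproof x y z : unitriangular (\matrix_(i, j)
  if (i == o0) && (j == o1) then x else if (i == o1) && (j == o2) then y
  else if (i == o0) && (j == o2) then z else (i == j)%:R : int).
Proof. by apply/unitriangularP; apply: ord3P; apply: ord3P; rewrite ?mxE. Qed.

Definition mkh x y z : heisenberg := Heisenberg (mkh_subproof x y z).

Lemma hx_mkh x y z : hx (mkh x y z) = x. Proof. by rewrite /hx mxE. Qed.
Lemma hy_mkh x y z : hy (mkh x y z) = y. Proof. by rewrite /hy mxE. Qed.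
Lemma hz_mkh x y z : hz (mkh x y z) = z. Proof. by rewrite /hz mxE. Qed.

Variable R : archiRealFieldType.
Local Notation vec := (R * R)%type.

Definition planar g : vec := ((hx g)%:~R, (hy g)%:~R).
Local Notation hp := planar.
Definition zt g : R := (2 * hz g - hx g * hy g)%:~R.

Lemma hpM g h : hp (g * h)%g = hp g + hp h.
Proof. by rewrite /hp hxM hyM !rmorphD. Qed.

Lemma ztM g h : zt (g * h)%g = zt g + zt h + om (hp g) (hp h).
Proof.
rewrite /zt /om /= hxM hyM hzM !(rmorphB, rmorphD, rmorphM) /=; ring.
Qed.

Lemma hp1 : hp 1%g = 0.
Proof.
have := hpM 1%g 1%g; rewrite mulg1 => /eqP.
by rewrite -subr_eq0 opprD addrA subrr sub0r oppr_eq0 => /eqP.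
Qed.

Lemma zt1 : zt 1%g = 0.
Proof.
have := ztM 1%g 1%g; rewrite mulg1 hp1 om0l; lra.
Qed.

Lemma hp_inv g : hp g^-1%g = - hp g.
Proof. by apply/eqP; rewrite -addr_eq0 -hpM mulVg hp1. Qed.

Lemma ztV g : zt g^-1%g = - zt g.
Proof. by have := ztM g^-1%g g; rewrite mulVg zt1 hp_inv omNl omxx; lra. Qed.

Lemma zt_conj g h : zt (g * h * g^-1)%g = zt h + 2 * om (hp g) (hp h).
Proof. rewrite !ztM ztV hpM hp_inv !(omNr, omDl) omxx (omC (hp h)); ring. Qed.

Lemma hp_prod (I : Type) (r : seq I) (F : I -> heisenberg) :
  hp (\prod_(i <- r) F i)%g = \sum_(i <- r) hp (F i).
Proof. by apply: (big_morph hp) => [g h|]; rewrite ?hpM ?hp1. Qed.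

Lemma zt_prod (w : seq heisenberg) :
  zt (\prod_(s <- w) s)%g = \sum_(s <- w) zt s + larea [seq hp s | s <- w].
Proof.
elim: w => [|s w IHw]; first by rewrite !big_nil zt1 addr0.
by rewrite !big_cons ztM IHw hp_prod /= big_map; ring.
Qed.

(** Reversal negates the area and keeps the linear part; up to a linear error, negative [zt] is thus
    reduced to positive. *)
Lemma zt_prod_rev (w : seq heisenberg) :
  zt (\prod_(s <- rev w) s)%g = 2 * \sum_(s <- w) zt s - zt (\prod_(s <- w) s)%g.
Proof.
elim: w => [|s w IHw]; first by rewrite !big_nil zt1; lra.
rewrite rev_cons big_rcons /= ztM {}IHw !big_cons ztM hp_prod.
have -> : \sum_(i <- rev w) hp i = \sum_(i <- w) hp i by apply: perm_big; rewrite perm_rev.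
rewrite hp_prod (omC (hp s)); ring.
Qed.

Lemma heis_ext_hp g h : hp g = hp h -> zt g = zt h -> g = h.
Proof.
move=> [/intr_inj ex /intr_inj ey] /intr_inj; rewrite ex ey => ez.
by apply: heis_ext => //; lia.
Qed.

Lemma centralE (z : heisenberg) g : hp z = 0 -> (z * g)%g = (g * z)%g.
Proof.
move=> z0; apply: heis_ext_hp; first by rewrite !hpM addrC.
by rewrite !ztM z0 om0l om0r addr0 addrC addr0.
Qed.

End HeisenbergCoordinates.

Lemma leastP (Q : nat -> Prop) : (exists n, Q n) ->
  Q (least Q) /\ forall n, Q n -> (least Q <= n)%N.
Proof.
move=> exQ; rewrite /least; case: pselect => [exQ'|[]]; last by case: exQ => n Qn; exists n; apply/asboolP.
by case: ex_minnP => n /asboolP Qn nmin; split=> // k /asboolP /nmin.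
Qed.

Section WordLength.
Local Open Scope ring_scope.
Variable S : {fset heisenberg}.
Hypothesis S_sym : symmetric_set S.
Hypothesis S_gen : generating S.
Implicit Types (g h s t : heisenberg) (w u : seq heisenberg).

Local Notation wl := (word_length S).
Local Notation wprod w := (\prod_(s <- w) s)%g.

Lemma cat_subset w u : {subset w <= S} -> {subset u <= S} -> {subset w ++ u <= S}.
Proof. by move=> wS uS s; rewrite mem_cat => /orP[/wS|/uS]. Qed.

Lemma word_inv w : {subset w <= S} ->
  let w' := [seq (s^-1)%g | s <- rev w] in {subset w' <= S} /\ wprod w' = (wprod w)^-1%g.
Proof.
move=> wS w'; split.
  move=> s /mapP[t]; rewrite mem_rev => /wS tS ->; exact: S_sym.
rewrite /w'; elim: w {wS w'} => [|s w IHw]; first by rewrite !big_nil invg1.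
by rewrite rev_cons map_rcons big_rcons /= IHw big_cons invgM.
Qed.

Lemma generates g : exists2 w, {subset w <= S} & wprod w = g.
Proof.
pose H := [pred g | `[< exists2 w, {subset w <= S} & wprod w = g >]].
have /asboolP // : g \in H; apply: S_gen => [|s sS]; last first.
  by apply/asboolP; exists [:: s]; rewrite ?big_seq1 // => t; rewrite inE => /eqP ->.
split; first by apply/asboolP; exists [::]; rewrite ?big_nil.
move=> x y /asboolP[w wS <-] /asboolP[u uS <-]; apply/asboolP.
have [u'S u'E] := word_inv uS.
by eexists; first exact: (cat_subset wS u'S); rewrite big_cat u'E.
Qed.

Lemma wl_spec g :
  (exists w, [/\ {subset w <= S}, wprod w = g & size w = wl g]) /\
  forall w, {subset w <= S} -> wprod w = g -> (wl g <= size w)%N.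
Proof.
have [w0 w0S w0g] := generates g.
have [|h1 h2] := @leastP (fun n => exists w : seq heisenberg,
      [/\ {subset w <= S}, wprod w = g & size w = n]).
  by exists (size w0), w0.
by split=> // w wS wg; apply: h2; exists w.
Qed.

Lemma wl_word g : exists w, [/\ {subset w <= S}, wprod w = g & size w = wl g].
Proof. by have [] := wl_spec g. Qed.

Lemma wl_prod w : {subset w <= S} -> (wl (wprod w) <= size w)%N.
Proof. by move=> wS; have [_ ->] := wl_spec (wprod w). Qed.

Lemma wlM g h : (wl (g * h)%g <= wl g + wl h)%N.
Proof.
have [w [wS wg ws]] := wl_word g; have [u [uS ug us]] := wl_word h.
rewrite -ws -us -size_cat -wg -ug -big_cat; exact/wl_prod/cat_subset.
Qed.

Lemma wlV g : wl g^-1%g = wl g.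
Proof.
have h x : (wl x^-1%g <= wl x)%N.
  have [w [wS wg ws]] := wl_word x; have [w'S w'E] := word_inv wS.
  by rewrite -ws -wg -w'E (leq_trans (wl_prod w'S)) // size_map size_rev.
by apply/eqP; rewrite eqn_leq h -{1}(invgK g) h.
Qed.

Lemma wl_letter s : s \in S -> (wl s <= 1)%N.
Proof.
move=> sS; have := @wl_prod [:: s]; rewrite big_seq1; apply=> t.
by rewrite inE => /eqP ->.
Qed.

Lemma wlXn g n : (wl (g ^+ n)%g <= n * wl g)%N.
Proof.
elim: n => [|n IHn]; last by rewrite expgS mulSn (leq_trans (wlM _ _)) ?leq_add2l.
by have := @wl_prod [::]; rewrite big_nil; apply.
Qed.

Variable R : archiRealFieldType.
Local Notation hp := (planar R).
Local Notation zt := (zt R).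

Lemma letter_bound : exists2 B : R, 1 <= B & forall s, s \in S -> nm (hp s) <= B /\ `|zt s| <= B.
Proof.
suff [B B1 h] : exists2 B : R, 1 <= B & forall s, s \in (S : seq _) -> nm (hp s) <= B /\ `|zt s| <= B.
  by exists B.
elim: (S : seq heisenberg) => [|s w [B B1 IHw]]; first by exists 1.
exists (B + nm (hp s) + `|zt s|); first by rewrite -addrA ler_wpDr // addr_ge0 ?nm_ge0.
move=> t; have h1 := nm_ge0 (hp s); have h2 := normr_ge0 (zt s).
by rewrite inE => /orP[/eqP ->|/IHw[]]; [split|move=> k1 k2; split]; lra.
Qed.

Lemma nm_larea (u : seq (R * R)) : `|larea u| <= (\sum_(x <- u) nm x) ^+ 2.
Proof.
elim: u => [|x u IHu]; first by rewrite normr0 sqr_ge0.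
rewrite big_cons /=; apply: le_trans (ler_normD _ _) _.
have h1 : `|om x (\sum_(y <- u) y)| <= nm x * \sum_(y <- u) nm y.
  by apply: le_trans (ler_om _ _) _; rewrite ler_wpM2l ?nm_ge0 ?ler_nm_sum.
have s0 : 0 <= \sum_(y <- u) nm y by rewrite sumr_ge0 // => *; apply: nm_ge0.
have p := mulr_ge0 (nm_ge0 x) s0; have q := sqr_ge0 (nm x).
apply: le_trans (lerD h1 IHu) _; lra.
Qed.

Lemma box_bounded (r : R) : exists C : nat, forall g,
  nm (hp g) <= r -> `|zt g| <= r -> (wl g <= C)%N.
Proof.
(* [M] also bounds [hz g], as [2 * hz g] is [zt g + hx g * hy g]; coordinates are shifted by [M] to
   be enumerated by natural numbers. *)
pose N := Num.bound r; pose M := (N + N * N)%N.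
pose f (i j k : nat) := mkh (i%:Z - M%:Z) (j%:Z - M%:Z) (k%:Z - M%:Z).
exists (\max_(i < (M + M).+1) \max_(j < (M + M).+1) \max_(k < (M + M).+1) wl (f i j k)).
move=> g hn hz'.
have xN (x : int) : `|x%:~R| <= r :> R -> (`|x| < N)%N.
  move=> xr; have r0 : 0 <= r by apply: le_trans xr.
  have := le_lt_trans xr (archi_boundP r0).
  by rewrite -intr_norm -abszE -pmulrn ltr_nat.
have h1 : (`|hx g| < N)%N by apply: xN; apply: le_trans hn; rewrite /nm /= lerDl.
have h2 : (`|hy g| < N)%N by apply: xN; apply: le_trans hn; rewrite /nm /= lerDr.
have h3 : (absz (2 * hz g - hx g * hy g)%R < N)%N by apply: xN.
have h4 : (`|hz g| <= M)%N by rewrite /M; nia.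
have gE : g = f (absz (hx g + M%:Z)) (absz (hy g + M%:Z)) (absz (hz g + M%:Z)).
  by apply: heis_ext; rewrite ?hx_mkh ?hy_mkh ?hz_mkh /M; lia.
rewrite {1}gE.
have k1 : (absz (hx g + M%:Z)%R < (M + M).+1)%N by rewrite /M; lia.
have k2 : (absz (hy g + M%:Z)%R < (M + M).+1)%N by rewrite /M; lia.
have k3 : (absz (hz g + M%:Z)%R < (M + M).+1)%N by lia.
apply: leq_trans (leq_bigmax (Ordinal k1)).
apply: leq_trans (leq_bigmax (Ordinal k2)).
exact: (leq_bigmax (Ordinal k3)).
Qed.

End WordLength.

Section Walks.
Local Open Scope group_scope.
Variable S : {fset heisenberg}.
Hypothesis S_sym : symmetric_set S.
Hypothesis S_gen : generating S.
Implicit Types (g h s x y z : heisenberg) (w p : seq heisenberg).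
Local Notation wl := (word_length S).
Local Notation wprod w := (\prod_(s <- w) s).

Definition walk n M g h := exists p,
  [/\ path_between S g h p, size p <= M & {subset g :: p <= cayley_ball S n}].

Lemma walk_trans n M N g h x : walk n M g h -> walk n N h x -> walk n (M + N) g x.
Proof.
move=> [p [[p1 p2] ps pb]] [q [[q1 q2] qs qb]]; exists (p ++ q); split.
- by split; rewrite ?cat_path ?last_cat p2 ?p1.
- by rewrite size_cat leq_add.
move=> y; rewrite inE mem_cat orbA => /orP[yp|yq]; first by apply: pb; rewrite inE.
by apply: qb; rewrite inE yq orbT.
Qed.

Lemma walk_word n g w : {subset w <= S} ->
  (forall i, i <= size w -> wl (g * wprod (take i w)) <= n) -> walk n (size w) g (g * wprod w).
Proof.
elim: w g => [|s w IHw] g wS wn.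
  exists [::]; split=> //; first by rewrite big_nil mulg1.
  by move=> x; rewrite inE => /eqP ->; have := wn 0 isT; rewrite big_nil mulg1.
have [|i iw|p [[p1 p2] ps pb]] := IHw (g * s).
- by move=> x xw; apply: wS; rewrite inE xw orbT.
- by have := wn i.+1 iw; rewrite /= big_cons mulgA.
exists (g * s :: p); split=> //; last first.
  move=> x; rewrite inE => /orP[/eqP ->|/pb //].
  by have := wn 0 isT; rewrite take0 big_nil mulg1.
split; first by apply/andP; split=> //; rewrite /cayley /= mulKg wS ?mem_head.
by rewrite /= big_cons mulgA.
Qed.

Lemma cayley_sym g h : cayley S g h -> cayley S h g.
Proof. by rewrite /cayley /= => /S_sym; rewrite invgM invgK. Qed.

Lemma walk_sym n M g h : walk n M g h -> walk n M h g.
Proof.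
move=> [p [[p1 p2] ps pb]]; exists (rev (belast g p)); split.
- split; last by case: p {p1 ps pb} p2 => [//|x p _]; rewrite /= rev_cons last_rcons.
  rewrite -p2 rev_path; apply: sub_path p1 => x y; exact: cayley_sym.
- by rewrite size_rev size_belast.
move=> x; rewrite inE mem_rev => /orP[/eqP ->|/mem_belast]; last exact: pb.
by apply: pb; rewrite -p2 mem_last.
Qed.

Lemma wl_dist g h k : cayley_dist S g h <= k -> wl (g^-1 * h) <= k.
Proof.
have [|[p [p1 ph] sp] _ pk] := @leastP (fun n => exists2 p, path_between S g h p & size p = n).
  (* [least] is 0 on an empty predicate, so some path must be exhibited; the radius [wl g + size w]
     makes the ball condition void. *)
  have [w [wS wg _]] := wl_word S_sym S_gen (g^-1 * h).
  have [|p [pp _ _]] := @walk_word (wl g + size w) g w wS.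
    move=> i iw; rewrite (leq_trans (wlM S_sym S_gen _ _)) // leq_add2l.
    rewrite (leq_trans (wl_prod S_sym S_gen _)) ?size_take_min ?geq_minr //.
    by move=> x /mem_take /wS.
  by exists (size p), p => //; move: pp; rewrite wg mulVKg.
apply: leq_trans pk; rewrite /cayley_dist -sp -ph; elim: p g p1 {ph sp} => [|x p IHp] g /=.
  by rewrite mulVg => _; have := @wl_prod S S_sym S_gen [::]; rewrite big_nil; apply.
move=> /andP[gx xp]; have -> : g^-1 * last x p = (g^-1 * x) * (x^-1 * last x p).
  by rewrite mulgA mulgK.
rewrite (leq_trans (wlM S_sym S_gen _ _)) // -add1n leq_add ?IHp //.
exact: wl_letter.
Qed.

Lemma walk_le n M N g h : M <= N -> walk n M g h -> walk n N g h.
Proof. by move=> MN [p [pp ps pb]]; exists p; split; rewrite ?(leq_trans ps). Qed.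

Lemma walk_suffix n w i : {subset w <= S} -> size w <= n ->
  walk n (size w - i) (wprod (take i w)) (wprod w).
Proof.
move=> wS wn; rewrite -{3}(cat_take_drop i w) big_cat -size_drop.
apply: walk_word => [s /mem_drop /wS //|j _].
rewrite -big_cat (leq_trans (wl_prod S_sym S_gen _)) //.
  by move=> s; rewrite mem_cat => /orP[/mem_take /wS|/mem_take /mem_drop /wS].
by rewrite (leq_trans _ wn) // size_cat -{3}(cat_take_drop i w) size_cat leq_add2l size_take_min geq_minr.
Qed.

Lemma wl_prefix w i : {subset w <= S} -> wl (wprod w) = size w -> i <= size w ->
  wl (wprod (take i w)) = i.
Proof.
move=> wS ww iw; apply/eqP; rewrite eqn_leq.
have h1 : wl (wprod (take i w)) <= size (take i w).
  by apply: wl_prod => // s /mem_take /wS.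
have h2 : wl (wprod (drop i w)) <= size (drop i w).
  by apply: wl_prod => // s /mem_drop /wS.
have := wlM S_sym S_gen (wprod (take i w)) (wprod (drop i w)).
rewrite -big_cat cat_take_drop ww; move: h1 h2; rewrite size_takel // size_drop; lia.
Qed.

End Walks.

(** * Word length and block representations *)

Section Realization.
Local Open Scope ring_scope.
Variable R : archiRealFieldType.
Local Notation vec := (R * R)%type.
Local Notation hp := (planar R).
Local Notation zt := (zt R).
Variable S : {fset heisenberg}.
Hypothesis S_sym : symmetric_set S.
Hypothesis S_gen : generating S.
Variable B : R.
Hypothesis B_ge1 : 1 <= B.
Hypothesis hp_le : forall s, s \in S -> nm (hp s) <= B.
Hypothesis zt_le : forall s, s \in S -> `|zt s| <= B.
Variables (V : seq vec) (l : nat) (v : nat -> vec) (sl : nat -> heisenberg).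
Hypothesis hpV : forall s, s \in S -> hp s \in V.
Hypothesis P : polygon V l v.
Hypothesis om_ge1 : forall j k, (j < k < j + l)%N -> 1 <= om (v j) (v k).
Hypothesis slS : forall j, sl j \in S.
Hypothesis hp_sl : forall j, hp (sl j) = v j.

Implicit Types (g h s y : heisenberg) (w u : seq heisenberg) (a : nat -> R) (q : vec).
Local Notation m := (l + l)%N.
Local Notation periodic := (@periodic R l).
Local Notation bv := (block_vec v).
Local Notation sigma := (block_sum l v).
Local Notation ell := (block_length l).
Local Notation area := (block_area l v).
Local Notation cone := (vertex_cone v).
Local Notation spike := (@single_block R l).
Local Notation wl := (word_length S).
Local Notation wprod w := (\prod_(s <- w) s)%g.

Let nm_v j : nm (v j) <= B.
Proof. by rewrite -hp_sl hp_le. Qed.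

Lemma Permutation_perm_eq w w' : Permutation w w' -> perm_eq w w'.
Proof.
elim=> {w w'} [//|s w w' _|s t w|w w' w'' _ h _ h']; first by rewrite perm_cons.
  by rewrite (perm_catCA [:: t] [:: s] w).
exact: (seq.perm_trans h h').
Qed.

(** A discrete intermediate value theorem: exchanging adjacent letters keeps the planar endpoint and
    changes [zt] by at most [2 * B ^+ 2]. Derivations of [Permutation] are chains of such exchanges;
    the prefix [g] lets the induction pass under a common first letter. *)
Lemma interpolate_perm w w' : Permutation w w' -> {subset w <= S} ->
  forall g (x : R), zt (g * wprod w)%g <= x <= zt (g * wprod w')%g \/
    zt (g * wprod w')%g <= x <= zt (g * wprod w)%g ->
  exists u, [/\ {subset u <= S}, size u = size w, hp (wprod u) = hp (wprod w) &
    `|zt (g * wprod u)%g - x| <= 2 * B ^+ 2].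
Proof.
elim=> {w w'} [|s w w' _ IH|s t w|w w' w'' ww' IH w'w'' IH'] wS g x hx.
- exists [::]; split=> //; have -> : x = zt (g * wprod [::])%g by case: hx; lra.
  by rewrite subrr normr0 mulr_ge0 ?sqr_ge0.
- have [||u [uS us uh uz]] := IH _ (g * s)%g x.
  + by move=> r rw; apply: wS; rewrite inE rw orbT.
  + by rewrite -!mulgA; rewrite !big_cons in hx.
  exists (s :: u); split.
  + by move=> r; rewrite inE => /orP[/eqP ->|/uS //]; apply: wS; rewrite mem_head.
  + by rewrite /= us.
  + by rewrite !big_cons !hpM uh.
  + by rewrite big_cons mulgA.
- exists (t :: s :: w); split=> //.
  have tS : t \in S by apply: wS; rewrite mem_head.
  have sS : s \in S by apply: wS; rewrite !inE eqxx orbT.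
  have d : zt (g * wprod (t :: s :: w))%g - zt (g * wprod (s :: t :: w))%g = 2 * om (hp t) (hp s).
    rewrite !big_cons !(ztM, hpM) !(omDr, omDl) (omC (hp s) (hp t)); ring.
  have : `|2 * om (hp t) (hp s)| <= 2 * B ^+ 2.
    rewrite normrM gtr0_norm // ler_wpM2l // (le_trans (ler_om _ _)) // expr2.
    by rewrite ler_pM ?nm_ge0 ?hp_le.
  by rewrite -d => dd; rewrite ler_norml; move: dd; rewrite ler_norml => /andP[? ?]; case: hx => /andP[? ?]; lra.
- have pw := Permutation_perm_eq ww'.
  have w'S : {subset w' <= S} by move=> r; rewrite -(perm_mem pw); apply: wS.
  have mid : (zt (g * wprod w)%g <= x <= zt (g * wprod w')%g \/ zt (g * wprod w')%g <= x <= zt (g * wprod w)%g) \/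
    (zt (g * wprod w')%g <= x <= zt (g * wprod w'')%g \/ zt (g * wprod w'')%g <= x <= zt (g * wprod w')%g).
    have [h|/ltW h] := leP x (zt (g * wprod w')%g); case: hx => /andP[h1 h2].
    + by left; left; rewrite h1 ?h.
    + by right; right; rewrite h1 ?h.
    + by right; left; rewrite h2 ?h.
    + by left; right; rewrite h2 ?h.
  case: mid => h; first exact: IH.
  have [u [uS us uh uz]] := IH' w'S _ _ h; exists u; split=> //.
    by rewrite us (perm_size pw).
  by rewrite uh !hp_prod (perm_big _ pw).
Qed.

Lemma zt_prod_nat (G : nat -> heisenberg) c d : (c <= d)%N ->
  zt (\prod_(c <= j < d) G j)%g = \sum_(c <= j < d) zt (G j) +
    bar (fun j => hp (G j)) (fun j => hp (G j)) c d.
Proof.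
elim: d => [|d IHd]; first by rewrite leqn0 => /eqP ->; rewrite /bar !big_geq // zt1 addr0.
rewrite leq_eqVlt => /orP[/eqP ->|cd]; first by rewrite /bar !big_geq // zt1 addr0.
by rewrite !big_nat_recr ?bar_recr //= ztM IHd // /ps hp_prod; ring.
Qed.

Lemma bar_bv_le a b (M N : R) c d : (c <= d)%N -> \sum_(c <= j < d) `|a j| <= M -> \sum_(c <= j < d) `|b j| <= N ->
  `|bar (bv a) (bv b) c d| <= B ^+ 2 * (M * N).
Proof.
move=> cd aM bN; apply: le_trans (ler_bar _ _ cd) _.
have h (f : nat -> R) K : \sum_(c <= j < d) `|f j| <= K -> 0 <= \sum_(c <= j < d) nm (bv f j) <= B * K.
  move=> fK; apply/andP; split; first by rewrite sumr_ge0 // => j _; apply: nm_ge0.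
  have : B * \sum_(c <= j < d) `|f j| <= B * K by rewrite ler_wpM2l // (le_trans ler01).
  apply: le_trans; rewrite mulr_sumr; apply: ler_sum => j _.
  by rewrite nmZ mulrC ler_wpM2r // nm_v.
have /andP[a0 a1] := h _ _ aM; have /andP[b0 b1] := h _ _ bN.
by apply: le_trans (ler_pM a0 b0 a1 b1) _; rewrite mulrACA -expr2.
Qed.

Lemma exists_ge_mean a c : periodic a -> (forall j, 0 <= a j) ->
  exists2 k, (c <= k < c + m)%N & ell a <= m%:R * a k.
Proof.
move=> ap a0; have [N [N0 aN NE]] := max_norm a c (c + m).
have h : ell a <= m%:R * N.
  rewrite -(ellE c ap) big_nat; apply: (@le_trans _ _ (\sum_(c <= j < c + m) N)).
    by rewrite [leRHS]big_nat; apply: ler_sum => j jc; apply: le_trans (ler_norm _) (aN _ jc).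
  by rewrite sumr_const_nat addKn mulr_natl.
have l0 := l_gt0 P.
case: NE => [N00|[j jc NE]]; last by exists j; rewrite // -(ger0_norm (a0 j)) -NE.
exists c; first by nlia.
by apply: le_trans h _; rewrite N00 mulr0 mulr_ge0.
Qed.

Lemma nm_sigma_le a : (forall j, 0 <= a j) -> nm (sigma a) <= B * ell a.
Proof.
move=> a0; apply: le_trans (ler_nm_sum _ _ _) _; rewrite /block_length mulr_sumr.
by apply: ler_sum => j _; rewrite nmZ ger0_norm // mulrC ler_wpM2r // nm_v.
Qed.

Lemma wprod_nseq n s : wprod (nseq n s) = (s ^+ n)%g.
Proof. by elim: n => [|n IHn]; rewrite ?big_nil // big_cons IHn expgS. Qed.

Lemma hpXn s n : hp (s ^+ n)%g = sc n%:R (hp s).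
Proof.
elim: n => [|n IHn]; first by rewrite expg0 hp1 /sc !mul0r.
by rewrite expgS hpM IHn /sc -addn1 natrD; congr pair => /=; ring.
Qed.

Lemma ztXn s n : zt (s ^+ n)%g = n%:R * zt s.
Proof.
elim: n => [|n IHn]; first by rewrite expg0 zt1 mul0r.
by rewrite expgS ztM IHn hpXn omZr omxx -addn1 natrD; ring.
Qed.

Lemma sum_zt_le w : {subset w <= S} -> `|\sum_(s <- w) zt s| <= B * (size w)%:R.
Proof.
elim: w => [|s w IHw] wS; first by rewrite big_nil normr0 mulr0.
rewrite big_cons; apply: le_trans (ler_normD _ _) _.
have h1 : `|zt s| <= B by apply/zt_le/wS/mem_head.
have h2 := IHw (fun x xw => wS x (mem_behead (s := s :: w) xw)).
by rewrite /= -addn1 natrD mulrDr mulr1; lra.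
Qed.

(* Conjugating one block by a long power of a transverse letter enlarges the
   enclosed area at bounded cost. *)
Lemma block_word (N : nat -> nat) c k r : (forall j, N (j + m)%N = N j) -> (c <= k < c + m)%N ->
  let n := (fun j => (N j)%:R : R) in
  exists w, [/\ {subset w <= S}, (size w)%:R = ell n + 2 * r%:R, hp (wprod w) = sigma n &
    area c n + 2 * r%:R * n k - B * ell n <= zt (wprod w)].
Proof.
move=> Nper /andP[ck km] n; have np : periodic n by move=> j; rewrite /n Nper.
(* The vertex just before [v k]; adding [m] avoids the predecessor of 0. *)
have l0 := l_gt0 P; pose t := sl (k + m).-1.
have w1 : 1 <= om (hp t) (v k).
  by rewrite hp_sl -(v_per P k) om_ge1 //; have := poly_gt1 P; lia.
pose bw j := if j == k then nseq r t ++ nseq (N k) (sl k) ++ nseq r (t^-1)%g else nseq (N j) (sl j).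
pose w := flatten [seq bw j | j <- index_iota c (c + m)].
have tS : t \in S by apply: slS.
have tVS : (t^-1)%g \in S by apply: S_sym.
have bwS j : {subset bw j <= S}.
  move=> x; rewrite /bw; case: ifP => _; rewrite ?mem_cat ?mem_nseq.
    by move=> /or3P[] /andP[_ /eqP ->] //; apply: slS.
  by move=> /andP[_ /eqP ->]; apply: slS.
have wE : wprod w = (\prod_(c <= j < c + m) wprod (bw j))%g by rewrite /w big_flatten big_map.
have hpE j : hp (wprod (bw j)) = bv n j.
  rewrite /bw; case: eqP => [->|_]; rewrite ?big_cat /= !wprod_nseq ?hpM ?hpXn hp_sl //.
  rewrite hp_inv -hp_sl /bv; move: (hp t) => [? ?]; rewrite /block_vec hp_sl.
  by move: (v k) => [? ?]; rewrite /sc /n; congr pair => /=; ring.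
have ztE j : zt (wprod (bw j)) = n j * zt (sl j) + (if j == k then 2 * r%:R * n k * om (hp t) (v k) else 0).
  rewrite /bw; case: eqP => [->|_]; last by rewrite wprod_nseq ztXn addr0.
  rewrite !big_cat /= !wprod_nseq expVgn mulgA zt_conj ztXn !hpXn omZl omZr hp_sl /n; ring.
exists w; split.
- by move=> x /flattenP[u /mapP[j _ ->]]; apply: bwS.
- rewrite size_flatten sumnE !big_map natr_sum.
  have sE j : (size (bw j))%:R = n j + (if j == k then 2 * r%:R else 0) :> R.
    rewrite /bw /n; case: eqP => [->|_]; rewrite ?size_cat !size_nseq ?addr0 //.
    by rewrite !natrD; ring.
  rewrite (eq_bigr _ (fun j _ => sE j)) big_split /= (ellE c np); congr (_ + _).
  rewrite (big_cat_nat ck (ltnW km)) /= [X in _ + X]big_ltn // eqxx !big_nat.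
  rewrite !big1 ?add0r ?addr0 // => j jk; case: eqP => // jE; move: jk; rewrite jE; lia.
- rewrite wE hp_prod (eq_bigr _ (fun j _ => hpE j)); exact: (sigmaE P).
rewrite wE zt_prod_nat ?leq_addr //.
rewrite (eq_bar (fun j _ => hpE j) (fun j _ => hpE j)) (eq_bigr _ (fun j _ => ztE j)) big_split /=.
have -> : \sum_(c <= i < c + m) (if i == k then 2 * r%:R * n k * om (hp t) (v k) else 0) = 2 * r%:R * n k * om (hp t) (v k).
  rewrite (big_cat_nat ck (ltnW km)) /= [X in _ + X]big_ltn // eqxx !big_nat.
  rewrite !big1 ?add0r ?addr0 // => j jk; case: eqP => // jE; move: jk; rewrite jE; lia.
have h1 : - (B * ell n) <= \sum_(c <= i < c + m) n i * zt (sl i).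
  rewrite -(ellE c np) mulr_sumr -sumrN; apply: ler_sum => j _.
  have : `|zt (sl j)| <= B by apply: zt_le.
  rewrite ler_norml => /andP[h _]; rewrite mulrC -mulrN; apply: ler_wpM2l => //.
have h2 : 2 * r%:R * n k <= 2 * r%:R * n k * om (hp t) (v k).
  by rewrite ler_peMr // !mulr_ge0 // /n ler0n.
rewrite /block_area; lra.
Qed.

Lemma area_trunc a c : periodic a -> (forall j, 0 <= a j) ->
  area c a <= area c (fun j => (Num.truncn (a j))%:R) + B ^+ 2 * (2 * m%:R * ell a + m%:R ^+ 2).
Proof.
move=> ap a0; pose n j := (Num.truncn (a j))%:R : R; pose f j := a j - n j.
have np : periodic n by move=> j; rewrite /n ap.
have fi j : 0 <= f j <= 1.
  have /andP[h1 h2] := truncn_itv (a0 j); rewrite /f /n subr_ge0 h1.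
  by move: h2; rewrite -addn1 natrD; lra.
have cm : (c <= c + m)%N by apply: leq_addr.
have nS : \sum_(c <= j < c + m) `|n j| <= ell a.
  rewrite -(ellE c ap); apply: ler_sum => j _; rewrite ger0_norm /n ?ler0n //.
  by have /andP[] := truncn_itv (a0 j).
have fS : \sum_(c <= j < c + m) `|f j| <= m%:R.
  apply: (@le_trans _ _ (\sum_(c <= j < c + m) 1)); last by rewrite sumr_const_nat addKn.
  by apply: ler_sum => j _; have /andP[h1 h2] := fi j; rewrite ger0_norm.
have aE j : bv a j = bv n j + bv f j by rewrite -bvD; congr (sc _ _); rewrite /f; ring.
have e : area c a = area c n + bar (bv n) (bv f) c (c + m) + bar (bv f) (bv n) c (c + m) +
    bar (bv f) (bv f) c (c + m).
  by rewrite /block_area (eq_bar (fun j _ => aE j) (fun j _ => aE j)) barDl !barDr; ring.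
have hB := bar_bv_le cm.
have h1 := le_trans (ler_norm _) (hB _ _ _ _ nS fS).
have h2 := le_trans (ler_norm _) (hB _ _ _ _ fS nS).
have h3 := le_trans (ler_norm _) (hB _ _ _ _ fS fS).
by rewrite -/n e; lra.
Qed.

Lemma nm_sigma_trunc a : periodic a -> (forall j, 0 <= a j) ->
  nm (sigma a - sigma (fun j => (Num.truncn (a j))%:R)) <= m%:R * B.
Proof.
move=> ap a0; rewrite /block_sum /ps -sumrB; apply: le_trans (ler_nm_sum _ _ _) _.
apply: (@le_trans _ _ (\sum_(0 <= j < m) B)); last by rewrite sumr_const_nat subn0 mulr_natl.
apply: ler_sum => j _; have /andP[h1 h2] := truncn_itv (a0 j).
have -> : bv a j - bv (fun j => (Num.truncn (a j))%:R) j = sc (a j - (Num.truncn (a j))%:R) (v j).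
  by rewrite /block_vec /sc; congr pair => /=; ring.
rewrite nmZ ger0_norm ?subr_ge0 // -[leRHS]mul1r; apply: ler_pM; rewrite ?subr_ge0 ?nm_ge0 //.
  by move: h2; rewrite -addn1 natrD; lra.
Qed.

Lemma area_le_sqr a c : periodic a -> (forall j, 0 <= a j) -> area c a <= B ^+ 2 * ell a ^+ 2.
Proof.
move=> ap a0; have h : \sum_(c <= j < c + m) `|a j| <= ell a.
  by rewrite -(ellE c ap); apply: ler_sum => j _; rewrite ger0_norm.
by apply: le_trans (ler_norm _) (bar_bv_le (leq_addr _ _) h h).
Qed.

Lemma ell_ge0 a : (forall j, 0 <= a j) -> 0 <= ell a.
Proof. by move=> a0; rewrite sumr_ge0. Qed.

Lemma Permutation_rev w : Permutation w (rev w).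
Proof.
elim: w => [|s w IHw]; first exact: perm_nil.
rewrite rev_cons; apply: Permutation.perm_trans (perm_skip s IHw) _.
elim: (rev w) => [|t u IHu] /=; first exact: Permutation_refl.
exact: Permutation.perm_trans (perm_swap t s u) (perm_skip t IHu).
Qed.

(* Truncating [a] to integers gives a word [w]; the words interpolating between
   [w] and its reversal have areas covering [- zt w .. zt w] in bounded steps. *)
Lemma wl_realize (C0 C1 : R) : 0 <= C0 -> 0 <= C1 -> exists C2 : nat,
  forall a c g, periodic a -> (forall j, 0 <= a j) -> nm (sigma a - hp g) <= C0 ->
  `|zt g| <= area c a + C1 * (ell a + 1) -> (wl g)%:R <= ell a + C2%:R.
Proof.
move=> C00 C10; have B0 : 0 <= B by apply: le_trans B_ge1.
have l0 := l_gt0 P; have M1 : 1 <= m%:R :> R by rewrite ler1n; lia.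
set M := m%:R in M1.
pose C0' := C0 + M * B; have C0'0 : 0 <= C0' by rewrite addr_ge0 // mulr_ge0 // (le_trans ler01).
pose K1 := B ^+ 2 * (2 * M + M ^+ 2).
have K10 : 0 <= K1 by rewrite mulr_ge0 ?sqr_ge0 // addr_ge0 ?sqr_ge0 // mulr_ge0 // (le_trans ler01).
pose K2 := 3 * B + K1 + C1 + B * C0'.
have K20 : 0 <= K2 by rewrite !addr_ge0 // mulr_ge0.
(* Conjugation in [block_word] gains [2 * r * n k], with [n k] at least [E / M - 1]. This [r] makes
   half of the gain cover the linear errors [K2 * E]; for [E >= L0] the other half pays for the
   [2 * r] extra letters. *)
pose r := Num.bound (M * K2).
have rK : M * K2 < r%:R by apply: archi_boundP; rewrite mulr_ge0 // (le_trans ler01).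
pose L0 := M * (3 + 4 * B).
have [Cb hb] := box_bounded S (C0' + 2 * B ^+ 2).
have [Cs hs] := box_bounded S (C0 + B * L0 + B ^+ 2 * L0 ^+ 2 + C1 * (L0 + 1)).
exists (2 * r + Cb + Cs)%N => a c g ap a0 ag zg.
have E0 := ell_ge0 a0; set E := ell a in E0 zg *.
have sE : nm (sigma a) <= B * E := nm_sigma_le a0.
case: (ltrP E L0) => EL.
  have h1 : nm (hp g) <= C0 + B * L0.
    have -> : hp g = sigma a - (sigma a - hp g) by rewrite opprB addrC subrK.
    apply: le_trans (ler_nmB _ _) _; have := ler_wpM2l B0 (ltW EL); lra.
  have L00 : 0 <= L0 := le_trans E0 (ltW EL).
  have h2 : `|zt g| <= B ^+ 2 * L0 ^+ 2 + C1 * (L0 + 1).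
    apply: le_trans zg _; apply: lerD; last by rewrite ler_wpM2l // lerD2r ltW.
    apply: le_trans (area_le_sqr _ ap a0) _; rewrite ler_wpM2l ?sqr_ge0 //.
    by rewrite ler_sqr ?nnegrE // ltW.
  have w1 : (wl g <= Cs)%N.
    apply: hs; last by apply: le_trans h2 _; rewrite -addrA lerDr addr_ge0 // mulr_ge0.
    apply: le_trans h1 _; rewrite -addrA lerDl addr_ge0 // mulr_ge0 ?sqr_ge0 // addr_ge0 //.
  apply: (@le_trans _ _ Cs%:R); first by rewrite ler_nat.
  by rewrite natrD ler_wpDl // ler_wpDl.
pose N j := Num.truncn (a j); pose n j := (N j)%:R : R.
have Nper j : N (j + m)%N = N j by rewrite /N ap.
have [k kc kE] := exists_ge_mean c ap a0.
have [w [wS ws wh wz]] := block_word r Nper kc; rewrite -/n in ws wh wz.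
have tr j : n j <= a j < n j + 1.
  by have := truncn_itv (a0 j); rewrite /n /N -addn1 natrD.
have nE : ell n <= E by apply: ler_sum => j _; have /andP[] := tr j.
have nE0 : 0 <= ell n by apply: ell_ge0 => j; rewrite /n.
have n0 j : 0 <= n j by rewrite /n.
have sn : nm (sigma n) <= B * E.
  by apply: le_trans (nm_sigma_le n0) _; rewrite ler_wpM2l.
have dn : nm (hp g - sigma n) <= C0'.
  have -> : hp g - sigma n = (sigma a - sigma n) - (sigma a - hp g).
    by rewrite opprB [RHS]addrC addrA subrK.
  apply: le_trans (ler_nmB _ _) _; have := nm_sigma_trunc ap a0; rewrite -/n /C0'; lra.
(* The value of [zt (wprod u)] for which the remainder [y] below would have [zt y = 0]; it is
   reached up to [2 * B ^+ 2]. *)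
pose x := zt g - om (sigma n) (hp g).
have xle : `|x| <= `|zt g| + B * E * C0'.
  have -> : x = zt g - om (sigma n) (hp g - sigma n) by rewrite omBr omxx subr0.
  apply: le_trans (ler_normB _ _) _; rewrite lerD2l.
  by apply: le_trans (ler_om _ _) _; rewrite ler_pM ?nm_ge0.
have an := area_trunc c ap a0; rewrite -/n -/M -/E in an.
have nk : E / M - 1 <= n k.
  have /andP[_ h] := tr k; have : E / M <= a k by rewrite ler_pdivrMr ?(lt_le_trans ltr01) // mulrC.
  lra.
have big : `|x| + 2 * (B * (size w)%:R) <= zt (wprod w).
  have r0 : 0 <= r%:R :> R by [].
  have k1 : K1 * (E + 1) >= B ^+ 2 * (2 * M * E + M ^+ 2).
    have M0 : 0 <= M by apply: le_trans M1.
    have q : 2 * M * E + M ^+ 2 <= (2 * M + M ^+ 2) * (E + 1).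
      by have := mulr_ge0 (sqr_ge0 M) E0; lra.
    by have := ler_wpM2l (sqr_ge0 B) q; rewrite /K1; lra.
  have k2 : 2 * r%:R * (E / M - 1) <= 2 * r%:R * n k by rewrite ler_wpM2l // mulr_ge0.
  have Mp : 0 < M by apply: lt_le_trans M1.
  have k3 : K2 * E <= r%:R * (E / M).
    have h : K2 <= r%:R / M by rewrite ler_pdivlMr // mulrC ltW.
    by have := ler_wpM2r E0 h; lra.
  have k4 : r%:R * (3 + 4 * B) <= r%:R * (E / M).
    by rewrite ler_wpM2l // ler_pdivlMr // mulrC.
  have k5 : K2 <= r%:R.
    by apply: le_trans (ltW rK); rewrite ler_peMl.
  have k6 : B * ell n <= B * E by rewrite ler_wpM2l.
  rewrite ws; rewrite -/E in nE; have bc := mulr_ge0 B0 C0'0; move: k3 k5; rewrite /K2; lra.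
have sw := sum_zt_le wS.
have xr : zt (1 * wprod (rev w))%g <= x <= zt (1 * wprod w)%g.
  rewrite !mul1g zt_prod_rev; have := ler_norm x; have := ler_norm (- x); rewrite normrN.
  have := ler_norm (\sum_(s <- w) zt s) => h1 h2 h3.
  have bs : 0 <= B * (size w)%:R by rewrite mulr_ge0.
  by apply/andP; split; lra.
have [u [uS us uh uz]] := interpolate_perm (Permutation_rev w) wS (or_intror xr).
rewrite mul1g in uz.
pose y := ((wprod u)^-1 * g)%g.
have yh : hp y = hp g - sigma n by rewrite /y hpM hp_inv uh wh addrC.
have yz : zt y = x - zt (wprod u) by rewrite /y ztM ztV hp_inv omNl uh wh /x; ring.
have wy : (wl y <= Cb)%N.
  apply: hb; first by rewrite yh (le_trans dn) // lerDl mulr_ge0 // sqr_ge0.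
  by rewrite yz distrC (le_trans uz) // lerDr.
have -> : g = (wprod u * y)%g by rewrite /y mulVKg.
apply: (@le_trans _ _ (size u + wl y)%:R).
  by rewrite ler_nat (leq_trans (wlM S_sym S_gen _ _)) // leq_add2r (wl_prod S_sym S_gen).
rewrite natrD us ws; have : (wl y)%:R <= Cb%:R :> R by rewrite ler_nat.
have : 0 <= Cs%:R :> R by [].
by rewrite !natrD natrM; lra.
Qed.

Lemma hp_wl g : nm (hp g) <= B * (wl g)%:R.
Proof.
have [w [wS <- <-]] := wl_word S_sym S_gen g; rewrite hp_prod.
elim: w wS => [|s w IHw] wS; first by rewrite big_nil nm0 mulr0.
rewrite big_cons; apply: le_trans (ler_nmD _ _) _.
have h1 : nm (hp s) <= B by apply/hp_le/wS/mem_head.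
have h2 := IHw (fun x xw => wS x (mem_behead (s := s :: w) xw)).
by rewrite /= -addn1 natrD mulrDr mulr1; lra.
Qed.

Lemma zt_wl g : `|zt g| <= B * (wl g)%:R + (B * (wl g)%:R) ^+ 2.
Proof.
have [w [wS <- ws]] := wl_word S_sym S_gen g; rewrite zt_prod -{}ws.
apply: le_trans (ler_normD _ _) _; apply: lerD; first exact: (sum_zt_le wS).
apply: le_trans (nm_larea _) _; 
have s0 : 0 <= \sum_(x <- [seq hp s | s <- w]) nm x by rewrite sumr_ge0 // => x _; apply: nm_ge0.
have b0 : 0 <= B * (size w)%:R by rewrite mulr_ge0 // (le_trans ler01 B_ge1).
rewrite ler_sqr //.
rewrite big_map; elim: w wS {s0 b0} => [|s w IHw] wS; first by rewrite big_nil mulr0.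
rewrite big_cons; have h1 : nm (hp s) <= B by apply/hp_le/wS/mem_head.
have h2 := IHw (fun x xw => wS x (mem_behead (s := s :: w) xw)).
by rewrite /= -addn1 natrD mulrDr mulr1; lra.
Qed.

(** [dominated] bounds areas only from above, so for negative [zt g] the geodesic is first reversed,
    which keeps its planar endpoint. *)
Lemma dominate_elt g : exists a c, [/\ periodic a, forall j, 0 <= a j, sigma a = hp g,
  ell a = (wl g)%:R & cone c (- hp g) /\ `|zt g| <= area c.+1 a + B * (wl g)%:R].
Proof.
have [w [wS wg ws]] := wl_word S_sym S_gen g.
have sz := sum_zt_le wS.
have [u [uS us uh ul]] : exists u, [/\ {subset u <= S}, size u = size w,
    hp (wprod u) = hp g & `|zt g| <= larea [seq hp s | s <- u] + B * (wl g)%:R].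
  have e1 := zt_prod R w; have e2 := zt_prod R (rev w).
  have e3 := zt_prod_rev R w; rewrite wg in e1 e3.
  have e4 : \sum_(s <- rev w) zt s = \sum_(s <- w) zt s by apply: perm_big; rewrite perm_rev.
  rewrite e4 in e2; rewrite ler_norml ws in sz; case/andP: sz => z1 z2.
  case: (ger0P (zt g)) => z0.
    by exists w; split; rewrite ?wg //; lra.
  exists (rev w); split; rewrite ?size_rev //; last by lra.
    by move=> x; rewrite mem_rev; apply: wS.
  by rewrite -wg !hp_prod; apply: perm_big; rewrite perm_rev.
have [|a [c [ap a0 sa la [co ar]]]] := @dominated _ V l v P [seq hp s | s <- u].
  by move=> x /mapP[s /uS sS ->]; apply: hpV.
rewrite big_map -hp_prod uh in sa; rewrite size_map us ws in la; rewrite sa in co.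
exists a, c; split=> //; split=> //; lra.
Qed.

(* The value of [zt] at the lifts of [hp h + q], up to the bounded term coming
   from the short factor. *)
Definition area_target h q : R := zt h + om (hp h) q.
Local Notation tau := area_target.

(** [C2] is chosen before [Bd]: the term [zt y], bounded in terms of [Bd], is absorbed in the slope
    once [wl h] exceeds [n0]. *)
Lemma wl_good_point (C0 C1 : R) : 0 <= C0 -> 0 <= C1 -> exists C2 : nat, forall Bd : nat,
  exists n0 : nat, forall h, (n0 <= wl h)%N -> forall a c q, periodic a -> (forall j, 0 <= a j) ->
    nm (sigma a - (hp h + q)) <= C0 -> `|tau h q| <= area c a + C1 * (wl h)%:R ->
    (wl h)%:R <= 2 * ell a ->
    forall y, hp y = q -> (wl y <= Bd)%N -> (wl (h * y)%g)%:R <= ell a + C2%:R.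
Proof.
move=> C00 C10; have C3 : 0 <= 2 * (C1 + 1) by lra.
have [C2 real] := wl_realize C00 C3.
exists C2 => Bd; exists (Num.bound (B * Bd%:R + (B * Bd%:R) ^+ 2)) => h hn a c q ap a0 sa ta la y yq yB.
apply: (real a c) => //; first by rewrite hpM yq.
rewrite ztM yq; have -> : zt h + zt y + om (hp h) q = tau h q + zt y by rewrite /tau; ring.
have B0 : 0 <= B by apply: le_trans B_ge1.
have yz : `|zt y| <= (wl h)%:R.
  apply: le_trans (zt_wl y) _.
  have b1 : B * (wl y)%:R <= B * Bd%:R by rewrite ler_wpM2l // ler_nat.
  have b2 : (B * (wl y)%:R) ^+ 2 <= (B * Bd%:R) ^+ 2 by rewrite ler_sqr // nnegrE mulr_ge0.
  apply: le_trans (lerD b1 b2) _; apply: ltW.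
  have := archi_boundP (_ : 0 <= B * Bd%:R + (B * Bd%:R) ^+ 2).
  rewrite addr_ge0 ?mulr_ge0 ?sqr_ge0 // => /(_ isT) hb; apply: lt_le_trans hb _.
  by rewrite ler_nat.
apply: le_trans (ler_normD _ _) _; apply: le_trans (lerD ta yz) _.
have : (C1 + 1) * (wl h)%:R <= (C1 + 1) * (2 * ell a) by rewrite ler_wpM2l //; lra.
lra.
Qed.

(** * Planar paths whose short lifts stay in the ball *)

Section Connections.
Variables (h : heisenberg) (Bd : nat).
Local Notation n := (wl h).

(* A planar point [q] stands for all short [y] above it at once, so that a path
   of planar points lifts to a path of group elements from any starting lift. *)
Definition lifts_in q := forall y, hp y = q -> (wl y <= Bd)%N -> (wl (h * y)%g <= n)%N.
Definition lifts_deep q (k : nat) := forall y, hp y = q -> (wl y <= Bd + Bd)%N -> (wl (h * y)%g + k <= n)%N.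

Inductive conn : nat -> vec -> vec -> Prop :=
| conn0 M q of lifts_in q : conn M q q
| connS M q s q' of lifts_in q & s \in S & conn M (q + hp s) q' : conn M.+1 q q'.

Lemma lifts_deep_in q k : lifts_deep q k -> lifts_in q.
Proof. by move=> gq y yq yB; have := gq y yq (leq_trans yB (leq_addr _ _)); nlia. Qed.

Lemma conn_le M N q q' : (M <= N)%N -> conn M q q' -> conn N q q'.
Proof.
move=> MN c; elim: c N MN => {M q q'} [M q gq|M q s q' gq sS _ IH] [|N] // MN; try exact: conn0.
by apply: connS sS _ => //; apply: IH.
Qed.

Lemma conn_trans M N q q' q'' : conn M q q' -> conn N q' q'' -> conn (M + N) q q''.
Proof.
elim=> {M q q'} [M q gq|M q s q' gq sS _ IH] c; first by apply: conn_le c; apply: leq_addl.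
by rewrite addSn; apply: connS sS _ => //; apply: IH.
Qed.

Lemma conn_lifts_in M q q' : conn M q q' -> lifts_in q /\ lifts_in q'.
Proof. by elim=> {M q q'} [M q gq|M q s q' gq sS _ [_ IH]]. Qed.

Lemma conn_sym M q q' : conn M q q' -> conn M q' q.
Proof.
elim=> {M q q'} [M q gq|M q s q' gq sS c IH]; first exact: conn0.
have [gqs _] := conn_lifts_in c; rewrite -addn1; apply: conn_trans IH _.
apply: (@connS _ _ (s^-1)%g) => //; first exact: S_sym.
by rewrite hp_inv addrK; apply: conn0.
Qed.

(** A short lift of an intermediate point becomes a lift of [q] after multiplication by at most
    [k <= Bd] letters, which is why [lifts_deep] admits length [Bd + Bd]; the depth [k] pays for
    undoing this. *)
Lemma conn_step q k y : lifts_deep q k -> (wl y <= k)%N -> (k <= Bd)%N -> conn k q (q + hp y).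
Proof.
move=> gq yk kB; have [w [wS wy ws]] := wl_word S_sym S_gen y.
rewrite -ws -wy {ws wy y} in yk *.
have gw i : (i <= size w)%N -> lifts_in (q + hp (wprod (take i w))).
  move=> iw y yq yB; pose z := (wprod (take i w))^-1%g.
  have wz : (wl z <= i)%N.
    rewrite wlV // (leq_trans (wl_prod S_sym S_gen _)) ?size_take_min ?geq_minl //.
    by move=> x /mem_take /wS.
  have : (wl (h * (y * z))%g + k <= n)%N.
    apply: gq; first by rewrite hpM yq /z hp_inv addrK.
    by rewrite (leq_trans (wlM S_sym S_gen _ _)) // leq_add // (leq_trans wz) // (leq_trans iw) // (leq_trans yk).
  have : (wl (h * y)%g <= wl (h * (y * z)) + wl z^-1)%N%g.
    have e : (h * y = h * (y * z) * z^-1)%g by rewrite mulgA mulgK.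
    by rewrite {1}e wlM.
  by rewrite wlV //; nlia.
apply: (conn_le yk); elim: w q wS gw {yk kB gq k} => [|s w IHw] q wS gw.
  by rewrite big_nil hp1 addr0; apply: conn0; have := gw 0%N; rewrite take0 big_nil hp1 addr0; apply.
apply: (@connS _ _ s).
- by have := gw 0%N; rewrite take0 big_nil hp1 addr0; apply.
- exact/wS/mem_head.
rewrite big_cons hpM addrA; apply: IHw; first by move=> x xw; apply: wS; rewrite inE xw orbT.
by move=> i iw; have := gw i.+1 iw; rewrite /= big_cons hpM addrA.
Qed.

End Connections.

(** * Connecting nearby points inside the ball *)

Let B_ge0 : 0 <= B := le_trans ler01 B_ge1.

Definition mixture (x : R) a b j := (1 - x) * a j + x * b j.
Local Notation mix := mixture.

Lemma bv_mix x a b j : bv (mix x a b) j = sc (1 - x) (bv a j) + sc x (bv b j).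
Proof. by rewrite /block_vec /mix /sc; congr pair => /=; ring. Qed.

Lemma mix_per x a b : periodic a -> periodic b -> periodic (mix x a b).
Proof. by move=> ap bp j; rewrite /mix ap bp. Qed.

Lemma mix_ge0 x a b : 0 <= x <= 1 -> (forall j, 0 <= a j) -> (forall j, 0 <= b j) ->
  forall j, 0 <= mix x a b j.
Proof. by move=> /andP[x0 x1] a0 b0 j; rewrite addr_ge0 // mulr_ge0 // subr_ge0. Qed.

Lemma sigma_mix x a b : sigma (mix x a b) = sc (1 - x) (sigma a) + sc x (sigma b).
Proof. by rewrite /block_sum (eq_ps (fun j _ => bv_mix x a b j)) psD !psZ. Qed.

Lemma ell_mix x a b : ell (mix x a b) = (1 - x) * ell a + x * ell b.
Proof. by rewrite /block_length /mix big_split /= -!mulr_sumr. Qed.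

Lemma sigmaB a b : sigma (fun j => a j - b j) = sigma a - sigma b.
Proof.
rewrite /block_sum /ps -sumrB; apply: eq_bigr => j _.
by rewrite /block_vec /sc; congr pair => /=; ring.
Qed.

(* By [area_le], a mixture of two nearby representations loses only a bounded
   amount of area. *)
Lemma area_mix c x a b : area c (mix x a b) =
  (1 - x) * area c a + x * area c b - x * (1 - x) * area c (fun j => a j - b j).
Proof.
have bB j : bv (fun j => a j - b j) j = bv a j + sc (-1) (bv b j).
  by rewrite /block_vec /sc; congr pair => /=; ring.
rewrite /block_area (eq_bar (fun j _ => bv_mix x a b j) (fun j _ => bv_mix x a b j)).
rewrite (eq_bar (fun j _ => bB j) (fun j _ => bB j)).
by rewrite !barDl !barDr !barZl !barZr; ring.
Qed.

Lemma nm_ps_le a c e : (c <= e)%N -> (e <= c + m)%N -> periodic a -> (forall j, 0 <= a j) ->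
  nm (ps (bv a) c e) <= B * ell a.
Proof.
move=> ce ec ap a0; apply: le_trans (ler_nm_sum _ _ _) _.
rewrite -(ellE c ap) (big_cat_nat ce ec) /= mulrDr ler_wpDr //.
  by rewrite mulr_ge0 ?B_ge0 ?sumr_ge0.
rewrite mulr_sumr; apply: ler_sum => j _; rewrite nmZ ger0_norm // mulrC ler_wpM2r //.
Qed.

Lemma area_perM a c k : periodic a -> area (c + k * m) a = area c a.
Proof.
by move=> ap; elim: k => [|k IHk]; rewrite ?addn0 // mulSn [(m + _)%N]addnC addnA (area_per P).
Qed.

Lemma area_cut a c c' : periodic a -> (forall j, 0 <= a j) ->
  area c a <= area c' a + 2 * (B * ell a * nm (sigma a)).
Proof.
move=> ap a0; have [k [q [q' [/andP[ck kc] e]]]] := modn_rep P c c'.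
rewrite -(area_perM c' q' ap) -e (area_perM k q ap) (area_shift P ap ck (ltnW kc)).
have h := nm_ps_le ck (ltnW kc) ap a0.
have := le_trans (ler_norm _) (ler_om (ps (bv a) c k) (sigma a)).
by have := ler_wpM2r (nm_ge0 (sigma a)) h; lra.
Qed.

Definition rd q := mkh (Num.floor q.1) (Num.floor q.2) 0.

Lemma nm_rd q : nm (hp (rd q) - q) <= 2.
Proof.
rewrite /nm /= hx_mkh hy_mkh.
have /andP[h1 h2] := floor_itv q.1; have /andP[h3 h4] := floor_itv q.2.
rewrite intrD in h2; rewrite intrD in h4; rewrite !ler0_norm ?subr_le0 //; lra.
Qed.

Lemma rd_hp y : hp (rd (hp y)) = hp y.
Proof. by rewrite /planar hx_mkh hy_mkh /= !intrKfloor. Qed.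

(** The steps of a connection need representatives whose length is controlled by the projection
    alone, so the central coordinate is left free. *)
Lemma planar_lift : exists r0 : nat, forall y, exists2 y0, hp y0 = hp y & (wl y0)%:R <= r0%:R * nm (hp y).
Proof.
pose X := mkh 1 0 0; pose Y := mkh 0 1 0; exists (wl X + wl Y)%N => y.
pose sg g (z : int) : heisenberg := ((if 0 <= z then g else g^-1) ^+ absz z)%g.
have wsg g z : (wl (sg g z) <= absz z * wl g)%N.
  by apply: leq_trans (wlXn S_sym S_gen _ _) _; case: ifP; rewrite ?wlV.
have hsg g z : hp (sg g z) = sc z%:~R (hp g).
  rewrite hpXn; case: ifP => z0; rewrite ?hp_inv.
    by rewrite -[in RHS](gez0_abs z0).
  have zE : z = - (absz z)%:Z by move: z0; clear; lia.
  by rewrite [in RHS]zE mulrNz /sc /= -!pmulrn; congr pair => /=; ring.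
exists (sg X (hx y) * sg Y (hy y))%g.
  rewrite hpM !hsg /planar /X /Y !hx_mkh !hy_mkh /sc; congr pair => /=; ring.
apply: (@le_trans _ _ (absz (hx y) * wl X + absz (hy y) * wl Y)%:R).
  by rewrite ler_nat (leq_trans (wlM S_sym S_gen _ _)) // leq_add.
rewrite /nm /= -!intr_norm -!abszE -!pmulrn !natrD !natrM.
have : 0 <= (wl X)%:R * (absz (hy y))%:R :> R by rewrite mulr_ge0.
have : 0 <= (wl Y)%:R * (absz (hx y))%:R :> R by rewrite mulr_ge0.
lra.
Qed.

(** The slope [B + 3] leaves room above the [B + 1] of [tight_rep] for moving the cut past short
    blocks. *)
Definition block_rep h c a y := [/\ periodic a, forall j, 0 <= a j, sigma a = hp h + hp y,
  `|tau h (hp y)| <= area c a + (B + 3) * (wl h)%:R & (wl h)%:R <= 2 * ell a].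

Lemma tau_mix h x q q' : tau h (sc (1 - x) q + sc x q') = (1 - x) * tau h q + x * tau h q'.
Proof. by rewrite /area_target omDr !omZr; ring. Qed.

Lemma ler_norm_mix (x y z : R) : 0 <= x <= 1 ->
  `|(1 - x) * y + x * z| <= (1 - x) * `|y| + x * `|z|.
Proof.
move=> /andP[x0 x1]; apply: le_trans (ler_normD _ _) _.
by rewrite !normrM (ger0_norm x0) ger0_norm // subr_ge0.
Qed.

Lemma conn_chain h Bd M T (qs : nat -> vec) :
  (forall t, (t < T)%N -> conn h Bd M (qs t) (qs t.+1)) -> lifts_in h Bd (qs 0%N) ->
  conn h Bd (T * M) (qs 0%N) (qs T).
Proof.
elim: T => [|T IHT] hc g0; first exact: conn0.
rewrite mulSn addnC; apply: conn_trans (hc T (ltnSn _)).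
by apply: IHT => // t tT; apply/hc/ltnW.
Qed.

(** Mixtures follow the segment from [hp y] to [hp y']. As endpoints and lengths differ by at most
    [K] and the cut [c] is common, [area_le] bounds the area lost. *)
Lemma conn_straight : exists L, forall K : R, exists M, forall Bd, (L <= Bd)%N -> exists n0, forall h,
  (n0 <= wl h)%N -> forall a a' c y y', block_rep h c a y -> block_rep h c a' y' ->
  nm (hp y' - hp y) <= K -> `|ell a - ell a'| <= K ->
  ell a + L%:R <= (wl h)%:R -> ell a' + L%:R <= (wl h)%:R ->
  conn h Bd M (hp y) (hp y').
Proof.
have B0 := B_ge0.
have C00 : 0 <= 2 :> R by [].
(* [2 * B] pays for rounding the planar point, [1] for the area lost by mixing. *)
have C10 : 0 <= (B + 3) + 2 * B + 1 by lra.
have [C2 gp] := wl_good_point C00 C10.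
have [r0 hr0] := planar_lift.
have [KN KN0 neg] := area_le P om_ge1 nm_v.
(* Consecutive rounded points are at distance at most 5: 2 for each rounding, 1 for a step of the
   segment. The depth covers such a move on top of [C2]. *)
pose L := (C2 + r0 * 5)%N; exists L => K; pose T := (Num.bound K).+1.
exists (T * (r0 * 5))%N => Bd LB; have [n0 hn0] := gp (Bd + Bd)%N.
exists (n0 + Num.bound (KN * (2 * K ^+ 2)))%N => h hn a a' c y y'.
move=> [ap a0 sa ta la] [ap' a0' sa' ta' la'] yK eK eL eL'.
have K0 : 0 <= K by apply: le_trans (nm_ge0 _) yK.
have TK : K <= T%:R.
  by apply: ltW; apply: lt_le_trans (archi_boundP K0) _; rewrite ler_nat.
have T0 : 0 < T%:R :> R by rewrite ltr0n.
have nK : KN * (2 * K ^+ 2) <= (wl h)%:R.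
  apply: ltW; apply: lt_le_trans (archi_boundP _) _; first by rewrite !mulr_ge0 ?sqr_ge0.
  by rewrite ler_nat (leq_trans _ hn) // leq_addl.
pose lin x := sc (1 - x) (hp y) + sc x (hp y').
pose x t : R := t%:R / T%:R; pose qs t := hp (rd (lin (x t))).
have x01 t : (t <= T)%N -> 0 <= x t <= 1.
  by move=> tT; rewrite divr_ge0 //= ler_pdivrMr // mul1r ler_nat.
have g t : (t <= T)%N -> lifts_deep h Bd (qs t) (r0 * 5).
  move=> /x01 xt y0 y0q y0B.
  have := hn0 h (leq_trans (leq_addr _ _) hn) (mix (x t) a a') c (qs t) (mix_per _ ap ap') (mix_ge0 xt a0 a0').
  have sE : sigma (mix (x t) a a') = hp h + lin (x t).
    rewrite sigma_mix sa sa' /lin; move: (hp h) (hp y) (hp y') => [? ?] [? ?] [? ?].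
    by rewrite /sc; congr pair => /=; ring.
  have /andP[x0 x1] := xt; have x1' : 0 <= 1 - x t by rewrite subr_ge0.
  have eE := ell_mix (x t) a a'.
  have p1 := ler_wpM2l x1' la; have p2 := ler_wpM2l x0 la'.
  have p3 := ler_wpM2l x1' eL; have p4 := ler_wpM2l x0 eL'.
  have h1 : nm (sigma (mix (x t) a a') - (hp h + qs t)) <= 2.
    have -> : sigma (mix (x t) a a') - (hp h + qs t) = - (qs t - lin (x t)).
      by rewrite sE opprB opprD addrACA subrr add0r.
    by rewrite nmN; apply: nm_rd.
  have h2 : `|tau h (qs t)| <= area c (mix (x t) a a') + (B + 3 + 2 * B + 1) * (wl h)%:R.
    have -> : tau h (qs t) = tau h (lin (x t)) + om (hp h) (qs t - lin (x t)).
      by rewrite /area_target omBr; ring.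
    apply: le_trans (ler_normD _ _) _.
    have e1 : `|om (hp h) (qs t - lin (x t))| <= 2 * B * (wl h)%:R.
      apply: le_trans (ler_om _ _) _.
      have := ler_pM (nm_ge0 _) (nm_ge0 _) (hp_wl h) (nm_rd (lin (x t))).
      by rewrite -/(qs t); lra.
    have e2 : `|tau h (lin (x t))| <= (1 - x t) * `|tau h (hp y)| + x t * `|tau h (hp y')|.
      by rewrite tau_mix; apply: ler_norm_mix.
    have e3 := neg (fun j => a j - a' j) c.
    have {}e3 : area c (fun j => a j - a' j) <= KN * (2 * K ^+ 2).
      apply: le_trans (e3 _) _; first by move=> j; rewrite ap ap'.
      rewrite ler_wpM2l //.
      have s1 : nm (sigma (fun j => a j - a' j)) <= K.
        by rewrite sigmaB sa sa' opprD addrACA subrr add0r -nmN opprB.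
      have s2 : `|ell (fun j => a j - a' j)| <= K by rewrite /block_length sumrB.
      have s3 : nm (sigma (fun j => a j - a' j)) ^+ 2 <= K ^+ 2 by rewrite ler_sqr ?nnegrE ?nm_ge0.
      have s4 : ell (fun j => a j - a' j) ^+ 2 <= K ^+ 2 by rewrite -(real_normK (num_real _)) ler_sqr ?nnegrE.
      lra.
    have e4 : x t * (1 - x t) * area c (fun j => a j - a' j) <= (wl h)%:R.
      have x2 : x t * (1 - x t) <= 1 by rewrite mulr_ile1 // lerBlDr lerDl.
      have x3 : 0 <= x t * (1 - x t) by rewrite mulr_ge0.
      apply: le_trans (ler_wpM2l x3 (le_trans e3 nK)) _.
      by rewrite -[leRHS]mul1r ler_wpM2r.
    have e5 := ler_wpM2l x1' ta; have e6 := ler_wpM2l x0 ta'.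
    rewrite area_mix; lra.
  have h3 : (wl h)%:R <= 2 * ell (mix (x t) a a') by rewrite eE; lra.
  move=> /(_ h1 h2 h3 y0 y0q y0B); rewrite eE => hw.
  by rewrite -(ler_nat R) natrD; rewrite /L natrD in p3 p4; lra.
have q0 : qs 0%N = hp y.
  rewrite /qs /x mul0r /lin subr0; have -> : sc 1 (hp y) + sc 0 (hp y') = hp y.
    by case: (hp y) (hp y') => ? ? [? ?]; rewrite /sc; congr pair => /=; ring.
  exact: rd_hp.
have qT : qs T = hp y'.
  rewrite /qs /x divff ?lt0r_neq0 // /lin subrr; have -> : sc 0 (hp y) + sc 1 (hp y') = hp y'.
    by case: (hp y) (hp y') => ? ? [? ?]; rewrite /sc; congr pair => /=; ring.
  exact: rd_hp.
rewrite -q0 -qT; apply: conn_chain; last by apply: lifts_deep_in (g 0%N _).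
move=> t tT; pose z := ((rd (lin (x t)))^-1 * rd (lin (x t.+1)))%g.
have hz : hp z = qs t.+1 - qs t by rewrite /z hpM hp_inv addrC.
have [z0 z0h z0l] := hr0 z.
have -> : qs t.+1 = qs t + hp z0 by rewrite z0h hz addrC subrK.
apply: (conn_step (g t (ltnW tT))); last by rewrite (leq_trans _ LB) // leq_addl.
rewrite -(ler_nat R) (le_trans z0l) // natrM ler_wpM2l //.
have -> : hp z = (qs t.+1 - lin (x t.+1)) - (qs t - lin (x t)) + sc (T%:R^-1) (hp y' - hp y).
  rewrite hz /lin /x -[in t.+1%:R]addn1 natrD.
  move: (qs _) (qs _) (hp y) (hp y') => [? ?] [? ?] [? ?] [? ?].
  by rewrite /sc; congr pair => /=; ring.
apply: le_trans (ler_nmD _ _) _; rewrite nmZ.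
have k1 := ler_nmB (qs t.+1 - lin (x t.+1)) (qs t - lin (x t)).
have k2 := nm_rd (lin (x t.+1)); have k3 := nm_rd (lin (x t)).
have k4 : `|T%:R^-1| * nm (hp y' - hp y) <= 1.
  rewrite ger0_norm ?invr_ge0 ?(ltW T0) // ler_pdivrMl // mulr1.
  exact: le_trans yK TK.
rewrite -/(qs t) in k3; rewrite -/(qs t.+1) in k2; lra.
Qed.

Lemma conn_letter h Bd q s : lifts_in h Bd q -> lifts_in h Bd (q + hp s) -> s \in S ->
  conn h Bd 1 q (q + hp s).
Proof. by move=> g1 g2 sS; apply: connS sS _ => //; apply: conn0. Qed.

Lemma spike_sub_ge0 a j (x : R) : periodic a -> (forall k, 0 <= a k) -> x <= a j -> 0 <= x ->
  forall k, 0 <= a k + spike j (- x) k.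
Proof.
move=> ap a0 xj x0 k; rewrite /single_block; case: eqP => [e|_]; last by rewrite addr0.
rewrite subr_ge0; suff -> : a k = a j by [].
rewrite (divn_eq k m) (divn_eq j m) e ![(_ * m + _)%N]addnC.
by rewrite !(periodicM _ _ ap).
Qed.

(* Shortening a long block by whole letters keeps a representation valid when
   the block is nearly parallel to the chord. *)
Lemma conn_descend : exists C2 : nat, forall (T : nat) (R1 : R) (Bd : nat), exists n0, forall h,
  (n0 <= wl h)%N -> forall a c y j, block_rep h c a y -> (c <= j < c + m)%N -> T%:R <= a j ->
  `|om (sigma a) (v j)| <= R1 -> `|om (v j) (ps (bv a) j.+1 (c + m))| <= R1 -> nm (hp y) <= R1 ->
  (wl h)%:R + 2 * T%:R <= 2 * ell a -> ell a + C2%:R <= (wl h)%:R ->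
  conn h Bd T (hp y) (hp y - sc T%:R (v j)) /\
  forall k : nat, ell a - T%:R + C2%:R + k%:R <= (wl h)%:R -> lifts_deep h Bd (hp y - sc T%:R (v j)) k.
Proof.
have B0 := B_ge0.
have C10 : 0 <= (B + 3) + 1 by lra.
have [C2 gp] := wl_good_point (lexx 0) C10.
exists C2 => T R1 Bd; have [n0 hn0] := gp (Bd + Bd)%N.
exists (n0 + Num.bound (T%:R * (4 * R1 + R1 * B)))%N => h hn a c y j [ap a0 sa ta la] jc aj s1 s2 yR lT lC.
have R10 : 0 <= R1 by apply: le_trans (nm_ge0 _) yR.
have nT : T%:R * (4 * R1 + R1 * B) <= (wl h)%:R.
  apply: ltW; apply: lt_le_trans (archi_boundP _) _.
    by rewrite mulr_ge0 // addr_ge0 // mulr_ge0.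
  by rewrite ler_nat (leq_trans _ hn) // leq_addl.
have main (i : nat) : (i <= T)%N -> forall y0, hp y0 = hp y - sc i%:R (v j) -> (wl y0 <= Bd + Bd)%N ->
    (wl (h * y0)%g)%:R <= ell a - i%:R + C2%:R.
  move=> iT y0 hy0 wy0.
  have iTR : i%:R <= T%:R :> R by rewrite ler_nat.
  have i0 : 0 <= i%:R :> R by [].
  pose a1 k := a k + spike j (- i%:R) k.
  have ap1 : periodic a1 by apply: periodicD => //; apply: spike_per.
  have a10 : forall k, 0 <= a1 k by apply: spike_sub_ge0 => //; lra.
  have e1 : ell a1 = ell a - i%:R by rewrite /a1 (ell_spike P).
  have sg : sigma a1 = hp h + (hp y - sc i%:R (v j)) by rewrite /a1 (sigma_spike P) // sa sc_opp addrA.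
  have ar : area c a1 = area c a - i%:R * (om (sigma a) (v j) + 2 * om (v j) (ps (bv a) j.+1 (c + m))).
    by rewrite /a1 (area_spike P _ ap jc) mulNr.
  rewrite -e1; apply: (hn0 h (leq_trans (leq_addr _ _) hn) a1 c (hp y - sc i%:R (v j))) => //.
  - by rewrite sg subrr nm0.
  - have -> : tau h (hp y - sc i%:R (v j)) = tau h (hp y) - i%:R * (om (sigma a) (v j) - om (hp y) (v j)).
      by rewrite /area_target sa omBr omZr omDl; ring.
    apply: le_trans (ler_normB _ _) _.
    have p1 : `|om (hp y) (v j)| <= R1 * B.
      by apply: le_trans (ler_om _ _) _; rewrite ler_pM ?nm_ge0.
    have p2 : `|i%:R * (om (sigma a) (v j) - om (hp y) (v j))| <= T%:R * (R1 + R1 * B).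
      rewrite normrM (ger0_norm i0) ler_pM //; apply: le_trans (ler_normB _ _) _; lra.
    have p3 : i%:R * (om (sigma a) (v j) + 2 * om (v j) (ps (bv a) j.+1 (c + m))) <= T%:R * (3 * R1).
      apply: le_trans (ler_norm _) _; rewrite normrM (ger0_norm i0) ler_pM //.
      by apply: le_trans (ler_normD _ _) _; rewrite normrM (ger0_norm (ler0n R 2)); lra.
    rewrite ar; lra.
  - by rewrite e1; lra.
pose qs (i : nat) := hp y - sc i%:R (v j).
have gq (i k : nat) : (i <= T)%N -> ell a - i%:R + C2%:R + k%:R <= (wl h)%:R -> lifts_deep h Bd (qs i) k.
  move=> iT hk y0 y0q y0B; have := main i iT y0 y0q y0B.
  by rewrite -(ler_nat R) natrD; lra.
split; last by move=> k hk; apply: (gq T k).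
have gi (i : nat) : (i <= T)%N -> lifts_in h Bd (qs i).
  by move=> iT; apply: (@lifts_deep_in _ _ _ 0); apply: gq => //; have : 0 <= i%:R :> R by []; lra.
have q0 : qs 0%N = hp y by rewrite /qs /sc !mul0r subr0.
rewrite -{1}q0 -[T in conn _ _ T]muln1 -/(qs T).
apply: conn_chain; last exact: gi.
move=> i iT; have e : qs i.+1 = qs i + hp (sl j)^-1%g.
  rewrite /qs hp_inv hp_sl -addn1 natrD; move: (hp y) (v j) => [? ?] [? ?].
  by rewrite /sc; congr pair => /=; ring.
rewrite e; apply: conn_letter; [exact/gi/ltnW|by rewrite -e; apply: gi|exact: S_sym].
Qed.

(* When the chord is short, letters can be traded between two consecutive long
   blocks, the blocks in between being short. *)
Lemma conn_link (R2 : R) : exists T0 : nat, forall T, (T0 <= T)%N -> exists M, forall Bd, (2 <= Bd)%N ->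
  exists n0, forall h, (n0 <= wl h)%N -> forall b y j j', periodic b -> (forall k, 0 <= b k) ->
  nm (sigma b - (hp h + hp y)) <= R2 -> nm (hp h) <= R2 -> nm (hp y) <= R2 ->
  (forall c, `|zt h| <= area c b + R2 * (wl h)%:R) ->
  (wl h)%:R + 2 * T%:R <= 2 * ell b -> ell b <= (wl h)%:R ->
  (j < j')%N -> (j' < j + l)%N -> T%:R <= b j -> T%:R <= b j' ->
  conn h Bd M (hp y - sc T%:R (v j)) (hp y - sc T%:R (v j')).
Proof.
case: (lerP 0 R2) => [R20|R2n]; last first.
  exists 0%N => T _; exists 0%N => Bd _; exists 0%N => h _ b y j j' _ _ _ hR.
  by have := nm_ge0 (hp h); lra.
have B0 := B_ge0.
have C10 : 0 <= R2 + 2 by lra.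
have [C2 gp] := wl_good_point R20 C10.
(* Removing [T] letters gives depth [T - C2], and one exchange takes two letters. *)
exists (C2 + 2)%N => T TC; exists (l * (T * 2))%N => Bd Bd2.
have [n0 hn0] := gp (Bd + Bd)%N.
pose X1 := T%:R * (B * (3 * R2)) + T%:R * ((3 * R2 + T%:R * B) * B + 2 * (B * (m%:R * (T%:R * B)))).
pose X2 := R2 * (R2 + 2 * (T%:R * B)).
have X10 : 0 <= X1 by rewrite /X1 !(addr_ge0, mulr_ge0).
have X20 : 0 <= X2 by rewrite /X2 !(addr_ge0, mulr_ge0).
exists (n0 + (Num.bound X1 + Num.bound X2))%N => h hn b y j j' bp b0 sb hR yR ar lT lb.
have nX1 : X1 <= (wl h)%:R.
  apply: ltW; apply: lt_le_trans (archi_boundP X10) _; rewrite ler_nat; nlia.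
have nX2 : X2 <= (wl h)%:R.
  apply: ltW; apply: lt_le_trans (archi_boundP X20) _; rewrite ler_nat; nlia.
have sR : nm (sigma b) <= 3 * R2.
  have -> : sigma b = (sigma b - (hp h + hp y)) + (hp h + hp y) by rewrite subrK.
  by have := ler_nmD (sigma b - (hp h + hp y)) (hp h + hp y); have := ler_nmD (hp h) (hp y); lra.
(* Cutting at [i'] puts the block [i'] first and leaves only short blocks after the block [i + m],
   so removing letters from either one changes the area by a bounded amount. *)
have pair i i' : (i < i')%N -> (i' < i + l)%N -> T%:R <= b i -> T%:R <= b i' ->
    (forall k, (i < k < i')%N -> b k <= T%:R) ->
    conn h Bd (T * 2) (hp y - sc T%:R (v i)) (hp y - sc T%:R (v i')).
  move=> ii' i'l bi bi' small.
  pose qs (x : nat) := hp y - sc (T - x)%:R (v i) - sc x%:R (v i').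
  have gq (x : nat) : (x <= T)%N -> lifts_deep h Bd (qs x) 2.
    move=> xT y0 y0q y0B.
    have xR : x%:R <= T%:R :> R by rewrite ler_nat.
    have x'R : (T - x)%:R <= T%:R :> R by rewrite ler_nat leq_subr.
    have x0 : 0 <= x%:R :> R by [].
    have x'0 : 0 <= (T - x)%:R :> R by [].
    pose b1 k := b k + spike i' (- x%:R) k.
    pose b2 k := b1 k + spike i (- (T - x)%:R) k.
    have b1p : periodic b1 by apply: periodicD => //; apply: spike_per.
    have b2p : periodic b2 by apply: periodicD => //; apply: spike_per.
    have b10 : forall k, 0 <= b1 k by apply: spike_sub_ge0 => //; apply: le_trans bi'.
    have b1E k : (i <= k < i')%N -> b1 k = b k.
      move=> ki; rewrite /b1 (@spike_out R l i' _ k i) ?addr0 //; nlia.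
    have b20 : forall k, 0 <= b2 k.
      by apply: spike_sub_ge0 => //; rewrite b1E ?leqnn ?ii' // (le_trans x'R).
    have e2 : ell b2 = ell b - T%:R.
      by rewrite /b2 (ell_spike P) // /b1 (ell_spike P) // natrB //; ring.
    have s1 : sigma b1 = sigma b - sc x%:R (v i') by rewrite /b1 (sigma_spike P) // sc_opp.
    have s2 : sigma b2 = sigma b1 - sc (T - x)%:R (v i) by rewrite /b2 (sigma_spike P) // sc_opp.
    have k1 : (i' <= i' < i' + m)%N by have := l_gt0 P; nlia.
    have k2 : (i' <= i + m < i' + m)%N by nlia.
    have a1 : area i' b1 = area i' b - x%:R * om (v i') (sigma b).
      rewrite /b1 (area_spike P _ bp k1) -{2}(sigmaE P i' bp) [in RHS](ps_recl (bv b)); last by nlia.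
      rewrite -(sigmaE P i' bp) (ps_recl (bv b)); last by nlia.
      by rewrite !omDr omDl !omZr omZl !omxx (omC (ps _ _ _)); ring.
    have a2 : area i' b2 = area i' b1 - (T - x)%:R * (om (sigma b1) (v i) + 2 * om (v i) (ps (bv b) i.+1 i')).
      have -> : b2 = (fun k => b1 k + spike (i + m) (- (T - x)%:R) k).
        by apply/funext => k; rewrite /b2 /single_block modnDr.
      rewrite (area_spike P _ b1p k2) (v_per P) -addSn (ps_per P _ _ b1p) mulNr.
      congr (_ - _ * (_ + 2 * om _ _)); apply: eq_ps => k ki; rewrite /block_vec b1E //; nlia.
    have t1 : nm (ps (bv b) i.+1 i') <= m%:R * (T%:R * B).
      apply: le_trans (ler_nm_sum _ _ _) _.
      apply: (@le_trans _ _ (\sum_(i.+1 <= k < i') T%:R * B)).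
        rewrite big_nat [leRHS]big_nat; apply: ler_sum => k ki; rewrite nmZ ger0_norm //.
        by rewrite ler_pM ?nm_ge0 // small.
      rewrite sumr_const_nat -[_ *+ _]mulr_natl ler_wpM2r ?mulr_ge0 // ler_nat; nlia.
    have t2 : nm (sigma b1) <= 3 * R2 + T%:R * B.
      rewrite s1; apply: le_trans (ler_nmB _ _) _; apply: lerD => //.
      by rewrite nmZ ger0_norm // ler_pM ?nm_ge0.
    have t3 : `|om (v i') (sigma b)| <= B * (3 * R2).
      by apply: le_trans (ler_om _ _) _; rewrite ler_pM ?nm_ge0.
    have t4 : `|om (sigma b1) (v i)| <= (3 * R2 + T%:R * B) * B.
      by apply: le_trans (ler_om _ _) _; rewrite ler_pM ?nm_ge0.
    have t5 : `|om (v i) (ps (bv b) i.+1 i')| <= B * (m%:R * (T%:R * B)).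
      by apply: le_trans (ler_om _ _) _; rewrite ler_pM ?nm_ge0.
    have t6 : area i' b - X1 <= area i' b2.
      have u1 : x%:R * om (v i') (sigma b) <= T%:R * (B * (3 * R2)).
        by apply: le_trans (ler_norm _) _; rewrite normrM ger0_norm // ler_pM.
      have u2 : (T - x)%:R * (om (sigma b1) (v i) + 2 * om (v i) (ps (bv b) i.+1 i')) <=
          T%:R * ((3 * R2 + T%:R * B) * B + 2 * (B * (m%:R * (T%:R * B)))).
        apply: le_trans (ler_norm _) _; rewrite normrM ger0_norm // ler_pM //.
        by apply: le_trans (ler_normD _ _) _; rewrite normrM (ger0_norm (ler0n R 2)) lerD // ler_wpM2l.
      by rewrite a2 a1 /X1; lra.
    have t7 : `|tau h (qs x)| <= `|zt h| + X2.
      apply: le_trans (ler_normD _ _) _; rewrite lerD2l; apply: le_trans (ler_om _ _) _.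
      rewrite /X2 ler_pM ?nm_ge0 // /qs; apply: le_trans (ler_nmB _ _) _.
      have u1 := ler_nmB (hp y) (sc (T - x)%:R (v i)).
      have u2 : nm (sc (T - x)%:R (v i)) <= T%:R * B by rewrite nmZ ger0_norm // ler_pM ?nm_ge0.
      have u3 : nm (sc x%:R (v i')) <= T%:R * B by rewrite nmZ ger0_norm // ler_pM ?nm_ge0.
      lra.
    have := hn0 h (leq_trans (leq_addr _ _) hn) b2 i' (qs x) b2p b20.
    have -> : sigma b2 - (hp h + qs x) = sigma b - (hp h + hp y).
      rewrite s2 s1 /qs; move: (sigma b) (hp h) (hp y) (sc _ _) (sc _ _) => [? ?] [? ?] [? ?] [? ?] [? ?].
      by congr pair => /=; ring.
    have u4 : `|tau h (qs x)| <= area i' b2 + (R2 + 2) * (wl h)%:R by have := ar i'; lra.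
    have u5 : (wl h)%:R <= 2 * ell b2 by rewrite e2; lra.
    move=> /(_ sb u4 u5 y0 y0q y0B); rewrite e2 => hw.
    have : (C2 + 2)%:R <= T%:R :> R by rewrite ler_nat.
    by rewrite -(ler_nat R) !natrD; lra.
  have q0 : qs 0%N = hp y - sc T%:R (v i).
    by rewrite /qs subn0 /sc !mul0r subr0.
  have qT : qs T = hp y - sc T%:R (v i').
    rewrite /qs subnn; move: (hp y) (v i) (v i') => [? ?] [? ?] [? ?].
    by rewrite /sc; congr pair => /=; ring.
  rewrite -q0 -qT; apply: conn_chain; last exact: lifts_deep_in (gq 0%N _).
  move=> x xT; have -> : qs x.+1 = qs x + hp (sl i * (sl i')^-1)%g.
    rewrite hpM hp_inv !hp_sl /qs !natrB // ?(ltnW xT) // -[in x.+1%:R]addn1 natrD.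
    move: (hp y) (v i) (v i') => [? ?] [? ?] [? ?].
    by rewrite /sc; congr pair => /=; ring.
  apply: (conn_step (gq x (ltnW xT))) => //.
  rewrite (leq_trans (wlM S_sym S_gen _ _)) // wlV // (leq_add (wl_letter S_sym S_gen _) (wl_letter S_sym S_gen _)) //.
move=> jj' j'l bj bj'.
(* The long blocks from [j] to [j'] are visited one after the other. *)
have chain d i : (j <= i)%N -> (i < j')%N -> (j' - i <= d)%N -> T%:R <= b i ->
    conn h Bd (d * (T * 2)) (hp y - sc T%:R (v i)) (hp y - sc T%:R (v j')).
  elim: d i => [|d IHd] i ji ij' d1 bi; first by nlia.
  have ex : exists k, [&& (i < k)%N, (k <= j')%N & T%:R <= b k] by exists j'; rewrite ij' leqnn.
  have [k /and3P[ik kj' bk] kmin] := ex_minnP ex.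
  have ck : conn h Bd (T * 2) (hp y - sc T%:R (v i)) (hp y - sc T%:R (v k)).
    apply: pair => //; first by nlia.
    move=> k' /andP[ik' kk']; rewrite leNgt; apply/negP => bk'.
    by have := kmin k'; rewrite ik' (ltW bk') (leq_trans (ltnW kk') kj') leqNgt kk' => /(_ isT).
  rewrite mulSn; move: kj'; rewrite leq_eqVlt => /orP[/eqP kj'|kj'].
    by rewrite -kj'; apply: conn_le ck; apply: leq_addr.
  by apply: conn_trans ck _; apply: IHd => //; nlia.
by apply: chain => //; nlia.
Qed.

(** Each block passed by the cut contributes its multiplicity times its [om] with the chord, and
    both are bounded. *)
Lemma shift_small a c e (M1 M2 : R) : periodic a -> (forall j, 0 <= a j) ->
  (c <= e)%N -> (e <= c + m)%N -> 0 <= M1 -> 0 <= M2 ->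
  (forall j, (c <= j < e)%N -> a j <= M1 /\ `|om (sigma a) (v j)| <= M2) ->
  `|area e a - area c a| <= 2 * (m%:R * (M1 * M2)).
Proof.
move=> ap a0 ce ec M10 M20 sm; rewrite (area_shift P ap ce ec) addrAC subrr add0r normrN normrM (ger0_norm (ler0n R 2)).
rewrite ler_wpM2l // om_suml; apply: le_trans (ler_norm_sum _ _ _) _.
apply: (@le_trans _ _ (\sum_(c <= j < e) M1 * M2)).
  rewrite big_nat [leRHS]big_nat; apply: ler_sum => j /sm[h1 h2].
  by rewrite omZl normrM ger0_norm // omC normrN ler_pM.
rewrite sumr_const_nat -[_ *+ _]mulr_natl ler_wpM2r ?mulr_ge0 // ler_nat; nlia.
Qed.

(* [lra] on the goal alone, for proofs with a large context. *)
Ltac clra := clear -R S S_sym S_gen B B_ge1 hp_le zt_le V l v sl hpV P om_ge1 slS hp_sl; lra.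

(* Cuts between [c] and [c'] can only differ when the chord is almost parallel
   to every hull vertex in between. *)
Lemma cone_gap c c' j x x' (d : R) : cone c x -> cone c' x' -> (c < j <= c')%N -> (c' <= c + l)%N ->
  nm (x' - x) <= d -> `|om x (v j)| <= d * B /\ `|om x' (v j)| <= d * B.
Proof.
move=> cx cx' /andP[cj jc'] c'l xd.
have h1 : 0 <= om x (v j) by apply: (cone_r P cx) => //; nlia.
have h2 : 0 <= om (v j) x' by apply: (cone_l P cx') => //; nlia.
have h3 : om (x - x') (v j) <= d * B.
  apply: le_trans (ler_norm _) _; apply: le_trans (ler_om _ _) _.
  by rewrite ler_pM ?nm_ge0 // -nmN opprB.
rewrite omC in h2; rewrite omBl in h3; rewrite ger0_norm // ler0_norm; last by lra.
by split; lra.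
Qed.

(** Cramer's rule: a vector almost parallel to two independent hull vertices is short. *)
Lemma nm_cross x j k (d : R) : (j < k < j + l)%N -> `|om x (v j)| <= d -> `|om x (v k)| <= d ->
  nm x <= 2 * (d * B).
Proof.
move=> jk hj hk; have w1 := om_ge1 jk.
have e : sc (om (v j) (v k)) x = sc (om x (v k)) (v j) - sc (om x (v j)) (v k).
  move: x (v j) (v k) {hj hk w1} => [? ?] [? ?] [? ?].
  by rewrite /sc /om; congr pair => /=; ring.
apply: (@le_trans _ _ (nm (sc (om (v j) (v k)) x))).
  by rewrite nmZ ler_peMl ?nm_ge0 // (le_trans w1) // ler_norm.
rewrite e; apply: le_trans (ler_nmB _ _) _; rewrite !nmZ.
have p1 : `|om x (v k)| * nm (v j) <= d * B by rewrite ler_pM ?nm_ge0.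
have p2 : `|om x (v j)| * nm (v k) <= d * B by rewrite ler_pM ?nm_ge0.
lra.
Qed.

(** What [dominate_elt] gives for [h * y], relative to [h]. Unlike [block_rep] it keeps the cone,
    used to compare cuts, and the exact length. *)
Definition tight_rep h c a y := [/\ periodic a, forall j, 0 <= a j, sigma a = hp h + hp y, ell a = (wl (h * y)%g)%:R &
  cone c (- sigma a) /\ `|tau h (hp y)| <= area c.+1 a + (B + 1) * (wl h)%:R].

(* If no long block of one of the two representations lies between the cuts, the
   cuts can be made equal and the segment of mixtures works. Otherwise descend
   along such a block on each side; if the two blocks differ, the chord is short
   and the endpoints are linked through the average representation. *)
Lemma conn_ordered_cuts : exists L, forall K : nat, exists M, forall Bd, (M <= Bd)%N -> exists n0, forall h,
  (n0 <= wl h)%N -> forall y y' a a' c c', (wl y <= K)%N -> (wl y' <= K)%N ->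
  tight_rep h c a y -> tight_rep h c' a' y' -> (c <= c')%N -> (c' <= c + l)%N ->
  (wl (h * y)%g + L <= wl h)%N -> (wl (h * y')%g + L <= wl h)%N ->
  conn h Bd M (hp y) (hp y').
Proof.
have half : 0 <= (1/2 : R) <= 1 by apply/andP; split; lra.
have B0 := B_ge0.
have [Ls st] := conn_straight.
have [C2 de] := conn_descend.
have [KN KN0 neg] := area_le P om_ge1 nm_v.
exists (Ls + C2)%N => K.
pose d : R := 2 * (B * K%:R); have d0 : 0 <= d by rewrite !mulr_ge0.
pose R1 := d * B + B * K%:R; have R10 : 0 <= R1 by rewrite addr_ge0 ?mulr_ge0.
pose Rp := 2 * (d * B * B); have Rp0 : 0 <= Rp by rewrite !mulr_ge0.
pose R2 := Rp + B * K%:R + d + (B + 3) + 2 * (B * (Rp + d)).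
have [T0 lk] := conn_link R2.
(* [T0] is for [conn_link]; after a descent by [T], a depth [K + K] covers the displacement
   [hp y - hp y'], spelled by at most [K + K] letters. *)
pose T := (T0 + K + K)%N; have TT0 : (T0 <= T)%N by rewrite /T; nlia.
have [Ml lk'] := lk T TT0.
have [Ms st'] := st d.
pose M := (Ls + 2 + Ms + (T + (Ml + (K + K + T))))%N.
exists M => Bd MB.
have BdL : (Ls <= Bd)%N by rewrite (leq_trans _ MB) // /M; nlia.
have Bd2 : (2 <= Bd)%N by rewrite (leq_trans _ MB) // /M; nlia.
have BdK : (K + K <= Bd)%N by rewrite (leq_trans _ MB) // /M; nlia.
have [n1 hn1] := st' Bd BdL.
have [n2 hn2] := de T R1 Bd.
have [n3 hn3] := lk' Bd Bd2.
pose X1 := 2 * (m%:R * (2 * T%:R * (d * B))).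
have X10 : 0 <= X1 by rewrite /X1 !mulr_ge0.
pose X2 := (Rp + B * K%:R) * (B * K%:R).
have X20 : 0 <= X2 by rewrite /X2 !(addr_ge0, mulr_ge0).
pose X3 := KN * (2 * d ^+ 2).
have X30 : 0 <= X3 by rewrite /X3 !(addr_ge0, mulr_ge0, sqr_ge0).
exists (n1 + n2 + n3 + (Num.bound X1 + Num.bound X2 + Num.bound X3) + 2 * (K + 2 * T))%N => h hn.
have nX (X : R) : 0 <= X -> (Num.bound X <= wl h)%N -> X <= (wl h)%:R.
  by move=> X0 hb; apply: ltW; apply: lt_le_trans (archi_boundP X0) _; rewrite ler_nat.
have nX1 : X1 <= (wl h)%:R by apply: nX => //; nlia.
have nX2 : X2 <= (wl h)%:R by apply: nX => //; nlia.
have nX3 : X3 <= (wl h)%:R by apply: nX => //; nlia.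
have m1 : (n1 <= wl h)%N by nlia.
have m2 : (n2 <= wl h)%N by nlia.
have m3 : (n3 <= wl h)%N by nlia.
have {nX}hn1 := hn1 h m1; have {}hn2 := hn2 h m2; have {}hn3 := hn3 h m3.
move=> y y' a a' c c' yK yK' [ap a0 sa la [co ta]] [ap' a0' sa' la' [co' ta']] cc' c'l yL yL'.
have nyK : nm (hp y) <= B * K%:R.
  by apply: le_trans (hp_wl y) _; rewrite ler_wpM2l // ler_nat.
have nyK' : nm (hp y') <= B * K%:R.
  by apply: le_trans (hp_wl y') _; rewrite ler_wpM2l // ler_nat.
have yd : nm (hp y' - hp y) <= d by apply: le_trans (ler_nmB _ _) _; rewrite /d; move: nyK nyK'; clra.
have wlow x : (wl x <= K)%N -> (wl h <= wl (h * x)%g + K)%N.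
  move=> xK; have : (wl (h * x * x^-1)%g <= wl (h * x)%g + wl x^-1%g)%N by apply: wlM.
  by rewrite mulgK wlV //; nlia.
have lo : (wl h)%:R + 2 * T%:R <= 2 * ell a.
  rewrite la -natrM -natrD -natrM ler_nat; have := wlow y yK; nlia.
have lo' : (wl h)%:R + 2 * T%:R <= 2 * ell a'.
  rewrite la' -natrM -natrD -natrM ler_nat; have := wlow y' yK'; nlia.
have hi : ell a + Ls%:R + C2%:R <= (wl h)%:R by rewrite la -!natrD ler_nat; nlia.
have hi' : ell a' + Ls%:R + C2%:R <= (wl h)%:R by rewrite la' -!natrD ler_nat; nlia.
have Ls0 : 0 <= Ls%:R :> R by [].
have C20 : 0 <= C2%:R :> R by [].
have T00 : 0 <= T%:R :> R by [].
have laL : (wl h)%:R <= 2 * ell a by move: lo T00; clra.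
have laL' : (wl h)%:R <= 2 * ell a' by move: lo' T00; clra.
have hiL : ell a + Ls%:R <= (wl h)%:R by move: hi C20; clra.
have hiL' : ell a' + Ls%:R <= (wl h)%:R by move: hi' C20; clra.
have hiC : ell a + C2%:R <= (wl h)%:R by move: hi Ls0; clra.
have hiC' : ell a' + C2%:R <= (wl h)%:R by move: hi' Ls0; clra.
have W0 : 0 <= (wl h)%:R :> R by [].
have ed : `|ell a - ell a'| <= d.
  have l1 : ell a <= (wl h)%:R by move: hiL Ls0; clra.
  have l2 : ell a' <= (wl h)%:R by move: hiL' Ls0; clra.
  have l3 : (wl h)%:R <= ell a + K%:R by rewrite la -natrD ler_nat wlow.
  have l4 : (wl h)%:R <= ell a' + K%:R by rewrite la' -natrD ler_nat wlow.
  have l5 : K%:R <= B * K%:R by rewrite ler_peMl.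
  by rewrite ler_norml /d; apply/andP; split; move: l1 l2 l3 l4 l5; clra.
have gap j : (c < j <= c')%N -> `|om (sigma a) (v j)| <= d * B /\ `|om (sigma a') (v j)| <= d * B.
  move=> jc; have xd : nm (- sigma a' - - sigma a) <= d.
    have -> : - sigma a' - - sigma a = - (hp y' - hp y).
      rewrite sa sa'; move: (hp h) (hp y) (hp y') => [? ?] [? ?] [? ?].
      by congr pair => /=; ring.
    by rewrite nmN.
  by have := cone_gap co co' jc c'l xd; rewrite !omNl !normrN.
have ta3 : `|tau h (hp y)| <= area c.+1 a + (B + 3) * (wl h)%:R by move: ta W0; clra.
have ta3' : `|tau h (hp y')| <= area c'.+1 a' + (B + 3) * (wl h)%:R by move: ta' W0; clra.
have dB0 : 0 <= d * B by rewrite mulr_ge0.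
have T20 : 0 <= 2 * T%:R :> R by rewrite mulr_ge0.
have sh1 e : (c < e)%N -> (e <= c'.+1)%N -> (forall j, (c < j < e)%N -> a j <= 2 * T%:R) ->
    `|tau h (hp y)| <= area e a + (B + 3) * (wl h)%:R.
  move=> ce ec sm; have ec' : (e <= c.+1 + m)%N by have := l_gt0 P; nlia.
  have : `|area e a - area c.+1 a| <= X1.
    apply: shift_small => // j jce.
    by split; [apply: sm|apply: (gap j _).1]; nlia.
  by rewrite ler_norml => /andP[]; move: ta nX1 W0; clra.
have sh2 e : (c < e)%N -> (e <= c'.+1)%N -> (forall j, (e <= j <= c')%N -> a' j <= 2 * T%:R) ->
    `|tau h (hp y')| <= area e a' + (B + 3) * (wl h)%:R.
  move=> ce ec sm; have ec' : (c'.+1 <= e + m)%N by have := l_gt0 P; nlia.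
  have : `|area c'.+1 a' - area e a'| <= X1.
    apply: shift_small => // j jce.
    by split; [apply: sm|apply: (gap j _).2]; nlia.
  by rewrite ler_norml => /andP[]; move: ta' nX1 W0; clra.
have str e : block_rep h e a y -> block_rep h e a' y' -> conn h Bd M (hp y) (hp y').
  move=> r1 r2; apply: (@conn_le _ _ Ms); first by rewrite /M; nlia.
  exact: (hn1 a a' e).
(* Long means at least [2 * T], so that the average of the two representations still has at least
   [T]. *)
case: (pselect (exists j, [&& (c < j)%N, (j <= c')%N & 2 * T%:R <= a j])) => [ex1|nex]; last first.
  apply: (str c'.+1); split=> //.
    apply: sh1 => // j /andP[cj jc]; rewrite leNgt; apply/negP => h1; apply: nex.
    by exists j; rewrite cj (ltW h1) andbT.
case: (pselect (exists j, [&& (c < j)%N, (j <= c')%N & 2 * T%:R <= a' j])) => [ex2|nex2]; last first.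
  apply: (str c.+1); split=> //.
    apply: sh2 => // j /andP[cj jc]; rewrite leNgt; apply/negP => h1; apply: nex2.
    by exists j; rewrite cj (ltW h1) andbT.
(* [j1] is the first long block of [a] between the cuts, [j2] the last one of [a']. Cutting [a] at
   [j1] and [a'] at [j2.+1] crosses only short blocks and places the block to be shortened first,
   respectively last. *)
have [j1 /and3P[cj1 j1c big1] min1] := ex_minnP ex1.
have [|j2 /and3P[cj2 j2c big2] max2] := @ex_maxnP _ c' ex2; first by move=> j /and3P[].
have r1 : block_rep h j1 a y.
  split=> //.
  apply: sh1 => //; first by rewrite ltnW.
  move=> j /andP[cj jj1]; rewrite leNgt; apply/negP => h1.
  by have := min1 j; rewrite cj (ltW h1) (leq_trans (ltnW jj1) j1c) leqNgt jj1 => /(_ isT).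
have r2 : block_rep h j2.+1 a' y'.
  split=> //.
  apply: sh2 => //; first by rewrite ltnW // ltnS ltnW.
  move=> j /andP[j2j jc']; rewrite leNgt; apply/negP => h1.
  by have := max2 j; rewrite jc' (ltW h1) (leq_trans cj2 (ltnW j2j)) leqNgt j2j => /(_ isT).
have R1K : B * K%:R <= R1 by rewrite lerDr.
have R1d : d * B <= R1 by rewrite lerDl mulr_ge0.
have jc1 : (c < j1 <= c')%N by rewrite cj1.
have jc2 : (c < j2 <= c')%N by rewrite cj2.
have [g1 g1'] := gap j1 jc1; have [g2 g2'] := gap j2 jc2.
have bT1 : T%:R <= a j1 by move: big1 T00; clra.
have bT2 : T%:R <= a' j2 by move: big2 T00; clra.
have g1R := le_trans g1 R1d; have g2R := le_trans g2' R1d.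
have yR1 := le_trans nyK R1K; have yR1' := le_trans nyK' R1K.
have [cn1 _] : conn h Bd T (hp y) (hp y - sc T%:R (v j1)) /\
    forall k : nat, ell a - T%:R + C2%:R + k%:R <= (wl h)%:R -> lifts_deep h Bd (hp y - sc T%:R (v j1)) k.
  apply: (hn2 a j1) => //.
  - by have := l_gt0 P; nlia.
  - have := sigmaE P j1 ap; rewrite (ps_recl (bv a)) => [e|]; last by have := l_gt0 P; nlia.
    have -> : ps (bv a) j1.+1 (j1 + m) = sigma a - bv a j1 by rewrite -e addrC addKr.
    by rewrite omBr /block_vec omZr omxx mulr0 subr0 omC normrN (le_trans g1).
have vj2 : v (j2 + m) = v j2 by apply: (v_per P).
have [cn2 gd2] : conn h Bd T (hp y') (hp y' - sc T%:R (v j2)) /\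
    forall k : nat, ell a' - T%:R + C2%:R + k%:R <= (wl h)%:R -> lifts_deep h Bd (hp y' - sc T%:R (v j2)) k.
  rewrite -vj2; apply: (hn2 a' j2.+1 y' (j2 + m)%N) => //; rewrite ?vj2 //.
  - by have := l_gt0 P; nlia.
  - by rewrite ap'.
  - by rewrite ?addSn psn om0r normr0.
have jn : conn h Bd (K + K) (hp y' - sc T%:R (v j2)) (hp y - sc T%:R (v j2)).
  have -> : hp y - sc T%:R (v j2) = hp y' - sc T%:R (v j2) + hp (y'^-1 * y)%g.
    rewrite hpM hp_inv; move: (hp y) (hp y') (sc _ _) => [? ?] [? ?] [? ?].
    by congr pair => /=; ring.
  apply: (conn_step (gd2 (K + K)%N _)) => //; last first.
    by rewrite (leq_trans (wlM S_sym S_gen _ _)) // wlV // leq_add.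
  have : (K + K)%:R <= T%:R :> R by rewrite ler_nat /T; nlia.
  by move: hiC'; clra.
suff mid : conn h Bd Ml (hp y - sc T%:R (v j1)) (hp y - sc T%:R (v j2)).
  have := conn_trans cn1 (conn_trans mid (conn_sym (conn_trans cn2 jn))).
  apply: conn_le; rewrite /M; nlia.
have [e12|n12] := eqVneq j1 j2.
  rewrite e12; apply: conn0; have [_] := conn_lifts_in (conn_trans cn2 jn); exact.
pose b := mix (1/2) a a'.
have bp : periodic b by apply: mix_per.
have b0 : forall k, 0 <= b k by apply: mix_ge0.
have sb : sigma b = sc (1/2) (sigma a) + sc (1/2) (sigma a').
  by rewrite /b sigma_mix; congr (sc _ _ + _); field.
have eb : ell b = 1/2 * ell a + 1/2 * ell a' by rewrite /b ell_mix; field.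
have bb1 : T%:R <= b j1 by rewrite /b /mixture; move: (a0' j1) big1; clra.
have bb2 : T%:R <= b j2 by rewrite /b /mixture; move: (a0 j2) big2; clra.
(* Two distinct blocks make the chord almost parallel to two independent directions, hence short. *)
have nP : nm (sigma a) <= Rp.
  case: (ltngtP j1 j2) n12 => // j12 _.
    by apply: (nm_cross _ g1 g2); nlia.
  by apply: (nm_cross _ g2 g1); nlia.
have nP' : nm (sigma a') <= Rp + d.
  have -> : sigma a' = sigma a + (hp y' - hp y).
    by rewrite sa sa' -!addrA; congr (_ + _); rewrite addrC subrK.
  by apply: le_trans (ler_nmD _ _) _; apply: lerD.
have nh : nm (hp h) <= Rp + B * K%:R.
  have -> : hp h = sigma a - hp y by rewrite sa addrK.
  by apply: le_trans (ler_nmB _ _) _; apply: lerD.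
have BK0 : 0 <= B * K%:R by rewrite mulr_ge0.
have q1 : 0 <= B * (Rp + d) by rewrite mulr_ge0 // addr_ge0.
have B3 : 0 <= B + 3 by rewrite addr_ge0.
have hR2 : nm (hp h) <= R2 by rewrite /R2; move: nh q1 B3 d0; clra.
have yR2 : nm (hp y) <= R2 by rewrite /R2; move: nyK q1 B3 d0 Rp0; clra.
have sR2 : nm (sigma b - (hp h + hp y)) <= R2.
  have -> : sigma b - (hp h + hp y) = sc (1/2) (hp y' - hp y).
    rewrite sb sa sa'; move: (hp h) (hp y) (hp y') => [? ?] [? ?] [? ?].
    by rewrite /sc; congr pair => /=; field.
  rewrite nmZ ger0_norm; last by case/andP: half.
  by rewrite /R2; move: yd (nm_ge0 (hp y' - hp y)) q1 B3 Rp0 BK0; clra.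
have tb x : nm (hp x) <= B * K%:R -> `|zt h| <= `|tau h (hp x)| + (wl h)%:R.
  move=> xb; have -> : zt h = tau h (hp x) - om (hp h) (hp x) by rewrite /area_target; ring.
  apply: le_trans (ler_normB _ _) _; rewrite lerD2l; apply: le_trans nX2.
  by apply: le_trans (ler_om _ _) _; rewrite ler_pM ?nm_ge0.
(* With a bounded chord all cuts give the same area up to a linear error. *)
have arb k : `|zt h| <= area k b + R2 * (wl h)%:R.
  have x1 := area_cut c.+1 k ap a0.
  have x2 := area_cut c'.+1 k ap' a0'.
  have x3 : B * ell a * nm (sigma a) <= B * (Rp + d) * (wl h)%:R.
    rewrite -!mulrA ler_wpM2l // mulrC; apply: ler_pM; rewrite ?nm_ge0 ?(ell_ge0 a0) //; move: hiL Ls0 nP d0; clra.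
  have x4 : B * ell a' * nm (sigma a') <= B * (Rp + d) * (wl h)%:R.
    rewrite -!mulrA ler_wpM2l // mulrC; apply: ler_pM; rewrite ?nm_ge0 ?(ell_ge0 a0') //; move: hiL' Ls0; clra.
  have x5 := tb _ nyK; have x6 := tb _ nyK'.
  have x7 : area k (fun j => a j - a' j) <= X3.
    apply: le_trans (neg _ _ _) _; first by move=> j; rewrite ap ap'.
    rewrite /X3 ler_wpM2l //.
    have s1 : nm (sigma (fun j => a j - a' j)) <= d.
      by rewrite sigmaB sa sa' opprD addrACA subrr add0r -nmN opprB.
    have s2 : `|ell (fun j => a j - a' j)| <= d by rewrite /block_length sumrB.
    have s3 : nm (sigma (fun j => a j - a' j)) ^+ 2 <= d ^+ 2 by rewrite ler_sqr ?nnegrE ?nm_ge0.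
    have s4 : ell (fun j => a j - a' j) ^+ 2 <= d ^+ 2 by rewrite -(real_normK (num_real _)) ler_sqr ?nnegrE.
    by move: s3 s4; clra.
  have x8 := mulr_ge0 (addr_ge0 (addr_ge0 Rp0 BK0) d0) W0.
  rewrite /b area_mix /R2; move: x1 x2 x3 x4 x5 x6 x7 x8 ta ta' nX3 W0; clra.
have ebl : (wl h)%:R + 2 * T%:R <= 2 * ell b by rewrite eb; move: lo lo'; clra.
have ebh : ell b <= (wl h)%:R by rewrite eb; move: hiL hiL' Ls0; clra.
case: (ltngtP j1 j2) n12 => // j12 _.
  by apply: (hn3 b) => //; nlia.
by apply: conn_sym; apply: (hn3 b) => //; nlia.
Qed.

Lemma tight_rep_cong h c c' k k' a y : (c + k * m = c' + k' * m)%N -> tight_rep h c a y -> tight_rep h c' a y.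
Proof.
move=> e [ap a0 sa la [co ta]]; split=> //; split.
  rewrite /vertex_cone -(v_perM P c' k') -(v_perM P c'.+1 k') addSn -e -addSn.
  by rewrite !(v_perM P).
by rewrite -(area_perM c'.+1 k' ap) addSn -e -addSn area_perM.
Qed.

(** Cuts count only modulo a full turn: one of the two follows the other within [l], and [conn] is
    symmetric. *)
Lemma conn_near : exists L, forall K : nat, exists M, forall Bd, (M <= Bd)%N -> exists n0, forall h,
  (n0 <= wl h)%N -> forall y y', (wl y <= K)%N -> (wl y' <= K)%N ->
  (wl (h * y)%g + L <= wl h)%N -> (wl (h * y')%g + L <= wl h)%N ->
  conn h Bd M (hp y) (hp y').
Proof.
have [L aux] := conn_ordered_cuts.
exists L => K; have [M {}aux] := aux K; exists M => Bd MB; have [n0 {}aux] := aux Bd MB.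
pose X := B * K%:R + (B * K%:R) ^+ 2.
have B0 := B_ge0.
have X0 : 0 <= X by rewrite addr_ge0 ?mulr_ge0 ?sqr_ge0.
exists (n0 + Num.bound X)%N => h hn y y' yK yK' yL yL'.
have n0h : (n0 <= wl h)%N by rewrite (leq_trans _ hn) // leq_addr.
have nX : X <= (wl h)%:R.
  apply: ltW; apply: lt_le_trans (archi_boundP X0) _.
  by rewrite ler_nat (leq_trans _ hn) // leq_addl.
have mk x : (wl x <= K)%N -> (wl (h * x)%g + L <= wl h)%N -> exists a c, tight_rep h c a x.
  move=> xK xL; have [a [c [ap a0 sa la [co ta]]]] := dominate_elt (h * x)%g.
  exists a, c; split=> //; first by rewrite sa hpM.
  split; first by rewrite sa.
  have -> : tau h (hp x) = zt (h * x)%g - zt x by rewrite ztM /area_target; ring.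
  apply: le_trans (ler_normB _ _) _.
  have h1 : `|zt x| <= (wl h)%:R.
    apply: le_trans nX; apply: le_trans (zt_wl x) _.
    have b1 : B * (wl x)%:R <= B * K%:R by rewrite ler_wpM2l // ler_nat.
    by rewrite lerD // ler_sqr // nnegrE mulr_ge0.
  have h2 : B * (wl (h * x)%g)%:R <= B * (wl h)%:R.
    by rewrite ler_wpM2l // ler_nat (leq_trans _ xL) // leq_addr.
  lra.
have [a [c r]] := mk y yK yL; have [a' [c' r']] := mk y' yK' yL'.
have [k [q [q' [/andP[ck kc] e]]]] := modn_rep P c c'.
have {}r' : tight_rep h k a' y' by apply: tight_rep_cong r'; exact: esym e.
case: (leqP k (c + l)) => kl; first exact: (aux h n0h y y' a a' c k).
apply: conn_sym; apply: (aux h n0h y' y a' a k (c + m)%N) => //; last 2 first.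
- exact: ltnW.
- by rewrite addnA leq_add2r ltnW.
by apply: (@tight_rep_cong h c (c + m)%N 1 0) r; rewrite mul1n mul0n addn0.
Qed.

Lemma central_shift : exists C : nat, forall E, exists n0, forall g, (n0 <= wl g)%N ->
  forall z, hp z = 0 -> (wl z <= E)%N -> (wl (g * z)%g <= wl g + C)%N.
Proof.
have [C2 gp] := wl_good_point (lexx 0) B_ge0.
exists C2 => E; have [n0 hn0] := gp E; exists n0 => g gn z z0 zE.
have [a [c [ap a0 sa la [co ta]]]] := dominate_elt g.
rewrite -(ler_nat R) natrD -la; apply: (hn0 g gn a c.+1 0) => //.
- by rewrite addr0 sa subrr nm0.
- by rewrite /area_target om0r addr0.
- by rewrite la ler_peMl // ler1n.
Qed.

(** The end [y'] is prescribed only in the plane; its central coordinate depends on the letters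
    used, whence the element [z] of [close_walk]. *)
Lemma conn_walk h Bd M q q' : conn h Bd M q q' ->
  forall y, hp y = q -> (wl y + M <= Bd)%N -> exists y',
    [/\ hp y' = q', (wl y' <= wl y + M)%N & walk S (wl h) M (h * y)%g (h * y')%g].
Proof.
elim=> {M q q'} [M q gq|M q s q' gq sS _ IH] y yq yB.
  exists y; split=> //; first exact: leq_addr.
  exists [::]; split=> // x; rewrite inE => /eqP ->.
  by apply: gq => //; exact: leq_trans (leq_addr _ _) yB.
have ys : (wl (y * s)%g <= wl y + 1)%N.
  by rewrite (leq_trans (wlM S_sym S_gen _ _)) // leq_add2l wl_letter.
have [||y' [y'q y'B [p [[p1 p2] ps pb]]]] := IH (y * s)%g.
- by rewrite hpM yq.
- by nlia.
exists y'; split=> //; first by nlia.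
exists ((h * (y * s))%g :: p); split=> //.
- split=> //; apply/andP; split=> //.
  by rewrite /cayley /= (mulgA h) mulKg.
move=> x; rewrite inE => /orP[/eqP ->|/pb //].
by apply: gq => //; nlia.
Qed.

(* Descend from [g1] and [g2] along geodesics, join the two points up to a central
   element [z], and undo [z] after a further descent towards [1]. *)
Lemma close_walk k : exists N, forall g1 g2, wl g1 = wl g2 -> (wl (g1^-1 * g2)%g <= k)%N ->
  walk S (wl g1) N g1 g2.
Proof.
have [L hcore] := conn_near.
have [C hC] := central_shift.
(* The depth [L] is for [conn_near] and [C] for the cost of [z] along the geodesic to [g2]. [K]
   bounds both displacements from [g1], [E] the length of [z], and at depth [Lt + L2] there is room
   to spell [z]. *)
pose Lt := (L + C)%N; pose K := (Lt + k)%N; have [M hM] := hcore K.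
pose E := (K + K + M)%N; pose L2 := (E + C)%N.
have [n0 hn0] := hM (K + M)%N (leq_addl _ _); have [n1 hn1] := hC E.
pose n2 := (n0 + n1 + Lt + L2)%N.
exists ((n2 + n2) + (Lt + M + L2 + E + (L2 + Lt)))%N => g1 g2 eg kg.
have [w1 [w1S w1g s1]] := wl_word S_sym S_gen g1.
have [w2 [w2S w2g s2]] := wl_word S_sym S_gen g2.
have pre1 i : (i <= wl g1)%N -> wl (wprod (take i w1)) = i.
  by move=> iw; apply: wl_prefix => //; rewrite ?w1g ?s1.
have pre2 i : (i <= wl g1)%N -> wl (wprod (take i w2)) = i.
  by move=> iw; apply: wl_prefix => //; rewrite ?w2g ?s2 -?eg.
have suf1 i : walk S (wl g1) (wl g1 - i) (wprod (take i w1)) g1.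
  by rewrite -{2}s1 -[in X in walk _ _ _ _ X]w1g; apply: walk_suffix; rewrite // s1.
have suf2 i : walk S (wl g1) (wl g1 - i) (wprod (take i w2)) g2.
  by rewrite {2}eg -s2 -[in X in walk _ _ _ _ X]w2g; apply: walk_suffix; rewrite // s2 eg.
set n := wl g1 in eg pre1 pre2 suf1 suf2 *.
(* For bounded [n] the path through [1] is short enough. *)
have [n_small|n_big] := leqP n n2.
  have := suf2 0; have := suf1 0; rewrite !take0 => /(walk_sym S_sym) h1 h2.
  by apply: walk_le (walk_trans h1 h2); nlia.
pose p1 := wprod (take (n - Lt) w1); pose p2 := wprod (take (n - Lt) w2).
pose x := wprod (take (n - Lt - L2) w2); pose d := drop (n - Lt - L2) (take (n - Lt) w2).
pose y := (g1^-1 * p1)%g; pose y' := (g1^-1 * p2)%g.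
have drop_le w i : {subset w <= S} -> size w = n -> (wl (wprod (drop i w)) <= n - i)%N.
  by move=> wS <-; rewrite -size_drop; apply: wl_prod => // s /mem_drop /wS.
have yK : (wl y <= Lt)%N.
  rewrite /y -w1g -{1}(cat_take_drop (n - Lt) w1) big_cat invgM -mulgA mulVg mulg1 wlV //.
  by rewrite (leq_trans (drop_le _ _ w1S s1)) //; nlia.
have y'K : (wl y' <= K)%N.
  have -> : y' = ((g1^-1 * g2) * (wprod (drop (n - Lt) w2))^-1)%g.
    by rewrite -w2g -{1}(cat_take_drop (n - Lt) w2) big_cat !mulgA mulgK.
  rewrite (leq_trans (wlM S_sym S_gen _ _)) // wlV // /K addnC leq_add //.
  by rewrite (leq_trans (drop_le _ _ w2S _)) ?s2 ?eg //; nlia.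
have hy : (g1 * y)%g = p1 by rewrite mulVKg.
have hy' : (g1 * y')%g = p2 by rewrite mulVKg.
have cn : conn g1 (K + M) M (hp y) (hp y').
  apply: hn0 => //; first by rewrite -/n; nlia.
  - by rewrite (leq_trans yK) // leq_addr.
  - by rewrite hy pre1 -/n; nlia.
  - by rewrite hy' pre2 -/n; nlia.
have [|y'' [y''q y''B]] := conn_walk cn (y := y) erefl; first by nlia.
rewrite hy -/n; pose z := (y'^-1 * y'')%g.
have -> : (g1 * y'')%g = (p2 * z)%g by rewrite /z -hy' -(mulgA g1) mulVKg.
move=> walkB.
have z0 : hp z = 0 by rewrite /z hpM hp_inv y''q addNr.
have zE : (wl z <= E)%N.
  by rewrite (leq_trans (wlM S_sym S_gen _ _)) // wlV //; nlia.
have xd i : (i <= L2)%N -> (x * wprod (take i d))%g = wprod (take (n - Lt - L2 + i) w2).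
  move=> iL; rewrite takeD big_cat; congr (_ * wprod _)%g.
  have -> : d = take L2 (drop (n - Lt - L2) w2) by rewrite take_drop; congr (drop _ (take _ _)); nlia.
  by rewrite take_takel.
have sd : size d = L2 by rewrite size_drop size_takel ?s2 -?eg; nlia.
have dS : {subset d <= S} by move=> s /mem_drop /mem_take /w2S.
have walkC : walk S n L2 (x * z)%g (p2 * z)%g.
  have -> : (p2 * z)%g = (x * z * wprod d)%g.
    rewrite -(mulgA x) (centralE _ z0) (mulgA x) -[d]take_size sd xd //; congr (wprod (take _ _) * z)%g; nlia.
  rewrite -sd; apply: walk_word => // i; rewrite sd => iL.
  rewrite -(mulgA x) (centralE _ z0) (mulgA x) xd // (leq_trans (hn1 _ _ _ z0 zE)) ?pre2; nlia.
have walkD : walk S n E x (x * z)%g.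
  have [u [uS uz us]] := wl_word S_sym S_gen z.
  apply: (walk_le zE); rewrite -us -uz; apply: walk_word => // i iu.
  rewrite (leq_trans (wlM S_sym S_gen _ _)) // pre2; last by nlia.
  have : (wl (wprod (take i u)) <= i)%N.
    by rewrite -{2}(size_takel iu); apply: wl_prod => // s /mem_take /uS.
  by rewrite us in iu; nlia.
have := walk_trans (walk_sym S_sym (suf1 (n - Lt)%N)) (walk_trans walkB
  (walk_trans (walk_sym S_sym walkC) (walk_trans (walk_sym S_sym walkD) (suf2 (n - Lt - L2)%N)))).
by apply: walk_le; nlia.
Qed.

End Realization.

(** * Projections of a generating set *)

Section Generators.
Local Open Scope ring_scope.
Variable R : archiRealFieldType.
Local Notation hp := (planar R).
Variable S : {fset heisenberg}.
Hypothesis S_sym : symmetric_set S.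
Hypothesis S_gen : generating S.

(** Otherwise symmetry of [S] forces [om q] to vanish on all projected generators. The elements on
    which it vanishes form a subgroup containing [S], hence everything, and the two unit vectors
    give [q = 0]. *)
Lemma generator_turn (q : R * R) : q != 0 -> exists2 t, t \in S & 0 < om q (hp t).
Proof.
move=> q0; case: (pselect (exists2 t, t \in S & 0 < om q (hp t))) => // nex; case/eqP: q0.
have om_le0 t : t \in S -> om q (hp t) <= 0.
  by move=> tS; rewrite leNgt; apply/negP => tq; apply: nex; exists t.
pose H := [pred g | om q (hp g) == 0].
have inH g : g \in H.
  apply: S_gen => [|t tS].
    split; first by rewrite inE hp1 om0r.
    by move=> x y; rewrite !inE hpM hp_inv omBr => /eqP -> /eqP ->; rewrite subrr.
  have := om_le0 _ (S_sym tS); rewrite hp_inv omNr inE eq_le om_le0 //=; lra.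
have /eqP := inH (mkh 0 1 0); have /eqP := inH (mkh 1 0 0).
rewrite /om /planar !(hx_mkh, hy_mkh) /= !(mulr0, mulr1, subr0, sub0r) => /eqP.
by rewrite oppr_eq0 => /eqP q2 q1; rewrite [q]surjective_pairing q1 q2.
Qed.

End Generators.

Theorem theorem39 (S : {fset heisenberg})
    (S_sym : symmetric_set S) (S_gen : generating S) :
  forall k : nat, exists N : nat, forall (n : nat) (g1 g2 : heisenberg),
    word_length S g1 = n -> word_length S g2 = n ->
    cayley_dist S g1 g2 <= k ->
    exists p : seq heisenberg,
      [/\ path_between S g1 g2 p,
          size p <= N &
          {subset g1 :: p <= cayley_ball S n}].
Proof.
move=> k; pose hp := planar rat.
have [B B1 hB] := @letter_bound S rat.
pose V := [seq hp s | s <- S].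
have hpV s : s \in S -> hp s \in V by move=> sS; apply: map_f.
have V_sym q : q \in V -> (- q)%R \in V.
  by case/mapP => s sS ->; rewrite -hp_inv hpV // S_sym.
have V_turn q : q \in V -> q != 0%R -> exists2 t, t \in V & (0 < om q t)%R.
  by move=> _ /(generator_turn S_sym S_gen) [t tS tq]; exists (hp t); rewrite ?hpV.
have V_neq0 : exists2 q, q \in V & q != 0%R.
  have [|t tS t0] := @generator_turn rat S S_sym S_gen (1, 0)%R; first by [].
  by exists (hp t); rewrite ?hpV //; apply/eqP => e; move: t0; rewrite -/hp e om0r ltxx.
have [l [v P]] := exists_polygon V_sym V_turn V_neq0.
have /choice [sl hsl] j : exists s, s \in S /\ hp s = v j.
  by have /mapP [s sS ->] := poly_in P j; exists s.
(* Vertices have integer coordinates, so a positive [om] is at least 1. *)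
have om_ge1 j j' : j < j' < j + l -> (1 <= om (v j) (v j'))%R.
  case/andP => j1 j2; have := poly_pos P j1 j2.
  rewrite -(hsl j).2 -(hsl j').2 /om /hp /planar /= -!intrM -intrB ltr0z -[1%R]/(1%:~R)%R ler_int.
  lia.
have [N hN] := close_walk S_sym S_gen B1 (fun s sS => (hB s sS).1) (fun s sS => (hB s sS).2) hpV P
   om_ge1 (fun j => (hsl j).1) (fun j => (hsl j).2) k.
exists N => n g1 g2 <- e /(wl_dist S_sym S_gen) gk.
exact: hN.
Qed.
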